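(* For all $\nu\in(0,1)$, the quantity $$\mu(\nu)=\inf_{0\not\equiv\phi\in C^\infty_0(\mathbb{R}^3,\mathbb{C}^2)}\frac{\mathcal{E}_{1,\nu}[\phi]}{\|\phi\|_{L^2(\mathbb{R}^3)}^2}$$ is negative and finite, the critical magnetic field $B(\nu)$ satisfies $$B(\nu)=\frac{4}{\mu(\nu)^2},$$ and $\nu\mapsto B(\nu)$ is a continuous, monotone decreasing function of $\nu$ on $(0,1)$.
   Context: Let $\sigma=(\sigma_1,\sigma_2,\sigma_3)$ be the Pauli matrices $$\sigma_1=\begin{pmatrix}0&1\\1&0\end{pmatrix},\quad \sigma_2=\begin{pmatrix}0&-i\\ i&0\end{pmatrix},\quad \sigma_3=\begin{pmatrix}1&0\\0&-1\end{pmatrix}.$$ For $B\ge 0$ and $x=(x_1,x_2,x_3)\in\mathbb{R}^3$ let $A_B(x)=\frac B2(-x_2,x_1,0)$ and $P_B:=-i\,\sigma\cdot(\nabla-i\,A_B(x))$, acting on $\mathbb{C}^2$-valued functions (2-spinors). For $\nu\in(0,1)$, $B>0$ define $$\mathcal{E}_{B,\nu}[\phi]:=\int_{\mathbb{R}^3}\frac{|x|}{\nu}\,|P_B\phi|^2\,d^3x-\int_{\mathbb{R}^3}\frac{\nu}{|x|}\,|\phi|^2\,d^3x$$ (so $\mathcal{E}_{1,\nu}$ is the case $B=1$), and, for $\lambda\ge-1$, $$J[\phi,\lambda,\nu,B]:=\int_{\mathbb{R}^3}\left(\frac{|P_B\phi|^2}{1+\lambda+\frac{\nu}{|x|}}+(1-\lambda)|\phi|^2-\frac{\nu}{|x|}|\phi|^2\right)d^3x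 .$$ Let $\mathcal{A}(\nu,B)$ be the set of $\phi\in C_0^\infty(\mathbb{R}^3,\mathbb{C}^2)$ with $\|\phi\|_{L^2(\mathbb{R}^3)}=1$ such that $\lambda\mapsto J[\phi,\lambda,\nu,B]$ changes sign in $(-1,+\infty)$. Let $\lambda[\phi,\nu,B]$ be the unique solution $\lambda\in(-1,+\infty)$ of $J[\phi,\lambda,\nu,B]=0$ if $\phi\in\mathcal{A}(\nu,B)$, and $\lambda[\phi,\nu,B]:=-1$ if $J[\phi,-1,\nu,B]\le 0$. Put $$\lambda_1(\nu,B):=\inf_{\phi\in\mathcal{A}(\nu,B)}\lambda[\phi,\nu,B].$$ (When it lies in $(-1,1)$, $\lambda_1(\nu,B)$ is the smallest eigenvalue in $(-1,1)$ of the magnetic Dirac operator $\begin{pmatrix}\mathbb{I}-\nu/|x| & P_B\\ P_B & -\mathbb{I}-\nu/|x|\end{pmatrix}$.) The critical magnetic field is $$B(\nu):=\inf\left\{B>0\;:\;\liminf_{b\nearrow B}\lambda_1(\nu,b)=-1\right\}.$$ *)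

(* Defs.v *)
From HB Require Import structures.
From mathcomp Require Import all_boot all_order all_algebra.
From mathcomp Require Import all_classical all_reals all_analysis.
From mathcomp Require Import complex.

Set Implicit Arguments.
Unset Strict Implicit.
Unset Printing Implicit Defensive.

Import Order.TTheory GRing.Theory Num.Theory numFieldNormedType.Exports.

Local Open Scope classical_set_scope.
Local Open Scope ring_scope.

(* R^3 is the product [R * R * R], which carries both a normed-module structure
   (used for derivatives, continuity, compactness) and the product Borel
   sigma-algebra; the norm it comes with is the sup norm, hence [enorm3]. *)
Definition space3 (R : realType) := (R * R * R)%type.
Definition spinor (R : realType) := 'cV[R[i]]_2.

Section Defs.
Variable R : realType.
Implicit Types (B nu lam : R) (x : R * R * R) (v : spinor R)
  (phi : space3 R -> spinor R).

Definition leb3 := ((@lebesgue_measure R \x @lebesgue_measure R)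
                      \x @lebesgue_measure R)%E.

Definition enorm3 x : R := Num.sqrt (x.1.1 ^+ 2 + x.1.2 ^+ 2 + x.2 ^+ 2).

Definition spinor_sqnorm v : R :=
  \sum_(a < 2) (complex.Re (v a ord0) ^+ 2 + complex.Im (v a ord0) ^+ 2).

Definition basis3 (j : 'I_3) : R * R * R :=
  tnth [tuple (1, 0, 0); (0, 1, 0); (0, 0, 1)] j.

Definition partial (j : 'I_3) (f : R * R * R -> R) : R * R * R -> R :=
  'D_(basis3 j) f.

(* C^oo: every iterated partial derivative exists and is continuous. *)
Definition smooth (f : R * R * R -> R) : Prop :=
  forall s : seq 'I_3, let g := foldr partial f s in
    continuous g /\ forall x (j : 'I_3), derivable g x (basis3 j).

Definition re_part phi (a : 'I_2) : R * R * R -> R :=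
  fun x => complex.Re (phi x a ord0).
Definition im_part phi (a : 'I_2) : R * R * R -> R :=
  fun x => complex.Im (phi x a ord0).

Definition test_spinor phi : Prop :=
  (forall a, smooth (re_part phi a) /\ smooth (im_part phi a)) /\
  compact (closure [set x : R * R * R | phi x != 0]).

Definition spinor_partial (j : 'I_3) phi : space3 R -> spinor R :=
  fun x => \col_(a < 2)
    Complex (partial j (re_part phi a) x) (partial j (im_part phi a) x).

Definition mx22 (a b c d : R[i]) : 'M[R[i]]_2 :=
  \matrix_(i < 2, j < 2)
    if i == 0 then (if j == 0 then a else b) else (if j == 0 then c else d).

Definition pauli (j : 'I_3) : 'M[R[i]]_2 :=
  tnth [tuple mx22 0 1 1 0; mx22 0 (- 'i%C) 'i%C 0; mx22 1 0 0 (-1)] j.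

Definition vecpot B x (j : 'I_3) : R :=
  B / 2 * tnth [tuple - x.1.2; x.1.1; 0] j.

Definition magnetic_pauli B phi : space3 R -> spinor R := fun x =>
  - 'i%C *: \sum_(j < 3)
     pauli j *m (spinor_partial j phi x - ('i%C * (vecpot B x j)%:C%C) *: phi x).

(* The integrals below are the real-valued ones of the library (0 on a
   non-integrable function). For test spinors all the integrands are integrable
   since 1/|x| is locally integrable on R^3. Where a quotient by |x| appears,
   the value taken at x = 0 is irrelevant. *)
Definition L2norm phi : R :=
  Num.sqrt (\int[leb3]_x spinor_sqnorm (phi x)).

Definition energy B nu phi : R :=
  \int[leb3]_x (enorm3 x / nu * spinor_sqnorm (magnetic_pauli B phi x))
  - \int[leb3]_x (nu / enorm3 x * spinor_sqnorm (phi x)).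

Definition J phi lam nu B : R :=
  \int[leb3]_x
    (spinor_sqnorm (magnetic_pauli B phi x) / (1 + lam + nu / enorm3 x)
     + (1 - lam) * spinor_sqnorm (phi x)
     - nu / enorm3 x * spinor_sqnorm (phi x)).

Definition admissible nu B : set (space3 R -> spinor R) :=
  [set phi | [/\ test_spinor phi,
                 L2norm phi = 1,
                 exists2 lam, -1 < lam & 0 < J phi lam nu B
               & exists2 lam, -1 < lam & J phi lam nu B < 0]].

(* [J phi ^~ nu B] is strictly decreasing on ]-1, +oo[ for normalized test
   spinors, so that [xget] selects its unique zero when it changes sign, and
   not changing sign means J <= 0 at -1. *)
Definition lambda nu B phi : R :=
  if `[< admissible nu B phi >]
  then xget (-1) [set lam | -1 < lam /\ J phi lam nu B = 0] else -1.

Definition lambda1 nu B : \bar R :=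
  ereal_inf [set (lambda nu B phi)%:E | phi in admissible nu B].

Definition Bcrit nu : \bar R :=
  ereal_inf [set B%:E | B in
    [set B | 0 < B /\ limf_einf (lambda1 nu) (B^'-) = (-1)%:E]].

Definition mu nu : \bar R :=
  ereal_inf [set (energy 1 nu phi / L2norm phi ^+ 2)%:E | phi in
    [set phi | test_spinor phi /\ exists x, phi x != 0]].

End Defs.

(* Main.v *)
(** Writing [kin], [pot], [mass] for the integrals of |x| |P_B phi|^2, |phi|^2 / |x|
    and |phi|^2, one has E_{B,nu} = kin / nu - nu pot, and the change of scale
    phi -> phi(c x) shows that the infimum of E_{B,nu} / mass is sqrt B mu(nu).

    - mu is finite: without field, the Dirac-Hardy inequality pot <= kin follows by
      integrating the null Lagrangians formed by the components of phi and the vector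
      field |x| x; a cutoff chi = 1 / (1 + k |x|^2) makes the magnetic term and the errors
      bounded by mass.
    - mu < 0: spin-up zero modes exp (- (x1^2 + x2^2) / 4) of P_1, cut off at distance S,
      have kin bounded and pot of order ln S.
    - nu mu(nu) is an infimum of functions that are affine in nu^2, hence concave in
      nu^2; this gives continuity, and mu(nu2) <= (nu2 / nu1) mu(nu1) gives strict
      monotonicity.
    - J at lambda = -1 equals E_{B,nu} + 2 mass, and J decreases in lambda, so a
      normalised phi is admissible exactly when E_{B,nu}[phi] + 2 > 0. If
      sqrt B mu(nu) > -2, the same cutoff, used at a coupling slightly above nu, shows
      that J stays positive near lambda = -1 uniformly in phi and in smaller fields, so
      that lambda_1 is bounded away from -1. If sqrt B mu(nu) < -2, moving from a spinor
      with E + 2 mass < 0 to one with E + 2 mass > 0 crosses spinors where this quantity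
      is positive and arbitrarily small, so that lambda_1 = -1. *)

(* The value 4 is the square of the coefficient 1 - lambda = 2 that the mass has in [J] at lambda =
   -1: criticality means sqrt B mu(nu) = -2. The Hardy inequality holds with constant 1, so every
   Young inequality that separates the field or the cutoff from the kinetic term costs a factor 1 +
   d that only the slack nu < 1 can pay. This is why finiteness of mu uses 1 + d = 1 / nu, and why
   subcritical bounds are taken at the coupling nu (1 + d), which continuity of mu makes harmless.
   The weights |x| and 1 / |x| are not smooth at the origin, whereas integration by parts is set up
   for smooth functions of bounded support; they are replaced by sqrt (|x|^2 + e) and its inverse,
   and e tends to 0 at the end. All pointwise algebra is done on the four real components of a
   spinor, where the spinor inequalities become sums of squares that [ring] can verify. *)
Require Import Defs.
From HB Require Import structures.
From mathcomp Require Import all_boot all_order all_algebra.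
From mathcomp Require Import all_classical all_reals all_analysis.
From mathcomp Require Import complex ring lra measurable_realfun gauss_integral.
Set Implicit Arguments.
Unset Strict Implicit.
Unset Printing Implicit Defensive.
Import Order.TTheory GRing.Theory Num.Theory numFieldNormedType.Exports.
Local Open Scope classical_set_scope.
Local Open Scope ring_scope.

(** * Calculus of smooth functions on R^3 *)

Section Calculus.
Variable R : realType.
Notation V := (R * R * R)%type.
Implicit Types (f g : V -> R) (x v : V) (j : 'I_3).

Lemma derive_line f x v : 'D_v f x = 'D_1 (fun t : R => f (t *: v + x)) 0.
Proof.
rewrite /derive; set g1 := fun h => h^-1 *: _; set g2 := fun h => h^-1 *: _.
suff -> : g1 = g2 by [].
by rewrite funeqE /g1 /g2 => h /=; rewrite addr0 scale0r add0r [_%:A]mulr1.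
Qed.

Lemma derivable_comp_line (h g : R -> R) (t : R) :
  derivable h (g t) 1 -> derivable g t 1 -> derivable (h \o g) t 1.
Proof.
move=> dh dg; apply: (derivable1_diffP (h \o g) t).2.
apply: differentiable_comp; first exact: (derivable1_diffP g t).1 dg.
exact: (derivable1_diffP h (g t)).1 dh.
Qed.

Lemma is_derive_chain (h : R -> R) (dh : R) f x v (df : R) :
  is_derive (f x) 1 h dh -> is_derive x v f df ->
  is_derive x v (h \o f) (dh * df).
Proof.
move=> [hd hE] [fd fE].
pose g (t : R) : R := f (t *: v + x).
have g0 : g 0 = f x by rewrite /g scale0r add0r.
have gd : derivable g 0 1 by exact: (derivable1P f x v).1 fd.
have gE : 'D_1 g 0 = df by rewrite -fE derive_line.
rewrite -g0 in hd hE; split.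
  apply: (derivable1P (h \o f) x v).2.
  exact: (@derivable_comp_line h g 0 hd gd).
rewrite derive_line; have := derive1_comp gd hd.
by rewrite !derive1E hE gE.
Qed.

(** The product rule does not express iterated partials of a product as a word of partials of one
    function, so closure properties of [smooth] are proved through this finite order, by an
    induction that covers all functions at once. *)
Fixpoint Cn n f : Prop :=
  continuous f /\
  if n is n'.+1 then
    forall j, (forall x, derivable f x (basis3 R j)) /\ Cn n' (partial j f)
  else True.

(** [foldr] puts the last letter of the word innermost, so [rcons] peels off the derivative that is
    taken first. *)
Lemma smoothP f :
  smooth f <-> [/\ continuous f, forall j x, derivable f x (basis3 R j)
    & forall j, smooth (partial j f)].
Proof.
split=> [sf|[cf df sf] s].
  split; first exact: (sf [::]).1.
    by move=> j x; exact: (sf [::]).2.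
  by move=> j s; have := sf (rcons s j); rewrite foldr_rcons.
case/lastP: s => [|s j] /=; first by split.
by rewrite foldr_rcons; exact: sf.
Qed.

Lemma smooth_Cn f : smooth f <-> forall n, Cn n f.
Proof.
split=> [sf n|].
  elim: n f sf => [|n IH] f /smoothP[cf df sf] /=; first by [].
  by split=> // j; split; [exact: df|exact: IH].
move=> Cf s; elim/last_ind: s f Cf => [|s j IH] f Cf /=.
  by split; [exact: (Cf 0%N).1|move=> x j; exact: ((Cf 1%N).2 j).1].
by rewrite foldr_rcons; apply: IH => n; exact: ((Cf n.+1).2 j).2.
Qed.

Lemma smooth_cont f : smooth f -> continuous f.
Proof. by move=> /smoothP[]. Qed.
Lemma smooth_derivable f : smooth f -> forall j x, derivable f x (basis3 R j).
Proof. by move=> /smoothP[]. Qed.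
Arguments smooth_derivable f : clear implicits.
Lemma smooth_partial f : smooth f -> forall j, smooth (partial j f).
Proof. by move=> /smoothP[]. Qed.

Lemma CnW n f : Cn n.+1 f -> Cn n f.
Proof.
elim: n f => [|n IH] f [cf H]; first by split.
by split=> // j; split; [exact: (H j).1|exact/IH/(H j).2].
Qed.

Lemma partialD f g j : (forall x, derivable f x (basis3 R j)) ->
  (forall x, derivable g x (basis3 R j)) ->
  partial j (f \+ g) = partial j f \+ partial j g.
Proof. by move=> df dg; apply/funext => x; rewrite /partial deriveD. Qed.

Lemma partialN f j : (forall x, derivable f x (basis3 R j)) ->
  partial j (\- f) = \- partial j f.
Proof. by move=> df; apply/funext => x; rewrite /partial deriveN. Qed.

Lemma partialM f g j : (forall x, derivable f x (basis3 R j)) ->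
  (forall x, derivable g x (basis3 R j)) ->
  partial j (f \* g) = (f \* partial j g) \+ (g \* partial j f).
Proof. by move=> df dg; apply/funext => x; rewrite /partial deriveM. Qed.

Lemma partial_cst (c : R) j : partial j (cst c) = cst 0.
Proof. by apply/funext => x; rewrite /partial derive_cst. Qed.

Lemma CnD n f g : Cn n f -> Cn n g -> Cn n (f \+ g).
Proof.
elim: n f g => [|n IH] f g [cf Hf] [cg Hg]; split => //=.
- by move=> x; exact: cvgD (cf x) (cg x).
- by move=> x; exact: cvgD (cf x) (cg x).
move=> j; split; first by move=> x; apply: derivableD; [case: (Hf j)|case: (Hg j)].
rewrite partialD; [|by case: (Hf j)|by case: (Hg j)].
by apply: IH; [case: (Hf j)|case: (Hg j)].
Qed.

Lemma CnN n f : Cn n f -> Cn n (\- f).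
Proof.
elim: n f => [|n IH] f [cf Hf]; split => //=.
- by move=> x; exact: cvgN (cf x).
- by move=> x; exact: cvgN (cf x).
move=> j; split; first by move=> x; apply: derivableN; case: (Hf j).
rewrite partialN; last by case: (Hf j).
by apply: IH; case: (Hf j).
Qed.

Lemma CnM n f g : Cn n f -> Cn n g -> Cn n (f \* g).
Proof.
elim: n f g => [|n IH] f g Cf Cg.
  by split => // x; exact: cvgM (Cf.1 x) (Cg.1 x).
have [[cf Hf] [cg Hg]] := (Cf, Cg); split.
  by move=> x; exact: cvgM (cf x) (cg x).
move=> j; split; first by move=> x; apply: derivableM; [case: (Hf j)|case: (Hg j)].
rewrite partialM; [|by case: (Hf j)|by case: (Hg j)].
apply: CnD; apply: IH.
- exact: CnW.
- by case: (Hg j).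
- exact: CnW.
- by case: (Hf j).
Qed.

Lemma Cn_cst n (c : R) : Cn n (cst c).
Proof.
elim: n c => [|n IH] c; split => //=; try by move=> x; exact: cvg_cst.
by move=> j; split=> [x|]; [exact: derivable_cst|rewrite partial_cst].
Qed.

Lemma smooth_cst (c : R) : smooth (cst c).
Proof. by apply/smooth_Cn => n; exact: Cn_cst. Qed.
Lemma smoothD f g : smooth f -> smooth g -> smooth (f \+ g).
Proof. by rewrite !smooth_Cn => sf sg n; exact: CnD. Qed.
Lemma smoothN f : smooth f -> smooth (\- f).
Proof. by rewrite !smooth_Cn => sf n; exact: CnN. Qed.
Lemma smoothM f g : smooth f -> smooth g -> smooth (f \* g).
Proof. by rewrite !smooth_Cn => sf sg n; exact: CnM. Qed.
Lemma smoothB f g : smooth f -> smooth g -> smooth (f \- g).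
Proof. by move=> sf sg; exact: smoothD (smoothN sg). Qed.

(** Bootstrap for functions whose derivatives are expressed through members of the same family:
    order n for all members gives order n for each derivative, hence order n + 1 for all members. *)
Lemma smooth_family (I : Type) (F : I -> V -> R) :
  (forall i, continuous (F i)) ->
  (forall i j x, derivable (F i) x (basis3 R j)) ->
  (forall n i j, (forall k, Cn n (F k)) -> Cn n (partial j (F i))) ->
  forall i, smooth (F i).
Proof.
move=> cF dF HF i; apply/smooth_Cn => n; elim: n i => [|n IH] i; first by split.
by split => // j; split; [exact: dF|exact: HF].
Qed.

Lemma smooth_comp_family (I : Type) (h dh : I -> R -> R) f (D : set R) :
  smooth f -> (forall x, D (f x)) ->
  (forall i t, D t -> is_derive t 1 (h i) (dh i t)) ->
  (forall n i, (forall k, Cn n (h k \o f)) -> Cn n (dh i \o f)) ->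
  forall i, smooth (h i \o f).
Proof.
move=> sf Df hd Hd.
have dF i j x : is_derive x (basis3 R j) (h i \o f) (dh i (f x) * partial j f x).
  apply: is_derive_chain; first exact: hd.
  exact/derivableP/(smooth_derivable f sf).
apply: smooth_family.
- move=> i x; apply: continuous_comp; first exact: smooth_cont.
  by apply/differentiable_continuous/derivable1_diffP; case: (hd i (f x) (Df x)).
- by move=> i j x; case: (dF i j x).
- move=> n i j Fk.
  have -> : partial j (h i \o f) = (dh i \o f) \* partial j f.
    by apply/funext => x; rewrite /partial; case: (dF i j x).
  apply: CnM; first exact: Hd.
  exact: (smooth_Cn _).1 (smooth_partial sf j) n.
Qed.

(** The derivative of 1 / t is a polynomial in 1 / t, so a family with one member closes up. *)
Lemma smooth_inv f : smooth f -> (forall x, f x != 0) -> smooth (fun x => (f x)^-1).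
Proof.
move=> sf f0.
apply: (@smooth_comp_family unit (fun _ t => t^-1) (fun _ t => - (t^-1 * t^-1)) f
  [set t | t != 0]) => //=.
- move=> _ t t0.
  apply: is_derive_eq; first exact: (@is_deriveV _ id t 1 1 t0).
  by rewrite /= scaler1 expr2 invfM.
- by move=> n _ H; apply: CnN; apply: CnM; exact: (H tt).
Qed.

Lemma smooth_expR f : smooth f -> smooth (fun x => expR (f x)).
Proof.
move=> sf.
apply: (@smooth_comp_family unit (fun _ t => expR t) (fun _ t => expR t) f setT) => //=.
by move=> n _ H; exact: (H tt).
Qed.

Lemma is_derive_invsqrt (t : R) : 0 < t ->
  is_derive t 1 (fun s => (Num.sqrt s)^-1)
    (- 2^-1 * ((Num.sqrt t)^-1 * (Num.sqrt t)^-1 * (Num.sqrt t)^-1)).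
Proof.
move=> t0; have st0 : Num.sqrt t != 0 by rewrite sqrtr_eq0 -ltNge.
have ds := is_derive1_sqrt t0.
case: ds => d dE; split; first exact: derivableV.
rewrite (@deriveV _ _ Num.sqrt t 1 st0 d) dE /GRing.scale /=.
by field.
Qed.

Lemma smooth_invsqrt f : smooth f -> (forall x, 0 < f x) ->
  smooth (fun x => (Num.sqrt (f x))^-1).
Proof.
move=> sf f0.
apply: (@smooth_comp_family unit (fun _ t => (Num.sqrt t)^-1)
  (fun _ t => - 2^-1 * ((Num.sqrt t)^-1 * (Num.sqrt t)^-1 * (Num.sqrt t)^-1)) f
  [set t | 0 < t]) => //=.
- by move=> _ t; exact: is_derive_invsqrt.
- move=> n _ H; apply: (@CnM _ (cst (- 2^-1))); first exact: Cn_cst.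
  by apply: CnM; [apply: CnM|]; exact: (H tt).
Qed.

(** The derivative of sqrt t is not a polynomial in sqrt t, whereas that of 1 / sqrt t is a
    polynomial in 1 / sqrt t; hence the detour by [smooth_invsqrt]. *)
Lemma smooth_sqrt f : smooth f -> (forall x, 0 < f x) ->
  smooth (fun x => Num.sqrt (f x)).
Proof.
move=> sf f0; have -> : (fun x => Num.sqrt (f x)) = f \* (fun x => (Num.sqrt (f x))^-1).
  apply/funext => x /=; rewrite -{2}(sqr_sqrtr (ltW (f0 x))) expr2 mulfK//.
  by rewrite sqrtr_eq0 -ltNge.
exact: smoothM sf (smooth_invsqrt sf f0).
Qed.

End Calculus.
Arguments smooth_derivable {R} f.

Section Calculus2.
Variable R : realType.
Notation V := (R * R * R)%type.
Implicit Types (f g : V -> R) (x v y : V) (j k : 'I_3).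

Lemma is_derive_line f y v (t : R) : derivable f (t *: v + y) v ->
  is_derive t 1 (fun s : R => f (s *: v + y)) ('D_v f (t *: v + y)).
Proof.
have E (h : R) : (h *: 1 + t) *: v + y = h *: v + (t *: v + y).
  by rewrite scalerDl /GRing.scale /= mulr1 addrA.
rewrite /derivable /derive; set q := (fun h => _) => dq.
have EE : q = fun h => h^-1 *: (((fun s : R => f (s *: v + y)) \o shift t) (h *: 1)
     - f (t *: v + y)).
  by apply/funext => h; rewrite /q /=  E.
by split; rewrite /derivable /derive -EE.
Qed.

Lemma is_derive_additive (f : V -> R) x v (d : R) :
  (forall h : R, f (h *: v + x) = h * d + f x) -> is_derive x v f d.
Proof.
move=> H.
have E : (fun h : R => f (h *: v + x)) = (fun h => h * d + f x) by apply/funext.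
have D : is_derive (0 : R) 1 (fun h : R => h * d + f x) d.
  have D1 : is_derive (0 : R) 1 (fun h : R => h * d) d.
    by apply: is_derive_eq; rewrite scale0r add0r /GRing.scale /= mulr1.
  have := is_deriveD D1 (is_derive_cst (f x) (0:R) 1); by rewrite addr0.
case: D => D1 D2; split; first by apply: (derivable1P f x v).2; rewrite E.
by rewrite derive_line E.
Qed.

Definition coor3 j x : R := tnth [tuple x.1.1; x.1.2; x.2] j.

Lemma is_derive_coord j k x :
  is_derive x (basis3 R k) (coor3 j) (j == k)%:R.
Proof.
apply: is_derive_additive => h.
by case: j k => [[|[|[|//]]] ?] [[|[|[|//]]] ?];
  rewrite /coor3 /basis3 /= !(tnth_nth 0) /= /GRing.scale /= ?mulr0 ?mulr1 ?mul0r ?add0r.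
Qed.

Lemma partial_coord j k : partial k (coor3 j) = cst ((j == k)%:R).
Proof.
by apply/funext => x; rewrite /partial; case: (is_derive_coord j k x).
Qed.

Lemma smooth_coord j : smooth (coor3 j).
Proof.
apply/smoothP; split.
- case: j => [[|[|[|//]]] ?]; rewrite /coor3 => x.
  + rewrite (_ : (fun _ => _) = (fst \o fst)); last by apply/funext=> z; rewrite !(tnth_nth 0).
    by apply: continuous_comp; exact: cvg_fst.
  + rewrite (_ : (fun _ => _) = (snd \o fst)); last by apply/funext=> z; rewrite !(tnth_nth 0).
    by apply: continuous_comp; [exact: cvg_fst|exact: cvg_snd].
  + rewrite (_ : (fun _ => _) = snd); last by apply/funext=> z; rewrite !(tnth_nth 0).
    exact: cvg_snd.
- by move=> k x; case: (is_derive_coord j k x).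
- by move=> k; rewrite partial_coord; exact: smooth_cst.
Qed.

Lemma is_derive_dilate (c : R) f x v : derivable f (c *: x) v ->
  is_derive x v (fun y => f (c *: y)) (c * 'D_v f (c *: x)).
Proof.
move=> df; pose g (t : R) := f (t *: v + c *: x).
have dg : is_derive (0 : R) 1 g ('D_v f (c *: x)).
  by have := @is_derive_line f (c *: x) v 0; rewrite scale0r add0r; apply.
have dl : is_derive (0 : R) 1 (fun t : R => t * c) c.
  by apply: is_derive_eq; rewrite scale0r add0r /GRing.scale /= mulr1.
have dgl : is_derive (0 : R) 1 (g \o (fun t : R => t * c)) ('D_v f (c *: x) * c).
  by apply: is_derive1_comp; rewrite /= mul0r.
have E : (fun t : R => f (c *: (t *: v + x))) = g \o (fun t : R => t * c).
  by apply/funext => t; rewrite /g /= scalerDr scalerA mulrC.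
rewrite mulrC; case: dgl => D1 D2; split; first by apply: (derivable1P _ x v).2; rewrite E.
by rewrite derive_line E.
Qed.

Lemma smooth_dilate (c : R) f : smooth f -> smooth (fun x => f (c *: x)).
Proof.
move=> sf; apply/smooth_Cn => n; elim: n f sf => [|n IH] f sf; split => //.
- by move=> x; apply: continuous_comp; [exact: scaler_continuous|exact: smooth_cont].
- by move=> x; apply: continuous_comp; [exact: scaler_continuous|exact: smooth_cont].
move=> j; split.
  by move=> x; case: (is_derive_dilate (smooth_derivable _ sf j (c *: x))).
rewrite (_ : partial j _ = cst c \* (fun x => partial j f (c *: x))).
  by apply: CnM; [exact: Cn_cst|exact: IH (smooth_partial sf j)].
apply/funext => x.
by rewrite /partial; case: (is_derive_dilate (smooth_derivable _ sf j (c *: x))).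
Qed.

Lemma partial_dilate (c : R) f j x : smooth f ->
  partial j (fun y => f (c *: y)) x = c * partial j f (c *: x).
Proof.
by move=> sf; rewrite /partial; case: (is_derive_dilate (smooth_derivable _ sf j (c *: x))).
Qed.

Lemma MVT_line f y v : (forall x, derivable f x v) -> forall h : R, 0 < h ->
  exists2 t, 0 < t < h & f (h *: v + y) - f y = 'D_v f (t *: v + y) * h.
Proof.
move=> df h h0.
have dl (t : R) : is_derive t 1 (fun s : R => f (s *: v + y)) ('D_v f (t *: v + y)).
  exact: is_derive_line.
have cl : {within `[0, h], continuous (fun s : R => f (s *: v + y))}.
  apply: continuous_subspaceT => t.
  by apply/differentiable_continuous/derivable1_diffP; case: (dl t).
have [t] := @MVT R _ _ 0 h h0 (fun t _ => dl t) cl.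
by rewrite in_itv /= subr0 scale0r add0r => th E; exists t.
Qed.

(** The mean value theorem is used twice: on the increment [g] along the first direction, then on
    [partial j f] along the second. *)
Lemma second_difference f j k x : smooth f -> forall h : R, 0 < h ->
  exists s t : R, [/\ 0 < s < h, 0 < t < h &
  f (h *: basis3 R j + (h *: basis3 R k + x)) - f (h *: basis3 R j + x)
  - (f (h *: basis3 R k + x) - f x) =
  partial k (partial j f) (t *: basis3 R k + (s *: basis3 R j + x)) * h * h].
Proof.
move=> sf h h0; set e := basis3 R j; set e' := basis3 R k.
pose g z := f (h *: e' + z) - f z.
have dsh z : is_derive z e (fun z => f (h *: e' + z)) ('D_e f (h *: e' + z)).
  have := smooth_derivable _ sf j (h *: e' + z).
  have E (a : R) : h *: e' + (a *: e + z) = a *: e + (h *: e' + z) by rewrite addrCA.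
  rewrite /derivable /derive; set q := (fun h => _) => dq.
  have EE : q = fun a => a^-1 *: (((fun z => f (h *: e' + z)) \o shift z) (a *: e)
     - f (h *: e' + z)).
    by apply/funext => a; rewrite /q /= -E.
  by split; rewrite /derivable /derive -EE.
have dg z : is_derive z e g ('D_e f (h *: e' + z) - 'D_e f z).
  by apply: is_deriveB; apply: derivableP; exact: smooth_derivable _ sf j z.
have [|s sh Es] := @MVT_line g x e _ h h0; first by move=> z; case: (dg z).
have [|t th Et] := @MVT_line (partial j f) (s *: e + x) e' _ h h0.
  by move=> z; exact: smooth_derivable _ (smooth_partial sf j) k z.
exists s, t; split => //.
rewrite [X in f X - _ - _]addrCA -/(g (h *: e + x)) -/(g x) Es.
by case: (dg (s *: e + x)) => _ ->; rewrite -/e' -Et.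
Qed.

Lemma basis3_norm j : `|basis3 R j| <= 1.
Proof.
by case: j => [[|[|[|//]]] ?]; rewrite /basis3 !(tnth_nth 0) /= !prod_normE /= ;
  rewrite ?normr0 ?normr1 ?maxxx // ?(max_l ler01) ?(max_r ler01) // (max_l ler01).
Qed.

(** Schwarz's theorem: the second difference is symmetric in the two directions and, divided by h^2,
    is a value of either mixed partial at a point near x. *)
Lemma partialC f j k : smooth f ->
  partial j (partial k f) = partial k (partial j f).
Proof.
move=> sf; apply/funext => x.
have tri (a b c d : R) : `|a - c| < d / 2 -> `|b - c| < d / 2 -> `|a - b| <= d.
  have -> : a - b = (a - c) - (b - c) by ring.
  by move=> ? ?; apply: (le_trans (ler_normB _ _)); rewrite ltW// (splitr d) ltrD.
set A := partial j _ x; set B := partial k _ x.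
apply/eqP; rewrite -subr_eq0 -normr_le0; apply/ler_addgt0Pl => e e0; rewrite addr0.
have cA : {for x, continuous (partial j (partial k f))}.
  exact: smooth_cont (smooth_partial (smooth_partial sf k) j) _.
have cB : {for x, continuous (partial k (partial j f))}.
  exact: smooth_cont (smooth_partial (smooth_partial sf j) k) _.
move/cvgrPdist_lt : cA => /(_ (e / 2)); rewrite divr_gt0// => /(_ isT).
move/cvgrPdist_lt : cB => /(_ (e / 2)); rewrite divr_gt0// => /(_ isT).
move=> /nbhs_normP[d1 /= d10 H1] /nbhs_normP[d2 /= d20 H2].
(* Two displacements shorter than [h] together stay within half of the smaller radius. *)
pose h := Num.min d1 d2 / 4.
have m0 : 0 < Num.min d1 d2 by rewrite lt_min d10.
have h0 : 0 < h by rewrite divr_gt0.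
have close d (a b : R) i i' : Num.min d1 d2 <= d -> 0 < a < h -> 0 < b < h ->
  `|x - (a *: basis3 R i + (b *: basis3 R i' + x))| < d.
  move=> md /andP[a0 ah] /andP[b0 bh].
  rewrite addrA opprD addrCA subrr addr0 normrN.
  apply: (le_lt_trans (ler_normD _ _)); rewrite !normrZ !gtr0_norm//.
  have := basis3_norm i; have := basis3_norm i'.
  move: ah bh; rewrite /h => *; nra.
have [s [t [sh th E1]]] := second_difference j k x sf h0.
have [s' [t' [sh' th' E2]]] := second_difference k j x sf h0.
have := H1 _ (close d1 t s k j _ th sh); rewrite ge_min lexx => /(_ isT).
have := H2 _ (close d2 t' s' j k _ th' sh'); rewrite ge_min lexx orbT => /(_ isT).
have -> : partial j (partial k f) (t' *: basis3 R j + (s' *: basis3 R k + x)) =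
  partial k (partial j f) (t *: basis3 R k + (s *: basis3 R j + x)).
  apply: (mulIf (lt0r_neq0 h0)); apply: (mulIf (lt0r_neq0 h0)).
  apply: etrans (esym E2) _; apply: etrans E1; rewrite (addrCA (h *: basis3 R k)).
  by move: (f _) (f _) (f _) (f _) => a b c d; ring.
rewrite -/A -/B; set z := partial _ _ _ => zA zB.
exact: tri zA zB.
Qed.

End Calculus2.

(** * A smooth bump *)

Section Bump.
Variable R : realType.
Notation V := (R * R * R)%type.

(** The exponent is a parameter because the derivative of one of these functions is a combination of
    those of index k + 1 and k + 2, as [smooth_comp_family] requires. *)
Definition flat (k : nat) (t : R) : R :=
  if 0 < t then t^-1 ^+ k * expR (- t^-1) else 0.

Lemma flat_ge0 k t : 0 <= flat k t.
Proof.
rewrite /flat; case: ifPn => // t0.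
by rewrite mulr_ge0 ?expR_ge0// exprn_ge0// invr_ge0 ltW.
Qed.

(** With y = 1 / t, the exponential series gives y^(k+2) <= (k+2)! e^y. The bound is quadratic so
    that the difference quotient at 0 tends to 0. *)
Lemma flat_le k t : `|flat k t| <= (k.+2)`!%:R * t ^+ 2.
Proof.
rewrite ger0_norm ?flat_ge0// /flat; case: ifPn => t0; last first.
  by rewrite mulr_ge0// sqr_ge0.
have y0 : 0 < t^-1 by rewrite invr_gt0.
have := expR_ge1Dxn k.+1 (ltW y0); move: y0; rewrite -[t in _ * t ^+ 2]invrK.
move: (t^-1) => y y0 H.
have F0 : (0 : R) < (k.+2)`!%:R by rewrite ltr0n fact_gt0.
have {}H : y ^+ k.+2 <= (k.+2)`!%:R * expR y.
  by rewrite mulrC -ler_pdivrMr//; apply: le_trans H; rewrite lerDr.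
rewrite expRN ler_pdivrMr ?expR_gt0// exprVn.
have y20 : 0 < y ^+ 2 by rewrite exprn_gt0.
by rewrite mulrAC ler_pdivlMr// -exprD addn2.
Qed.

Lemma is_derive_flat k (t : R) :
  is_derive t 1 (flat k) (flat k.+2 t - k%:R * flat k.+1 t).
Proof.
have [t0|t0|->] := ltgtP t 0.
- have E x : x < 0 -> flat k x = 0 by move=> x0; rewrite /flat ltNge ltW.
  have E' i : flat i t = 0 by rewrite /flat ltNge ltW.
  rewrite !E' mulr0 subr0.
  apply: (@near_eq_is_derive R R R (cst 0) (flat k) t 1 0) => //.
  by near=> x; rewrite E//; near: x; apply: open_nbhs_nbhs; split; [exact: open_lt|].
- have -> : flat k.+2 t - k%:R * flat k.+1 t =
     (k%:R * t^-1 ^+ k.-1 * (- t ^- 2)) * expR (- t^-1)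
       + t^-1 ^+ k * (expR (- t^-1) * (t ^- 2)).
    rewrite /flat t0 -exprVn; case: k => [|k] /=; first by rewrite !mul0r; ring.
    by rewrite !exprS; ring.
  apply: (@near_eq_is_derive R R R (fun t => t^-1 ^+ k * expR (- t^-1))).
    by near=> x; rewrite /flat ifT//; near: x; apply: open_nbhs_nbhs; split; [exact: open_gt|].
  have tn0 : t != 0 by rewrite gt_eqF.
  have dV : is_derive t 1 (fun x : R => x^-1) (- t ^- 2).
    apply: is_derive_eq; first exact: (@is_deriveV _ id t 1 1 tn0).
    by rewrite /GRing.scale /= mulr1.
  have dX : is_derive t 1 (fun x : R => x^-1 ^+ k) (k%:R * t^-1 ^+ k.-1 * (- t ^- 2)).
    apply: (@is_derive1_comp _ (fun y : R => y ^+ k) (fun x => x^-1)).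
    split; first exact: exprn_derivable.
    by rewrite exp_derive /GRing.scale /= mulr1.
  have dE : is_derive t 1 (fun x : R => expR (- x^-1)) (expR (- t^-1) * (t ^- 2)).
    apply: (@is_derive1_comp _ expR (fun x => - x^-1)).
    by have := is_deriveN dV; rewrite opprK.
  have := is_deriveM dX dE; rewrite /GRing.scale /=.
  by rewrite addrC (mulrC (expR _) (k%:R * _ * _)).
- have -> : flat k.+2 0 - k%:R * flat k.+1 0 = 0.
    by rewrite /flat ltxx mulr0 subr0.
  have H : h^-1 *: ((flat k \o shift 0) (h *: 1) - flat k 0) @[h --> 0^'] --> (0:R).
    apply/cvgrPdist_le => e e0; near=> h.
    have hn0 : h != 0 by near: h; exact: nbhs_dnbhs_neq.
    rewrite /= sub0r normrN {2}/flat ltxx subr0 addr0 /GRing.scale /= mulr1.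
    rewrite normrM normfV ler_pdivrMl ?normr_gt0//.
    have F0 : (0 : R) < (k.+2)`!%:R by rewrite ltr0n fact_gt0.
    apply: (le_trans (flat_le _ _)); rewrite -(real_normK (num_real h)) expr2.
    rewrite mulrA mulrC ler_wpM2l// -ler_pdivlMl//.
    near: h; apply: dnbhs0_le; by rewrite mulr_gt0 ?invr_gt0.
  split; first by apply/cvg_ex; exists 0.
  by apply: cvg_lim.
Unshelve. all: by end_near. Qed.

Lemma smooth_flat k (f : V -> R) : smooth f -> smooth (flat k \o f).
Proof.
move=> sf.
apply: (@smooth_comp_family R nat flat (fun k t => flat k.+2 t - k%:R * flat k.+1 t) f
  setT) => //=.
  by move=> i t _; exact: is_derive_flat.
move=> n i H; apply: (@CnD _ n (flat i.+2 \o f)); first exact: H.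
apply: CnN; apply: (@CnM _ n (cst i%:R)); first exact: Cn_cst.
exact: H.
Qed.

End Bump.

(** * Lebesgue measure on R^3 *)

Section Measure3.
Variable R : realType.
Notation V := (R * R * R)%type.
Notation lam := (@lebesgue_measure R).
Notation leb := (@leb3 R).
Notation T3 := (measurableTypeR R * measurableTypeR R * measurableTypeR R)%type.

Lemma norm3_lt (x : V) (e : R) :
  (`|x| < e) = [&& `|x.1.1| < e, `|x.1.2| < e & `|x.2| < e].
Proof. by rewrite !prod_normE /= !gt_max andbA. Qed.

Lemma norm3_le (x : V) (e : R) :
  (`|x| <= e) = [&& `|x.1.1| <= e, `|x.1.2| <= e & `|x.2| <= e].
Proof. by rewrite !prod_normE /= !ge_max andbA. Qed.

Definition box3 (c : V) (e : R) : set V :=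
  [set x : V | [/\ `|x.1.1 - c.1.1| < e, `|x.1.2 - c.1.2| < e & `|x.2 - c.2| < e]].

Lemma measurable_box3 c e : measurable (box3 c e : set T3).
Proof.
have -> : box3 c e = (ball c.1.1 e `*` ball c.1.2 e) `*` ball c.2 e.
  apply/seteqP; split => [[[x y] z] /= [? ? ?]|[[x y] z] /= [[? ?] ?]]; rewrite /ball /=.
    by split; [split|]; rewrite /= distrC.
  by split; rewrite /= distrC.
by apply: measurableX; [apply: measurableX|]; exact: measurable_ball.
Qed.

(** The sigma-algebra is the product one, so an open set is written as a countable union of boxes:
    those with rational centre and radius 1 / (n + 1) that it contains. *)
Lemma open_measurable3 (A : set V) : open A -> measurable (A : set T3).
Proof.
move=> oA.
pose F (q : rat * rat * rat * nat) : set V :=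
  let B := box3 (ratr q.1.1.1, ratr q.1.1.2, ratr q.1.2) (q.2.+1%:R^-1) in
  if `[< B `<=` A >] then B else set0.
suff -> : A = \bigcup_q F q.
  apply: countable_bigcupT_measurable; first exact: countableP.
  by move=> q; rewrite /F; case: ifPn => _; [exact: measurable_box3|exact: measurable0].
apply/seteqP; split; last first.
  by move=> x [q _]; rewrite /F; case: ifPn => // /asboolP BA /BA.
move=> x Ax; have /nbhs_normP[e /= e0 eA] := open_nbhs_nbhs (conj oA Ax).
(* The rational centre is within [d] of x in each coordinate, so every point of the box is within 2
   d < e of x. *)
have [n ne] : exists n : nat, n.+1%:R^-1 < e / 2.
  exists (Num.bound (2 / e)).
  rewrite -[ltRHS]invrK ltf_pV2 ?posrE ?invr_gt0 ?divr_gt0// invf_div.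
  apply: lt_le_trans (_ : (Num.bound (2 / e))%:R <= _); last by rewrite ler_nat.
  by apply: archi_boundP; rewrite divr_ge0// ltW.
set d : R := n.+1%:R^-1 in ne.
have d0 : 0 < d by rewrite invr_gt0.
have near_rat (t : R) : exists q : rat, `|t - ratr q| < d.
  have /rat_in_itvoo[q] : t - d < t + d by rewrite ltrD2l gtrN.
  rewrite in_itv /= => /andP[q1 q2]; exists q; rewrite ltr_norml; apply/andP; split; lra.
have [q1 h1] := near_rat x.1.1; have [q2 h2] := near_rat x.1.2.
have [q3 h3] := near_rat x.2.
exists (q1, q2, q3, n) => //; rewrite /F /= ifT; first by split.
apply/asboolP => y [y1 y2 y3]; apply: eA => /=.
have tri (a b c : R) : `|a - c| < d -> `|b - c| < d -> `|a - b| < e.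
  rewrite !ltr_norml => /andP[? ?] /andP[? ?]; apply/andP; split; lra.
by rewrite norm3_lt /=; apply/and3P; split; [exact: tri h1 y1|exact: tri h2 y2|exact: tri h3 y3].
Qed.

Definition measurable3 (f : V -> R) := measurable_fun (setT : set T3) (f : T3 -> R).

Lemma continuous_measurable3 (f : V -> R) : continuous f -> measurable3 f.
Proof.
move=> /continuousP cf; apply: (measurability _ (RGenOpens.measurableE R)).
move=> _ [_ [a [b ->] <-]]; rewrite setTI; apply: open_measurable3.
exact/cf/interval_open.
Qed.

Definition integrable3 (f : V -> R) := leb.-integrable setT (EFin \o f).

Definition bsupp (f : V -> R) := exists S : R, forall x, S < `|x| -> f x = 0.

Lemma integrable_box3 (S : R) :
  integrable3 (\1_[set x : V | `|x| <= S]).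
Proof.
have -> : [set x : V | `|x| <= S] = (`[-S, S] `*` `[-S, S]) `*` `[-S, S].
  apply/seteqP; split => [[[x y] z] /= |[[x y] z] /=]; rewrite norm3_le /= !in_itv /= !ler_norml.
    by move=> /and3P[-> -> ->].
  by move=> [[-> ->] ->].
set A := _ `*` _ : set T3.
have mA : measurable A by apply: measurableX => //; apply: measurableX.
rewrite /integrable3; apply/integrableP; split.
  exact/measurable_EFinP/measurable_indic.
under eq_integral do rewrite /= ger0_norm//.
rewrite integral_indic// setIT /leb3 /= product_measure1E//; last exact: measurableX.
by rewrite /= product_measure1E// /= lebesgue_measure_itv /=; case: ifPn => _;
   rewrite -?EFinB -?EFinM ?mul0e ?mule0 ltry.
Qed.

Lemma integrable_bsupp (f : V -> R) (C : R) : measurable3 f ->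
  bsupp f -> (forall x, `|f x| <= C) -> integrable3 f.
Proof.
move=> mf [S fS] fC; rewrite /integrable3.
apply: le_integrable; last exact: (integrableZl measurableT C (integrable_box3 S)).
- by [].
- exact/measurable_EFinP.
- move=> x _ /=; rewrite lee_fin.
  have C0 : 0 <= C := le_trans (normr_ge0 _) (fC x).
  have [xS|xS] := leP `|x| S.
    by rewrite indicE mem_set//= mulr1 (ger0_norm C0).
  by rewrite fS// normr0.
Qed.

Lemma continuous_bsupp_bounded (f : V -> R) : continuous f -> bsupp f ->
  exists C, forall x, `|f x| <= C.
Proof.
move=> cf [S fS].
have cK : compact ((`[-S, S] `*` `[-S, S]) `*` `[-S, S] : set V).
  by apply: compact_setX; [apply: compact_setX|]; exact: segment_compact.
have : compact (f @` ((`[-S, S] `*` `[-S, S]) `*` `[-S, S] : set V)).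
  by apply: continuous_compact => //; exact: continuous_subspaceT.
move=> /compact_bounded[M [Mr HM]].
exists (Num.max 0 (M + 1)) => x; have [xS|xS] := leP `|x| S; last first.
  by rewrite fS// normr0 le_max lexx.
rewrite le_max; apply/orP; right.
apply: (HM (M + 1)); first by rewrite ltrDl.
exists x => //; move: xS; rewrite norm3_le !ler_norml => /and3P[? ? ?].
by split; [split|]; rewrite /= in_itv.
Qed.

Lemma integrable_cont (f : V -> R) : continuous f -> bsupp f -> integrable3 f.
Proof.
move=> cf sf; have [C fC] := continuous_bsupp_bounded cf sf.
exact: integrable_bsupp (continuous_measurable3 cf) sf fC.
Qed.

Notation T2 := (measurableTypeR R * measurableTypeR R)%type.

(* The canonical sigma-finite structure of a product measure is only inferred
   by the library for subprobabilities, hence this alias. *)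
Definition leb2 : set T2 -> \bar R := (lam \x lam)%E.
HB.instance Definition _ := Measure.on leb2.

Lemma leb2_sigma_finite : sigma_finite setT leb2.
Proof.
exists (fun n : nat => `[- n%:R, n%:R] `*` `[- n%:R, n%:R] : set T2).
  apply/seteqP; split => // -[x y] _.
  exists (Num.bound (Num.max `|x| `|y|)) => //=; rewrite !in_itv /= -!ler_norml.
  have h : Num.max `|x| `|y| < (Num.bound (Num.max `|x| `|y|))%:R.
    by apply: archi_boundP; rewrite le_max normr_ge0.
  by split; apply: le_trans (ltW h); rewrite le_max lexx ?orbT.
move=> n; split; first exact: measurableX.
rewrite /leb2 product_measure1E//= lebesgue_measure_itv /=.
by case: ifPn => _; rewrite -?EFinB -?EFinM ?mul0e ?mule0 ltry.
Qed.

HB.instance Definition _ := Measure_isSigmaFinite.Build _ _ _ leb2 leb2_sigma_finite.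

Section Tonelli3.
Variable F : T3 -> \bar R.
Hypothesis mF : measurable_fun setT F.
Hypothesis F0 : forall x, (0 <= F x)%E.

Let mFz (z : measurableTypeR R) : measurable_fun setT (fun w => F (w, z)).
Proof. by apply: measurableT_comp => //; exact: pair2_measurable. Qed.

(** Several orders of iteration are provided so that each coordinate can be the innermost one, in
    which a partial derivative is integrated first. *)
Lemma integral3_zyx :
  (\int[leb]_x F x = \int[lam]_z \int[lam]_y \int[lam]_x F (x, y, z))%E.
Proof.
have E := @fubini_tonelli2 _ _ _ _ _ leb2 lam F mF F0.
refine (etrans E _).
apply: eq_integral => z _.
exact: (@fubini_tonelli2 _ _ _ _ _ lam lam (fun w => F (w, z)) (mFz z) (fun w => F0 (w, z))).
Qed.

Lemma integral3_zxy :
  (\int[leb]_x F x = \int[lam]_z \int[lam]_x \int[lam]_y F (x, y, z))%E.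
Proof.
have E := @fubini_tonelli2 _ _ _ _ _ leb2 lam F mF F0.
refine (etrans E _).
apply: eq_integral => z _.
exact: (@fubini_tonelli1 _ _ _ _ _ lam lam (fun w => F (w, z)) (mFz z) (fun w => F0 (w, z))).
Qed.

Lemma integral3_xyz :
  (\int[leb]_x F x = \int[lam]_x \int[lam]_y \int[lam]_z F (x, y, z))%E.
Proof.
have E := @fubini_tonelli1 _ _ _ _ _ leb2 lam F mF F0.
refine (etrans E _).
apply: (@fubini_tonelli1 _ _ _ _ _ lam lam (fubini_F lam F)).
  exact: measurable_fun_fubini_tonelli_F.
by move=> x; exact: integral_ge0.
Qed.

End Tonelli3.

(** The fundamental theorem of calculus gives a zero integral; equality of the positive and negative
    parts is the form that can be placed inside Tonelli's theorem for nonnegative functions. *)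
Lemma integral_derive_posneg (G g : R -> R) (S : R) :
  (forall t : R, is_derive t 1 G (g t)) -> continuous g ->
  (forall t, S < `|t| -> G t = 0) -> (forall t, S < `|t| -> g t = 0) ->
  (\int[lam]_t ((EFin \o g)^\+ t) = \int[lam]_t ((EFin \o g)^\- t))%E.
Proof.
move=> dG cg G0 g0.
pose M := `|S| + 1.
have SM : S < M by rewrite /M ltr_pwDr// ler_norm.
have M0 : 0 < M by rewrite /M ltr_wpDl.
have cW : {within `[- M, M], continuous g} by exact: continuous_subspaceT.
have gA : EFin \o g = (EFin \o g) \_ `[- M, M].
  apply/funext => t; rewrite patchE; case: ifPn => //= tA; rewrite g0//.
  apply: (lt_trans SM); rewrite ltNge; apply: contra tA; rewrite ler_norml => tM.
  by rewrite inE /= in_itv.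
have ig : lam.-integrable setT (EFin \o g).
  rewrite gA.
  have := integrable_mkcond (mu := lam) (EFin \o g) (measurable_itv `[- M, M]).
  move=> [+ _]; apply.
  by apply: continuous_compact_integrable => //; exact: segment_compact.
have : (\int[lam]_t (g t)%:E = 0)%E.
  rewrite -[LHS]/(\int[lam]_t (EFin \o g) t)%E gA -integral_mkcond.
  rewrite (@continuous_FTC2 _ g G)//.
  - by rewrite !G0 ?subee// ?normrN ger0_norm// ltW.
  - by rewrite gtrN.
  - have cG : continuous G.
      by move=> t; apply/differentiable_continuous/derivable1_diffP; case: (dG t).
    split=> [t _||]; first by case: (dG t).
      exact/cvg_at_right_filter/cG.
    exact/cvg_at_left_filter/cG.
  - by move=> t _; rewrite derive1E; case: (dG t).
rewrite integralE => /eqP; rewrite sube_eq ?add0e; first by move/eqP.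
  exact: (integrable_pos_fin_num measurableT ig).
by rewrite fin_num_adde_defr.
Qed.

(** Outside the closed ball the function vanishes on a whole neighbourhood of the point. *)
Lemma bsupp_partial (f : V -> R) j : bsupp f -> bsupp (partial j f).
Proof.
move=> [S fS]; exists S => x xS.
rewrite /partial (@near_eq_derive _ _ _ f (cst 0)) ?derive_cst//.
near=> y; rewrite fS//; near: y.
apply: open_nbhs_nbhs; split=> //.
rewrite (_ : (fun y => _) = Num.norm @^-1` [set t : R | S < t])//.
by apply: open_comp; [move=> y _; exact: norm_continuous|exact: open_gt].
Unshelve. all: by end_near. Qed.

(** The hypothesis on norms turns bounded support in space into bounded support along the line. *)
Lemma line_posneg (f : V -> R) j (y : V) : smooth f -> bsupp f ->
  (forall t : R, `|t| <= `|t *: basis3 R j + y|) ->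
  (\int[lam]_t ((EFin \o partial j f)^\+ (t *: basis3 R j + y)%R) =
   \int[lam]_t ((EFin \o partial j f)^\- (t *: basis3 R j + y)%R))%E.
Proof.
move=> sf bf ny; pose g := fun t : R => partial j f (t *: basis3 R j + y). have [S gS] := bsupp_partial j bf.
have [S' fS] := bf.
transitivity (\int[lam]_t ((EFin \o g)^\+ t))%E.
  by apply: eq_integral => t _; rewrite !funeposE.
transitivity (\int[lam]_t ((EFin \o g)^\- t))%E; last first.
  by apply: eq_integral => t _; rewrite !funenegE.
apply: (@integral_derive_posneg (fun t : R => f (t *: basis3 R j + y)) g (Num.max S S')).
- by move=> t; apply: is_derive_line; exact: smooth_derivable.
- move=> t; apply: (@continuous_comp _ _ _ (fun t : R => t *: basis3 R j + y) (partial j f)).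
    apply: cvgD; last exact: cvg_cst.
    by apply: cvgZr_tmp; exact: cvg_id.
  exact: smooth_cont (smooth_partial sf j) _.
- move=> t; rewrite gt_max => /andP[_ St]; apply: fS; exact: lt_le_trans (ny t).
- move=> t; rewrite gt_max => /andP[St _]; apply: gS; exact: lt_le_trans (ny t).
Qed.

Lemma scale_add3 (t a b c a' b' c' : R) :
  t *: ((a, b, c) : V) + (a', b', c') = (t * a + a', t * b + b', t * c + c').
Proof. by []. Qed.

Lemma integral_partial (f : V -> R) j : smooth f -> bsupp f ->
  \int[leb]_x partial j f x = 0.
Proof.
move=> sf bf; rewrite /Rintegral.
have cg := smooth_cont (smooth_partial sf j).
have bg := bsupp_partial j bf.
have ig := integrable_cont cg bg.
have mg : measurable_fun setT (EFin \o partial j f : T3 -> \bar R).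
  by case/integrableP: ig.
suff E : (\int[leb]_x ((EFin \o partial j f)^\+ x) =
          \int[leb]_x ((EFin \o partial j f)^\- x))%E.
  rewrite integralE E subee//.
  exact: (integrable_neg_fin_num measurableT ig).
have mp := measurable_funepos mg; have mn := measurable_funeneg mg.
have p0 x : (0 <= (EFin \o partial j f)^\+ x)%E by exact: funepos_ge0.
have n0 x : (0 <= (EFin \o partial j f)^\- x)%E by exact: funeneg_ge0.
have lineE (y : V) : (forall t : R, `|t| <= `|t *: basis3 R j + y|) ->
   (\int[lam]_t ((EFin \o partial j f)^\+ (t *: basis3 R j + y)%R) =
    \int[lam]_t ((EFin \o partial j f)^\- (t *: basis3 R j + y)%R))%E.
  by move=> ny; exact: line_posneg.
case: j {cg bg ig mg} sf mp mn p0 n0 lineE => [[|[|[|//]]] jlt] sf mp mn p0 n0 lineE.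
- rewrite (integral3_zyx mp p0) (integral3_zyx mn n0).
  apply: eq_integral => z _; apply: eq_integral => y _.
  have E (t : measurableTypeR R) : (t, y, z) = t *: basis3 R (Ordinal jlt) + (0, y, z).
    by rewrite /basis3 (tnth_nth 0) /= scale_add3 ?mulr1 ?mulr0 ?addr0 ?add0r.
  under eq_integral do rewrite E; under [RHS]eq_integral do rewrite E.
  by apply: lineE => t; rewrite -E !prod_normE /= !le_max lexx.
- rewrite (integral3_zxy mp p0) (integral3_zxy mn n0).
  apply: eq_integral => z _; apply: eq_integral => y _.
  have E (t : measurableTypeR R) : (y, t, z) = t *: basis3 R (Ordinal jlt) + (y, 0, z).
    by rewrite /basis3 (tnth_nth 0) /= scale_add3 ?mulr1 ?mulr0 ?addr0 ?add0r.
  under eq_integral do rewrite E; under [RHS]eq_integral do rewrite E.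
  by apply: lineE => t; rewrite -E !prod_normE /= !le_max lexx orbT.
- rewrite (integral3_xyz mp p0) (integral3_xyz mn n0).
  apply: eq_integral => z _; apply: eq_integral => y _.
  have E (t : measurableTypeR R) : (z, y, t) = t *: basis3 R (Ordinal jlt) + (z, y, 0).
    by rewrite /basis3 (tnth_nth 0) /= scale_add3 ?mulr1 ?mulr0 ?addr0 ?add0r.
  under eq_integral do rewrite E; under [RHS]eq_integral do rewrite E.
  by apply: lineE => t; rewrite -E !prod_normE /= !le_max lexx orbT.
Qed.

Section Dilate1.
Variables (c : R) (c0 : 0 < c).
Let dil (x : measurableTypeR R) : measurableTypeR R := c * x.

Let mdil : measurable_fun setT dil.
Proof. exact: mulrl_measurable. Qed.
Let cnng : {nonneg R} := NngNum (ltW c0).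
Let m : {measure set (measurableTypeR R) -> \bar R} :=
  mscale cnng (measure_function_pushforward__canonical__measure_function_Measure lam mdil).

(** [m] is c times the image of Lebesgue measure under x -> c x; it gives half-open intervals their
    length, and uniqueness does the rest. *)
Lemma lebesgue_dilate (A : set (measurableTypeR R)) : measurable A -> lam A = m A.
Proof.
apply: lebesgue_measure_unique => //= _ [[a b]] _ <-.
have E : dil @^-1` `]a, b]%classic = `]c^-1 * a, c^-1 * b]%classic.
  apply/seteqP; split => x /=; rewrite /dil !in_itv /= => /andP[h1 h2]; apply/andP; split.
  - by rewrite ltr_pdivrMl.
  - by rewrite ler_pdivlMl.
  - by rewrite -ltr_pdivrMl.
  - by rewrite -ler_pdivlMl.
rewrite -[RHS]/(c%:E * lam (dil @^-1` `]a, b]%classic))%E.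
rewrite E.
rewrite !lebesgue_measure_itv /= !lte_fin ltr_pM2l ?invr_gt0//.
case: ifPn => ab; last by rewrite mule0.
by rewrite -!EFinB -EFinM -mulrBr mulVKf// gt_eqF.
Qed.

Lemma ge0_integral_dilate1 (f : measurableTypeR R -> \bar R) :
  measurable_fun setT f -> (forall x, (0 <= f x)%E) ->
  (\int[lam]_x f (c * x)%R = (c^-1)%:E * \int[lam]_x f x)%E.
Proof.
move=> mf f0.
have -> : (\int[lam]_x f x = \int[m]_x f x)%E.
  by apply: eq_measure_integral => A mA _; exact: lebesgue_dilate.
rewrite /m ge0_integral_mscale// ge0_integral_pushforward// muleA -EFinM mulVf ?gt_eqF//.
by rewrite mul1e.
Qed.

End Dilate1.

Section Dilate3.
Variables (c : R) (c0 : 0 < c) (F : T3 -> \bar R).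
Hypothesis mF : measurable_fun setT F.
Hypothesis F0 : forall x, (0 <= F x)%E.

Let dil3 (x : T3) : T3 := (c * x.1.1, c * x.1.2, c * x.2).

Let mdil3 : measurable_fun setT dil3.
Proof.
have md : measurable_fun setT ( *%R c : measurableTypeR R -> measurableTypeR R).
  exact: mulrl_measurable.
apply: measurable_fun_pair; first apply: measurable_fun_pair.
- apply: (measurableT_comp md); apply: (measurableT_comp measurable_fst).
  exact: measurable_fst.
- apply: (measurableT_comp md); apply: (measurableT_comp measurable_snd).
  exact: measurable_fst.
- apply: (measurableT_comp md); exact: measurable_snd.
Qed.

Lemma ge0_integral_dilate3 :
  (\int[leb]_x F (dil3 x) = ((c^-1) ^+ 3)%:E * \int[leb]_x F x)%E.
Proof.
have ci : (0 <= (c^-1)%:E)%E by rewrite lee_fin invr_ge0 ltW.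
have mFz (z : measurableTypeR R) : measurable_fun setT (fun w : T2 => F (w, z)).
  by apply: measurableT_comp => //; exact: pair2_measurable.
have mFyz (y z : measurableTypeR R) : measurable_fun setT (fun x : measurableTypeR R => F (x, y, z)).
  by apply: (measurableT_comp (mFz z)); exact: pair2_measurable.
have mG (z : measurableTypeR R) : measurable_fun setT
    (fun y : measurableTypeR R => \int[lam]_x F (x, y, z))%E.
  exact: (@measurable_fun_fubini_tonelli_G _ _ _ _ _ lam (fun w => F (w, z))).
have mH : measurable_fun setT
    (fun z : measurableTypeR R => \int[lam]_y \int[lam]_x F (x, y, z))%E.
  have -> : (fun z : measurableTypeR R => \int[lam]_y \int[lam]_x F (x, y, z))%E =
     fubini_G leb2 F.
    apply/funext => z; apply/esym.
    exact: (@fubini_tonelli2 _ _ _ _ _ lam lam (fun w => F (w, z))).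
  exact: measurable_fun_fubini_tonelli_G.
rewrite (@integral3_zyx (F \o dil3)); [|exact: measurableT_comp|by move=> x; exact: F0].
rewrite (integral3_zyx mF F0) /= /dil3 /=.
pose H (z : measurableTypeR R) := (\int[lam]_y \int[lam]_x F (x, y, z))%E.
have H0 z : (0 <= H z)%E by apply: integral_ge0 => ? _; exact: integral_ge0.
transitivity (\int[lam]_z ((c^-1)%:E * (c^-1)%:E * H (c * z)%R))%E.
  apply: eq_integral => z _.
  transitivity (\int[lam]_y ((c^-1)%:E * \int[lam]_x F (x, (c * y)%R, (c * z)%R)))%E.
    apply: eq_integral => y _.
    exact: (@ge0_integral_dilate1 c c0 (fun x => F (x, (c * y)%R, (c * z)%R))).
  have mGc : measurable_fun setT
      (fun y : measurableTypeR R => \int[lam]_x F (x, (c * y)%R, (c * z)%R))%E.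
    by apply: (measurableT_comp (mG (c * z))); exact: mulrl_measurable.
  have Gc0 (u : measurableTypeR R) (y : measurableTypeR R) :
      (0 <= \int[lam]_x F (x, y, u))%E by exact: integral_ge0.
  rewrite (@ge0_integralZl _ _ _ lam _ measurableT _ mGc _ (fun y _ => Gc0 _ (c * y)%R) ci).
  rewrite (@ge0_integral_dilate1 c c0 (fun y => \int[lam]_x F (x, y, (c * z)%R))%E (mG _) (Gc0 _)).
  by rewrite muleA.
have mHc : measurable_fun setT (fun z : measurableTypeR R => H (c * z)%R).
  by apply: (measurableT_comp mH); exact: mulrl_measurable.
rewrite (@ge0_integralZl _ _ _ lam _ measurableT _ mHc _ (fun z _ => H0 (c * z)%R)); last exact: mule_ge0.
rewrite (@ge0_integral_dilate1 c c0 H mH H0).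
by rewrite muleA -!EFinM !exprS expr0 mulr1 mulrA.
Qed.

End Dilate3.

Lemma integral_prod3 (f g h : R -> R) :
  measurable_fun (setT : set (measurableTypeR R)) f ->
  measurable_fun (setT : set (measurableTypeR R)) g ->
  measurable_fun (setT : set (measurableTypeR R)) h ->
  (forall x, 0 <= f x) -> (forall x, 0 <= g x) -> (forall x, 0 <= h x) ->
  (\int[leb]_x (f x.1.1 * g x.1.2 * h x.2)%:E =
   \int[lam]_x (f x)%:E * \int[lam]_x (g x)%:E * \int[lam]_x (h x)%:E)%E.
Proof.
move=> mf mg mh f0 g0 h0.
have mF : measurable_fun setT (fun x : T3 => (f x.1.1 * g x.1.2 * h x.2)%:E).
  apply/measurable_EFinP; apply: measurable_funM; first apply: measurable_funM.
  - apply: (measurableT_comp mf); exact: (measurableT_comp measurable_fst measurable_fst).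
  - apply: (measurableT_comp mg); exact: (measurableT_comp measurable_snd measurable_fst).
  - apply: (measurableT_comp mh); exact: measurable_snd.
rewrite integral3_zyx//; last by move=> x; rewrite lee_fin !mulr_ge0.
have I0 (k : R -> R) : (forall x, 0 <= k x) -> (0 <= \int[lam]_x (k x)%:E)%E.
  by move=> k0; apply: integral_ge0 => x _; rewrite lee_fin.
transitivity (\int[lam]_z (\int[lam]_x (f x)%:E * \int[lam]_x (g x)%:E * (h z)%:E))%E.
  apply: eq_integral => z _.
  transitivity (\int[lam]_y (\int[lam]_x (f x)%:E * (h z)%:E * (g y)%:E))%E.
    apply: eq_integral => y _; rewrite -muleA -EFinM.
    rewrite -ge0_integralZr//.
    - by apply: eq_integral => x _; rewrite /= -mulrA EFinM (mulrC (g y)).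
    - exact/measurable_EFinP.
    - by move=> x _; rewrite lee_fin.
    - by rewrite lee_fin mulr_ge0.
  rewrite ge0_integralZl//.
  - by rewrite muleAC.
  - exact/measurable_EFinP.
  - by move=> x _; rewrite lee_fin.
  - by rewrite mule_ge0 ?I0 ?lee_fin.
rewrite ge0_integralZl//.
- exact/measurable_EFinP.
- by move=> x _; rewrite lee_fin.
- by rewrite mule_ge0 ?I0.
Qed.

Lemma negligible_origin : leb [set (0 : V)] = 0%E.
Proof.
have -> : [set (0 : V)] = ([set 0] `*` [set 0]) `*` [set 0] :> set T3.
  apply/seteqP; split => [x -> //|[[x y] z] /= [[]]] -> -> -> //.
rewrite /leb3 product_measure1E//=; last exact: measurableX.
by rewrite lebesgue_measure_set1 mule0.
Qed.

(** Quotients by |x| take a conventional value at the origin; this lets the integrand of [J] be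
    traded for one that is regular there. *)
Lemma eq_integral_off0 (f g : V -> R) : measurable3 f -> measurable3 g ->
  (forall x, x != 0 -> f x = g x) ->
  (\int[leb]_x (f x)%:E = \int[leb]_x (g x)%:E)%E.
Proof.
move=> mf mg fg; apply: ae_eq_integral => //.
- exact/measurable_EFinP.
- exact/measurable_EFinP.
- exists [set (0 : V)]; split.
  + have -> : [set (0 : V)] = ([set 0] `*` [set 0]) `*` [set 0] :> set T3.
      apply/seteqP; split => [x -> //|[[x y] z] /= [[]]] -> -> -> //.
    by apply: measurableX => //; exact: measurableX.
  + exact: negligible_origin.
  + move=> x /= H; apply/eqP; apply: contrapT => /negP x0; apply: H => _.
    by rewrite fg.
Qed.

End Measure3.

(** * The Pauli operator in real components *)

Section Spinors.
Variable R : realType.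
Notation V := (R * R * R)%type.
Notation Spin := (space3 R -> spinor R).
Implicit Types (phi psi : Spin) (x : V) (B : R).

Definition up_re phi : V -> R := re_part phi ord0.
Definition up_im phi : V -> R := im_part phi ord0.
Definition dn_re phi : V -> R := re_part phi ord_max.
Definition dn_im phi : V -> R := im_part phi ord_max.

Definition mkspinor (p q v w : V -> R) : Spin := fun x =>
  \col_(a < 2) if a == ord0 then Complex (p x) (q x) else Complex (v x) (w x).

Lemma up_re_mk p q v w : up_re (mkspinor p q v w) = p.
Proof. by apply/funext => x; rewrite /up_re /re_part mxE. Qed.
Lemma up_im_mk p q v w : up_im (mkspinor p q v w) = q.
Proof. by apply/funext => x; rewrite /up_im /im_part mxE. Qed.
Lemma dn_re_mk p q v w : dn_re (mkspinor p q v w) = v.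
Proof. by apply/funext => x; rewrite /dn_re /re_part mxE. Qed.
Lemma dn_im_mk p q v w : dn_im (mkspinor p q v w) = w.
Proof. by apply/funext => x; rewrite /dn_im /im_part mxE. Qed.
Definition mkE := (up_re_mk, up_im_mk, dn_re_mk, dn_im_mk).

Lemma ord2P (a : 'I_2) : a = ord0 \/ a = ord_max.
Proof.
by case: a => [[|[|//]] ?]; [left|right]; apply: val_inj.
Qed.

Definition sqn phi x : R :=
  up_re phi x ^+ 2 + up_im phi x ^+ 2 + dn_re phi x ^+ 2 + dn_im phi x ^+ 2.

Lemma spinor_sqnormE (u : spinor R) : spinor_sqnorm u =
  complex.Re (u ord0 ord0) ^+ 2 + complex.Im (u ord0 ord0) ^+ 2
  + complex.Re (u ord_max ord0) ^+ 2 + complex.Im (u ord_max ord0) ^+ 2.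
Proof.
rewrite /spinor_sqnorm big_ord_recl big_ord1 addrA.
by rewrite (_ : lift ord0 ord0 = ord_max)//; apply: val_inj.
Qed.

Lemma sqnE phi x : spinor_sqnorm (phi x) = sqn phi x.
Proof. exact: spinor_sqnormE. Qed.

Definition i0 : 'I_3 := ord0.
Definition i1 : 'I_3 := lift ord0 ord0.
Definition i2 : 'I_3 := ord_max.
Notation d_ j f := (partial j f).

Definition A1 B x : R := - (B / 2) * x.1.2.
Definition A2 B x : R := B / 2 * x.1.1.

(* Real and imaginary parts of the two components of i P_B phi, for
   phi = (p + i q, v + i w). *)
Definition prow1 B (p q v w : V -> R) x : R := d_ i2 p x + (d_ i0 v x + A1 B x * w x) + (d_ i1 w x - A2 B x * v x).
Definition prow2 B (p q v w : V -> R) x : R := d_ i2 q x + (d_ i0 w x - A1 B x * v x) - (d_ i1 v x + A2 B x * w x).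
Definition prow3 B (p q v w : V -> R) x : R := (d_ i0 p x + A1 B x * q x) - (d_ i1 q x - A2 B x * p x) - d_ i2 v x.
Definition prow4 B (p q v w : V -> R) x : R := (d_ i0 q x - A1 B x * p x) + (d_ i1 p x + A2 B x * q x) - d_ i2 w x.

Definition Psq B phi x : R :=
  let p := up_re phi in let q := up_im phi in
  let v := dn_re phi in let w := dn_im phi in
  prow1 B p q v w x ^+ 2 + prow2 B p q v w x ^+ 2 +
  prow3 B p q v w x ^+ 2 + prow4 B p q v w x ^+ 2.

(** The covariant derivative d_j - i A_j applied to the component [b]. *)
Definition cov B phi x (j : 'I_3) (b : 'I_2) : R[i] :=
  Complex (partial j (re_part phi b) x + vecpot B x j * im_part phi b x)
          (partial j (im_part phi b) x - vecpot B x j * re_part phi b x).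

Lemma covE B phi x j b : spinor_partial j phi x b ord0 -
    'i%C * (vecpot B x j)%:C%C * phi x b ord0 = cov B phi x j b.
Proof.
rewrite mxE /cov /re_part /im_part; case: (phi x b ord0) => c d.
by apply/eqP; rewrite eq_complex /=; apply/andP; split; apply/eqP; ring.
Qed.

Lemma magnetic_pauli_entry B phi x (a : 'I_2) :
  magnetic_pauli B phi x a ord0 = - 'i%C *
   \sum_(j < 3) \sum_(b < 2) pauli R j a b * cov B phi x j b.
Proof.
rewrite /magnetic_pauli mxE summxE; congr (_ * _); apply: eq_bigr => j _.
by rewrite mxE; apply: eq_bigr => b _; rewrite -covE !mxE.
Qed.

Lemma sum3E (f : 'I_3 -> R[i]) : \sum_(j < 3) f j = f i0 + f i1 + f i2.
Proof.
rewrite big_ord_recl big_ord_recl big_ord1 addrA.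
by congr (_ + f _ + f _); apply: val_inj.
Qed.

Lemma sum2E (f : 'I_2 -> R[i]) : \sum_(j < 2) f j = f ord0 + f ord_max.
Proof. by rewrite big_ord_recl big_ord1; congr (_ + f _); apply: val_inj. Qed.

Lemma pauli_entries :
  (pauli R i0 ord0 ord0 = 0) * (pauli R i0 ord0 ord_max = 1) *
  (pauli R i0 ord_max ord0 = 1) * (pauli R i0 ord_max ord_max = 0) *
  (pauli R i1 ord0 ord0 = 0) * (pauli R i1 ord0 ord_max = - 'i%C) *
  (pauli R i1 ord_max ord0 = 'i%C) * (pauli R i1 ord_max ord_max = 0) *
  (pauli R i2 ord0 ord0 = 1) * (pauli R i2 ord0 ord_max = 0) *
  (pauli R i2 ord_max ord0 = 0) * (pauli R i2 ord_max ord_max = -1).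
Proof. by rewrite /pauli !(tnth_nth 0) /= !mxE. Qed.

Lemma magnetic_pauli_up B phi x : magnetic_pauli B phi x ord0 ord0 =
  - 'i%C * (cov B phi x i2 ord0 + cov B phi x i0 ord_max - 'i%C * cov B phi x i1 ord_max).
Proof.
rewrite magnetic_pauli_entry sum3E !sum2E !pauli_entries.
by move: (cov _ _ _ _ _) (cov _ _ _ _ _) (cov _ _ _ _ _) (cov _ _ _ _ _)
  (cov _ _ _ _ _) (cov _ _ _ _ _) => *; ring.
Qed.

Lemma magnetic_pauli_dn B phi x : magnetic_pauli B phi x ord_max ord0 =
  - 'i%C * (cov B phi x i0 ord0 + 'i%C * cov B phi x i1 ord0 - cov B phi x i2 ord_max).
Proof.
rewrite magnetic_pauli_entry sum3E !sum2E !pauli_entries.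
by move: (cov _ _ _ _ _) (cov _ _ _ _ _) (cov _ _ _ _ _) (cov _ _ _ _ _)
  (cov _ _ _ _ _) (cov _ _ _ _ _) => *; ring.
Qed.

Lemma vecpotE B x : (vecpot B x i0 = A1 B x) * (vecpot B x i1 = A2 B x) * (vecpot B x i2 = 0).
Proof. by rewrite /vecpot !(tnth_nth 0) /= mulr0 /A1 mulrN mulNr. Qed.

Lemma spinor_entryE phi x b : phi x b ord0 = Complex (re_part phi b x) (im_part phi b x).
Proof. by rewrite /re_part /im_part; case: (phi x b ord0). Qed.

Lemma PsqE B phi x : spinor_sqnorm (magnetic_pauli B phi x) = Psq B phi x.
Proof.
rewrite spinor_sqnormE magnetic_pauli_up magnetic_pauli_dn /cov !vecpotE /=.
rewrite /Psq /prow1 /prow2 /prow3 /prow4 -/(up_re phi) -/(up_im phi) -/(dn_re phi) -/(dn_im phi).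
move: (partial _ _ _) (partial _ _ _) (partial _ _ _) (partial _ _ _).
move: (partial _ _ _) (partial _ _ _) (partial _ _ _) (partial _ _ _).
move: (partial _ _ _) (partial _ _ _) (partial _ _ _) (partial _ _ _).
move: (up_re _ _) (up_im _ _) (dn_re _ _) (dn_im _ _) (A1 _ _) (A2 _ _) => *.
ring.
Qed.

Definition tf (f : V -> R) := smooth f /\ bsupp f.

Lemma spinor_eq0 phi x : (phi x == 0) =
  [&& up_re phi x == 0, up_im phi x == 0, dn_re phi x == 0 & dn_im phi x == 0].
Proof.
apply/eqP/and4P => [E|[/eqP E1 /eqP E2 /eqP E3 /eqP E4]].
  by rewrite /up_re /up_im /dn_re /dn_im /re_part /im_part E !mxE /= !eqxx.
apply/matrixP => a b; rewrite (ord1 b) spinor_entryE !mxE.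
case: (ord2P a) => ->; first by rewrite -/(up_re phi) -/(up_im phi) E1 E2.
by rewrite -/(dn_re phi) -/(dn_im phi) E3 E4.
Qed.

Lemma test_spinorP phi : test_spinor phi <->
  [/\ tf (up_re phi), tf (up_im phi), tf (dn_re phi) & tf (dn_im phi)].
Proof.
split.
  move=> [sm cK].
  have [S HS] : exists S : R, forall x, S < `|x| -> phi x = 0.
    have [M [Mr HM]] := compact_bounded cK; exists (M + 1) => x xM.
    apply/eqP; apply: contraTT xM => phix; rewrite -leNgt.
    apply: (HM (M + 1)); first by rewrite ltrDl.
    exact: subset_closure.
  have bs (f : V -> R) : (forall x, phi x = 0 -> f x = 0) -> bsupp f.
    by move=> H; exists S => x /HS /H.
  by split; split; rewrite ?(sm _).1 ?(sm _).2//; try exact: (sm _).1; try exact: (sm _).2;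
     apply: bs => x /eqP; rewrite spinor_eq0 => /and4P[/eqP ? /eqP ? /eqP ? /eqP ?].
move=> [[s1 [S1 b1]] [s2 [S2 b2]] [s3 [S3 b3]] [s4 [S4 b4]]]; split.
  move=> a; case: (ord2P a) => ->; split; [exact: s1|exact: s2|exact: s3|exact: s4].
pose S := Num.max (Num.max S1 S2) (Num.max S3 S4).
have cK : compact ((`[-S, S] `*` `[-S, S]) `*` `[-S, S] : set V).
  by apply: compact_setX; [apply: compact_setX|]; exact: segment_compact.
apply: (subclosed_compact _ cK); first exact: closed_closure.
have cl := compact_closed (@norm_hausdorff _ _) cK.
rewrite [X in _ `<=` X]((closure_id _).1 cl).
apply: closure_subset => x /= phix; apply: contrapT => xS; move: phix; apply/negP/negPn.
have {xS} : S < `|x|.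
  rewrite ltNge; apply: contra_notN xS; rewrite norm3_le !ler_norml => /and3P[? ? ?].
  by split; [split|]; rewrite /= in_itv.
rewrite /S !gt_max spinor_eq0 => /andP[/andP[h1 h2] /andP[h3 h4]].
by rewrite b1// b2// b3// b4// !eqxx.
Qed.

Lemma bsuppM (f g : V -> R) : bsupp g -> bsupp (f \* g).
Proof. by move=> [S gS]; exists S => x xS /=; rewrite gS// mulr0. Qed.

Lemma bsuppD (f g : V -> R) : bsupp f -> bsupp g -> bsupp (f \+ g).
Proof.
move=> [S fS] [T gT]; exists (Num.max S T) => x /=; rewrite gt_max => /andP[xS xT].
by rewrite fS// gT// addr0.
Qed.

Lemma tfM (f g : V -> R) : smooth f -> tf g -> tf (f \* g).
Proof. by move=> sf [sg bg]; split; [exact: smoothM|exact: bsuppM]. Qed.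

Lemma tfD (f g : V -> R) : tf f -> tf g -> tf (f \+ g).
Proof. by move=> [sf bf] [sg bg]; split; [exact: smoothD|exact: bsuppD]. Qed.

Definition smul (g : V -> R) phi : Spin :=
  mkspinor (g \* up_re phi) (g \* up_im phi) (g \* dn_re phi) (g \* dn_im phi).

Lemma test_smul g phi : smooth g -> test_spinor phi -> test_spinor (smul g phi).
Proof.
move=> sg /test_spinorP[? ? ? ?]; apply/test_spinorP.
by rewrite /smul !mkE; split; exact: tfM.
Qed.

Lemma sqn_ge0 phi x : 0 <= sqn phi x.
Proof. by rewrite /sqn !addr_ge0// sqr_ge0. Qed.

Lemma Psq_ge0 B phi x : 0 <= Psq B phi x.
Proof. by rewrite /Psq !addr_ge0// sqr_ge0. Qed.

Lemma sqn_smul g phi x : sqn (smul g phi) x = g x ^+ 2 * sqn phi x.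
Proof. by rewrite /sqn /smul !mkE /=; ring. Qed.

Definition grad2 (g : V -> R) x : R := d_ i0 g x ^+ 2 + d_ i1 g x ^+ 2 + d_ i2 g x ^+ 2.

Definition smooth_spinor phi :=
  [/\ smooth (up_re phi), smooth (up_im phi), smooth (dn_re phi) & smooth (dn_im phi)].

Lemma test_smooth phi : test_spinor phi -> smooth_spinor phi.
Proof. by move=> /test_spinorP[[? _] [? _] [? _] [? _]]. Qed.

Lemma partialMx j (f g : V -> R) x : smooth f -> smooth g ->
  d_ j (f \* g) x = f x * d_ j g x + g x * d_ j f x.
Proof.
by move=> sf sg; rewrite partialM//; [exact: smooth_derivable|exact: smooth_derivable].
Qed.

(** Young's inequality, with gap d (a - b / d)^2. A small d keeps the first term with a factor close
    to 1 at the expense of the second. *)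
Lemma peter_paul (a b d : R) : 0 < d ->
  (a + b) ^+ 2 <= (1 + d) * a ^+ 2 + (1 + d^-1) * b ^+ 2.
Proof.
move=> d0; have dn0 : d != 0 by rewrite gt_eqF.
rewrite -subr_ge0.
have -> : (1 + d) * a ^+ 2 + (1 + d^-1) * b ^+ 2 - (a + b) ^+ 2 = d * (a - d^-1 * b) ^+ 2.
  by field.
by rewrite mulr_ge0 ?sqr_ge0// ltW.
Qed.

Lemma rows_smul B g phi x : smooth g -> smooth_spinor phi ->
  let p := up_re phi in let q := up_im phi in
  let v := dn_re phi in let w := dn_im phi in
  let g1 := d_ i0 g x in let g2 := d_ i1 g x in let g3 := d_ i2 g x in
  Psq B (smul g phi) x =
   (g x * prow1 B p q v w x + (p x * g3 + v x * g1 + w x * g2)) ^+ 2 +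
   (g x * prow2 B p q v w x + (q x * g3 + w x * g1 - v x * g2)) ^+ 2 +
   (g x * prow3 B p q v w x + (p x * g1 - q x * g2 - v x * g3)) ^+ 2 +
   (g x * prow4 B p q v w x + (q x * g1 + p x * g2 - w x * g3)) ^+ 2.
Proof.
move=> sg [sp sq sv sw] p q v w g1 g2 g3.
rewrite /Psq /smul !mkE /prow1 /prow2 /prow3 /prow4 !partialMx//.
rewrite -/g1 -/g2 -/g3 -/p -/q -/v -/w /=.
move: (partial _ _ _) (partial _ _ _) (partial _ _ _) (partial _ _ _).
move: (partial _ _ _) (partial _ _ _) (partial _ _ _) (partial _ _ _).
move: (partial _ _ _) (partial _ _ _) (partial _ _ _) (partial _ _ _).
move: (p x) (q x) (v x) (w x) (g x) (A1 _ _) (A2 _ _) g1 g2 g3 => *.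
ring.
Qed.

(** P_B (g phi) = g P_B phi - i (sigma . grad g) phi, and (sigma . a)^2 = |a|^2 for a real vector a;
    hence the squared error terms add up exactly to [grad2 g x * sqn phi x]. *)
Lemma Psq_smul_le B g phi x d : 0 < d -> smooth g -> smooth_spinor phi ->
  Psq B (smul g phi) x <=
  (1 + d) * (g x ^+ 2 * Psq B phi x) + (1 + d^-1) * (grad2 g x * sqn phi x).
Proof.
move=> d0 sg sphi; rewrite rows_smul//= /Psq /sqn /grad2.
move: (prow1 _ _ _ _ _ _) (prow2 _ _ _ _ _ _) (prow3 _ _ _ _ _ _) (prow4 _ _ _ _ _ _).
move: (up_re _ _) (up_im _ _) (dn_re _ _) (dn_im _ _) (partial _ _ _) (partial _ _ _)
  (partial _ _ _) (g x) => p q v w g1 g2 g3 y r1 r2 r3 r4.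
apply: le_trans (lerD (lerD (lerD (peter_paul _ _ d0) (peter_paul _ _ d0))
  (peter_paul _ _ d0)) (peter_paul _ _ d0)) _.
by rewrite le_eqVlt; apply/orP; left; apply/eqP; ring.
Qed.

(** P_0 and P_B differ by sigma . A_B, whose square is |A_B|^2. *)
Lemma Psq0_le B phi x d : 0 < d ->
  Psq 0 phi x <=
  (1 + d) * Psq B phi x + (1 + d^-1) * ((A1 B x ^+ 2 + A2 B x ^+ 2) * sqn phi x).
Proof.
move=> d0; rewrite /Psq /sqn /prow1 /prow2 /prow3 /prow4.
have -> : A1 0 x = 0 by rewrite /A1; ring.
have -> : A2 0 x = 0 by rewrite /A2; ring.
move: (partial _ _ _) (partial _ _ _) (partial _ _ _) (partial _ _ _).
move: (partial _ _ _) (partial _ _ _) (partial _ _ _) (partial _ _ _).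
move: (partial _ _ _) (partial _ _ _) (partial _ _ _) (partial _ _ _).
move: (up_re _ _) (up_im _ _) (dn_re _ _) (dn_im _ _) (A1 _ _) (A2 _ _).
move=> p q v w a b w3 p2 q1 v3 q2 p1 v2 w1 q3 w2 v1 p3.
have H (r t s : R) : r = s + t -> r ^+ 2 <= (1 + d) * s ^+ 2 + (1 + d^-1) * t ^+ 2.
  by move=> ->; exact: peter_paul.
apply: (@le_trans _ _ (
  (1 + d) * (p3 + (v1 + a * w) + (w2 - b * v)) ^+ 2 + (1 + d^-1) * (- (a * w) + b * v) ^+ 2 +
  ((1 + d) * (q3 + (w1 - a * v) - (v2 + b * w)) ^+ 2 + (1 + d^-1) * (a * v + b * w) ^+ 2) +
  ((1 + d) * ((p1 + a * q) - (q2 - b * p) - v3) ^+ 2 + (1 + d^-1) * (- (a * q) - b * p) ^+ 2) +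
  ((1 + d) * ((q1 - a * p) + (p2 + b * q) - w3) ^+ 2 + (1 + d^-1) * (a * p - b * q) ^+ 2))).
  by apply: lerD; [apply: lerD; [apply: lerD|]|]; apply: H; ring.
by rewrite le_eqVlt; apply/orP; left; apply/eqP; ring.
Qed.

Definition dil (c : R) phi : Spin :=
  mkspinor (fun x => up_re phi (c *: x)) (fun x => up_im phi (c *: x))
    (fun x => dn_re phi (c *: x)) (fun x => dn_im phi (c *: x)).

Lemma tf_dilate (c : R) f : c != 0 -> tf f -> tf (fun x => f (c *: x)).
Proof.
move=> c0 [sf [S fS]]; split; first exact: smooth_dilate.
exists (S / `|c|) => x; rewrite ltr_pdivrMr ?normr_gt0// => xS.
by apply: fS; rewrite normrZ mulrC.
Qed.

Lemma test_dil (c : R) phi : c != 0 -> test_spinor phi -> test_spinor (dil c phi).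
Proof.
move=> c0 /test_spinorP[? ? ? ?]; apply/test_spinorP.
by rewrite /dil !mkE; split; exact: tf_dilate.
Qed.

Lemma sqn_dil (c : R) phi x : sqn (dil c phi) x = sqn phi (c *: x).
Proof. by rewrite /sqn /dil !mkE. Qed.

(** The potential is linear in x, so that its value for the field c^2 B at x is c times its value
    for B at c x: derivatives and potential scale alike. *)
Lemma Psq_dil (c B : R) phi x : smooth_spinor phi ->
  Psq (c ^+ 2 * B) (dil c phi) x = c ^+ 2 * Psq B phi (c *: x).
Proof.
move=> [sp sq sv sw]; rewrite /Psq /dil !mkE /prow1 /prow2 /prow3 /prow4 !partial_dilate//.
have -> : A1 (c ^+ 2 * B) x = c * A1 B (c *: x) by rewrite /A1 /= /GRing.scale /=; ring.
have -> : A2 (c ^+ 2 * B) x = c * A2 B (c *: x) by rewrite /A2 /= /GRing.scale /=; ring.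
move: (c *: x) => y.
move: (partial _ _ _) (partial _ _ _) (partial _ _ _) (partial _ _ _).
move: (partial _ _ _) (partial _ _ _) (partial _ _ _) (partial _ _ _).
move: (partial _ _ _) (partial _ _ _) (partial _ _ _) (partial _ _ _).
move: (up_re _ _) (up_im _ _) (dn_re _ _) (dn_im _ _) (A1 _ _) (A2 _ _) => *.
ring.
Qed.

Definition lin (t : R) phi psi : Spin :=
  mkspinor (up_re phi \+ cst t \* up_re psi) (up_im phi \+ cst t \* up_im psi)
   (dn_re phi \+ cst t \* dn_re psi) (dn_im phi \+ cst t \* dn_im psi).

Lemma test_lin t phi psi : test_spinor phi -> test_spinor psi -> test_spinor (lin t phi psi).
Proof.
move=> /test_spinorP[? ? ? ?] /test_spinorP[? ? ? ?]; apply/test_spinorP.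
by rewrite /lin !mkE; split; apply: tfD => //; apply: tfM => //; exact: smooth_cst.
Qed.

(** A quadratic form along a line, with the polar form written as Q(phi + psi) - Q(phi) - Q(psi);
    only values of Q occur, so the integrability results for Q suffice after integration. *)
Lemma sqn_lin t phi psi x : sqn (lin t phi psi) x =
  sqn phi x + t * (sqn (lin 1 phi psi) x - sqn phi x - sqn psi x) + t ^+ 2 * sqn psi x.
Proof. by rewrite /sqn /lin !mkE /=; ring. Qed.

Lemma partial_lin j t (f g : V -> R) x : smooth f -> smooth g ->
  d_ j (f \+ cst t \* g) x = d_ j f x + t * d_ j g x.
Proof.
move=> sf sg; have sc := smooth_cst t.
rewrite partialD /=; [|exact: smooth_derivable|exact: (smooth_derivable _ (smoothM sc sg))].
by rewrite partialMx// partial_cst /= mulr0 addr0.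
Qed.

Lemma Psq_lin B t phi psi x : smooth_spinor phi -> smooth_spinor psi ->
  Psq B (lin t phi psi) x =
  Psq B phi x + t * (Psq B (lin 1 phi psi) x - Psq B phi x - Psq B psi x)
   + t ^+ 2 * Psq B psi x.
Proof.
move=> [sp sq sv sw] [sp' sq' sv' sw'].
rewrite /Psq /lin !mkE /prow1 /prow2 /prow3 /prow4 !partial_lin//=.
do 12 (move: (partial _ (up_re _) _) || move: (partial _ (up_im _) _)
  || move: (partial _ (dn_re _) _) || move: (partial _ (dn_im _) _)).
do 12 (move: (partial _ _ _)).
move: (up_re phi _) (up_im phi _) (dn_re phi _) (dn_im phi _).
move: (up_re psi _) (up_im psi _) (dn_re psi _) (dn_im psi _) (A1 _ _) (A2 _ _) => *.
ring.
Qed.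

End Spinors.

(** * The Dirac-Hardy inequality *)

Section Hardy.
Variable R : realType.
Notation V := (R * R * R)%type.
Notation Spin := (space3 R -> spinor R).
Implicit Types (phi psi : Spin) (x : V) (B : R) (f g : V -> R).
Notation leb := (@leb3 R).
Notation I f := (Rintegral leb setT f).
Notation d_ j f := (partial j f).

Lemma int3D f g : integrable3 f -> integrable3 g -> integrable3 (f \+ g).
Proof. by move=> intf intg; exact: (integrableD measurableT intf intg). Qed.

Lemma int3Z (k : R) f : integrable3 f -> integrable3 (cst k \* f).
Proof. by move=> intf; exact: (integrableZl measurableT k intf). Qed.

Lemma int3B f g : integrable3 f -> integrable3 g -> integrable3 (f \- g).
Proof. by move=> intf intg; exact: (integrableB measurableT intf intg). Qed.

Lemma ID f g : integrable3 f -> integrable3 g -> I (f \+ g) = I f + I g.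
Proof. by move=> intf intg; exact: (RintegralD measurableT intf intg). Qed.

Lemma IB f g : integrable3 f -> integrable3 g -> I (f \- g) = I f - I g.
Proof. by move=> intf intg; exact: (RintegralB measurableT intf intg). Qed.

Lemma IZ (k : R) f : integrable3 f -> I (cst k \* f) = k * I f.
Proof. by move=> intf; exact: (RintegralZl k measurableT intf). Qed.

Lemma I_le f g : integrable3 f -> integrable3 g -> (forall x, f x <= g x) -> I f <= I g.
Proof. by move=> intf intg fg; exact: (le_Rintegral measurableT intf intg (fun x _ => fg x)). Qed.

Lemma I_ge0 f : (forall x, 0 <= f x) -> 0 <= I f.
Proof. by move=> f0; exact: Rintegral_ge0. Qed.

(** Functions that may be added to an integrand at no cost. *)
Definition zi f := integrable3 f /\ I f = 0.

Lemma ziD f g : zi f -> zi g -> zi (f \+ g).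
Proof. by move=> [? ?] [? ?]; split; [exact: int3D|rewrite ID//; lra]. Qed.

Lemma ziZ (k : R) f : zi f -> zi (cst k \* f).
Proof. by move=> [? E]; split; [exact: int3Z|rewrite IZ// E mulr0]. Qed.

Lemma zi_partial j f : tf f -> zi (d_ j f).
Proof.
move=> [sf bf]; split; last exact: integral_partial.
by apply: integrable_cont; [exact: smooth_cont (smooth_partial sf j)|exact: bsupp_partial].
Qed.

Definition det3 j k l (a b f : V -> R) : V -> R := fun x =>
  d_ j a x * (d_ k b x * d_ l f x - d_ l b x * d_ k f x) +
  d_ k a x * (d_ l b x * d_ j f x - d_ j b x * d_ l f x) +
  d_ l a x * (d_ j b x * d_ k f x - d_ k b x * d_ j f x).

Lemma tf_smooth f : tf f -> smooth f. Proof. by case. Qed.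

Lemma partialBx j f g x : smooth f -> smooth g ->
  d_ j (f \- g) x = d_ j f x - d_ j g x.
Proof.
by move=> sf sg; rewrite /partial deriveB//; [exact: smooth_derivable|exact: smooth_derivable].
Qed.

Lemma partialDx j f g x : smooth f -> smooth g ->
  d_ j (f \+ g) x = d_ j f x + d_ j g x.
Proof.
by move=> sf sg; rewrite /partial deriveD//; [exact: smooth_derivable|exact: smooth_derivable].
Qed.

Lemma coordE x : (coor3 i0 x = x.1.1) * (coor3 i1 x = x.1.2) * (coor3 i2 x = x.2).
Proof. by rewrite /coor3 !(tnth_nth 0). Qed.

(* Abstracts [partial] into a variable: unification otherwise unfolds it. *)
Lemma partial_rules : exists D : 'I_3 -> (V -> R) -> V -> R,
  [/\ D = @partial R,
   forall j f, smooth f -> smooth (D j f),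
   forall j f g x, smooth f -> smooth g -> D j (f \* g) x = f x * D j g x + g x * D j f x,
   (forall j f g x, smooth f -> smooth g -> D j (f \- g) x = D j f x - D j g x) /\
   (forall j f g x, smooth f -> smooth g -> D j (f \+ g) x = D j f x + D j g x) &
   [/\ forall j k f, smooth f -> D j (D k f) = D k (D j f),
    forall j k x, D j (coor3 k) x = (k == j)%:R & forall j (c : R) x, D j (cst c) x = 0]].
Proof.
exists (@partial R); split.
- exact: erefl.
- by move=> j f sf; exact: smooth_partial.
- by move=> *; exact: partialMx.
- by split=> *; [exact: partialBx|exact: partialDx].
- split.
  + by move=> *; exact: partialC.
  + by move=> j k x; rewrite partial_coord.
  + by move=> j c x; rewrite partial_cst.
Qed.

(* The Jacobian determinant is a divergence, by symmetry of the second derivatives. *)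
Lemma null_lagrangian j k l (a b f : V -> R) : tf a -> smooth b -> smooth f ->
  zi (det3 j k l a b f).
Proof.
move=> ta sb sf; have sa := tf_smooth ta; have := zi_partial.
rewrite /det3; have [D [<- Dsm DM [DB _] [DC _ _]]] := partial_rules => zD.
have sb_ m := Dsm m _ sb; have sf_ m := Dsm m _ sf.
(* The components of the cross product of grad b and grad f, which is divergence free; multiplied by
   [a] they form the field whose divergence is the determinant. *)
pose F (m n : 'I_3) := (D m b \* D n f) \- (D n b \* D m f).
have sF m n : smooth (F m n) := smoothB (smoothM (sb_ m) (sf_ n)) (smoothM (sb_ n) (sf_ m)).
have tF m n : tf (F m n \* a) := tfM (sF m n) ta.
have E m n o x : D o (F m n \* a) x = (D m b x * D n f x - D n b x * D m f x) * D o a x +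
    a x * (D o (D m b) x * D n f x + D m b x * D o (D n f) x
     - D o (D n b) x * D m f x - D n b x * D o (D m f) x).
  rewrite (DM o _ _ x (sF m n) sa).
  rewrite (DB o _ _ x (smoothM (sb_ m) (sf_ n)) (smoothM (sb_ n) (sf_ m))).
  rewrite (DM o _ _ x (sb_ m) (sf_ n)) (DM o _ _ x (sb_ n) (sf_ m)) /F /=.
  by ring.
set G := (X in zi X).
have -> : G = D j (F k l \* a) \+ D k (F l j \* a) \+ D l (F j k \* a).
  apply/funext => x; rewrite /G /= !E.
  rewrite (DC k j _ sb) (DC l j _ sb) (DC l k _ sb).
  rewrite (DC k j _ sf) (DC l j _ sf) (DC l k _ sf).
  by ring.
exact: ziD (ziD (zD _ _ (tF _ _)) (zD _ _ (tF _ _))) (zD _ _ (tF _ _)).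
Qed.

Definition triple (x1 x2 x3 a1 a2 a3 b1 b2 b3 : R) : R :=
  x1 * (a2 * b3 - a3 * b2) + x2 * (a3 * b1 - a1 * b3) + x3 * (a1 * b2 - a2 * b1).

(** The squared length of the cross product of x and a, by Lagrange's identity. *)
Definition cross2 (x1 x2 x3 a1 a2 a3 : R) : R :=
  (x1 ^+ 2 + x2 ^+ 2 + x3 ^+ 2) * (a1 ^+ 2 + a2 ^+ 2 + a3 ^+ 2)
    - (x1 * a1 + x2 * a2 + x3 * a3) ^+ 2.

(** The variables are the gradients of the components of phi = (p + i q, v + i w). Multiplied by 2
    |x|^2, the gap is the sum over k of the squared lengths of (|x|^2 d_k - x_k x . grad) phi + i
    (sigma . x) L_k phi, where L is the cross product of x and grad; [T] is one such square. At x =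
    0 both sides vanish. *)
Lemma tangential_ineq (x1 x2 x3 p1 p2 p3 q1 q2 q3 v1 v2 v3 w1 w2 w3 : R) :
  let N := cross2 x1 x2 x3 in let X := triple x1 x2 x3 in
  (2 * (x3 * (X v1 v2 v3 w1 w2 w3 - X p1 p2 p3 q1 q2 q3)
     + x1 * (X q1 q2 q3 v1 v2 v3 - X p1 p2 p3 w1 w2 w3)
     + x2 * (X p1 p2 p3 v1 v2 v3 + X q1 q2 q3 w1 w2 w3))
  <= N p1 p2 p3 + N q1 q2 q3 + N v1 v2 v3 + N w1 w2 w3 : bool).
Proof.
rewrite /= -subr_ge0; set D := (X in 0 <= X).
pose r2 := x1 ^+ 2 + x2 ^+ 2 + x3 ^+ 2.
have r20 : 0 <= r2 by rewrite !addr_ge0// sqr_ge0.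
have [r2p|] := ltP 0 r2; last first.
  move=> r2n; have x10 : x1 = 0 by apply/eqP; rewrite -sqrf_eq0; apply/eqP; rewrite /r2 in r2n r20; nra.
  have x20 : x2 = 0 by apply/eqP; rewrite -sqrf_eq0; apply/eqP; rewrite /r2 in r2n r20; nra.
  have x30 : x3 = 0 by apply/eqP; rewrite -sqrf_eq0; apply/eqP; rewrite /r2 in r2n r20; nra.
  by rewrite le_eqVlt; apply/orP; left; apply/eqP; rewrite /D /cross2 /triple x10 x20 x30; ring.
pose xp := x1 * p1 + x2 * p2 + x3 * p3.
pose xq := x1 * q1 + x2 * q2 + x3 * q3.
pose xv := x1 * v1 + x2 * v2 + x3 * v3.
pose xw := x1 * w1 + x2 * w2 + x3 * w3.
pose T (y zp zq zv zw wp wq wv ww : R) :=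
  (r2 * zp - y * xp - (x3 * wq + x1 * ww - x2 * wv)) ^+ 2 +
  (r2 * zq - y * xq + (x3 * wp + x1 * wv + x2 * ww)) ^+ 2 +
  (r2 * zv - y * xv - (x1 * wq + x2 * wp - x3 * ww)) ^+ 2 +
  (r2 * zw - y * xw + (x1 * wp - x2 * wq - x3 * wv)) ^+ 2.
have T0 y zp zq zv zw wp wq wv ww : 0 <= T y zp zq zv zw wp wq wv ww.
  by rewrite /T !addr_ge0// sqr_ge0.
have E : 2 * r2 * D =
  T x1 p1 q1 v1 w1 (x2 * p3 - x3 * p2) (x2 * q3 - x3 * q2) (x2 * v3 - x3 * v2) (x2 * w3 - x3 * w2) +
  T x2 p2 q2 v2 w2 (x3 * p1 - x1 * p3) (x3 * q1 - x1 * q3) (x3 * v1 - x1 * v3) (x3 * w1 - x1 * w3) +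
  T x3 p3 q3 v3 w3 (x1 * p2 - x2 * p1) (x1 * q2 - x2 * q1) (x1 * v2 - x2 * v1) (x1 * w2 - x2 * w1).
  by rewrite /T /D /cross2 /triple /xp /xq /xv /xw /r2; ring.
have r2p' : 0 < 2 * r2 by rewrite mulr_gt0.
by rewrite -(pmulr_rge0 _ r2p') E; apply: addr_ge0; [apply: addr_ge0|]; exact: T0.
Qed.

Definition detf (a1 a2 a3 b1 b2 b3 f1 f2 f3 : R) : R :=
  a1 * (b2 * f3 - b3 * f2) + a2 * (b3 * f1 - b1 * f3) + a3 * (b1 * f2 - b2 * f1).

(** Here [s] and [y] are the smoothed |x| and 1 / |x|, and [F1], [F2], [F3] are Jacobian
    determinants whose third function is a component of s x. They cancel the cross terms of s |P_0
    phi|^2 and leave the form of [tangential_ineq]; the divergence of y |phi|^2 x completes the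
    squares of x . grad phi + phi. *)
Lemma hardy_pointwise (x1 x2 x3 p q v w p1 p2 p3 q1 q2 q3 v1 v2 v3 w1 w2 w3 s y e : R) :
  0 < y -> 0 <= e -> s = y * (x1 ^+ 2 + x2 ^+ 2 + x3 ^+ 2 + e) ->
  (x1 ^+ 2 + x2 ^+ 2 + x3 ^+ 2) * y ^+ 2 <= 1 ->
  let F1 := fun a1 a2 a3 b1 b2 b3 => detf a1 a2 a3 b1 b2 b3 (s + x1 * x1 * y) (x1 * x2 * y) (x1 * x3 * y) in
  let F2 := fun a1 a2 a3 b1 b2 b3 => detf a1 a2 a3 b1 b2 b3 (x2 * x1 * y) (s + x2 * x2 * y) (x2 * x3 * y) in
  let F3 := fun a1 a2 a3 b1 b2 b3 => detf a1 a2 a3 b1 b2 b3 (x3 * x1 * y) (x3 * x2 * y) (s + x3 * x3 * y) in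
  let n := p ^+ 2 + q ^+ 2 + v ^+ 2 + w ^+ 2 in
  (y * n <= s * ((p3 + v1 + w2) ^+ 2 + (q3 + w1 - v2) ^+ 2 + (p1 - q2 - v3) ^+ 2
                 + (q1 + p2 - w3) ^+ 2)
    + (- 2) * (F3 v1 v2 v3 w1 w2 w3 + (-1) * F3 p1 p2 p3 q1 q2 q3 + F1 q1 q2 q3 v1 v2 v3
           + (-1) * F1 p1 p2 p3 w1 w2 w3 + F2 p1 p2 p3 v1 v2 v3 + F2 q1 q2 q3 w1 w2 w3)
    + ((y - x1 ^+ 2 * y ^+ 3) * n + x1 * y * (2 * (p * p1 + q * q1 + v * v1 + w * w1))
      + ((y - x2 ^+ 2 * y ^+ 3) * n + x2 * y * (2 * (p * p2 + q * q2 + v * v2 + w * w2)))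
      + ((y - x3 ^+ 2 * y ^+ 3) * n + x3 * y * (2 * (p * p3 + q * q3 + v * v3 + w * w3)))) : bool).
Proof.
move=> y0 e0 -> r2y /=.
have := tangential_ineq x1 x2 x3 p1 p2 p3 q1 q2 q3 v1 v2 v3 w1 w2 w3.
rewrite /= -subr_ge0 => gap; rewrite -subr_ge0.
set g := (X in 0 <= X) in gap.
pose dd := p1 ^+ 2 + p2 ^+ 2 + p3 ^+ 2 + (q1 ^+ 2 + q2 ^+ 2 + q3 ^+ 2)
  + (v1 ^+ 2 + v2 ^+ 2 + v3 ^+ 2) + (w1 ^+ 2 + w2 ^+ 2 + w3 ^+ 2).
have dd0 : 0 <= dd by rewrite /dd !addr_ge0// sqr_ge0.
pose k (a a1 a2 a3 : R) := (x1 * a1 + x2 * a2 + x3 * a3 + a) ^+ 2.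
pose n := p ^+ 2 + q ^+ 2 + v ^+ 2 + w ^+ 2.
have n0 : 0 <= n by rewrite /n !addr_ge0// sqr_ge0.
set lhs := (X in 0 <= X).
(* Four nonnegative remainders: the gradient weighted by e, the tangential gap, the radial squares,
   and what is lost because |x| y is at most 1. *)
have -> : lhs = y * e * dd + y * g + y * (k p p1 p2 p3 + k q q1 q2 q3 + k v v1 v2 v3 + k w w1 w2 w3)
   + n * (y * (1 - (x1 ^+ 2 + x2 ^+ 2 + x3 ^+ 2) * y ^+ 2)).
  by rewrite /lhs /detf /g /cross2 /triple /dd /k /n; ring.
apply: addr_ge0; first apply: addr_ge0; first apply: addr_ge0.
- by rewrite !mulr_ge0// ltW.
- by rewrite mulr_ge0// ltW.
- by apply: mulr_ge0; [exact: ltW|rewrite !addr_ge0// sqr_ge0].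
- by apply: mulr_ge0 => //; rewrite mulr_ge0 ?subr_ge0// ltW.
Qed.

Lemma smooth_A1 B : smooth (A1 B).
Proof.
have -> : A1 B = cst (- (B / 2)) \* coor3 i1.
  by apply/funext => x; rewrite /A1 /= coordE.
exact: smoothM (smooth_cst _) (smooth_coord R _).
Qed.

Lemma smooth_A2 B : smooth (A2 B).
Proof.
have -> : A2 B = cst (B / 2) \* coor3 i0.
  by apply/funext => x; rewrite /A2 /= coordE.
exact: smoothM (smooth_cst _) (smooth_coord R _).
Qed.

Lemma bsuppN f : bsupp f -> bsupp (\- f).
Proof. by move=> [S fS]; exists S => x xS /=; rewrite fS// oppr0. Qed.

Lemma tfN f : tf f -> tf (\- f).
Proof. by move=> [sf bf]; split; [exact: smoothN|exact: bsuppN]. Qed.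

Lemma tfB f g : tf f -> tf g -> tf (f \- g).
Proof. by move=> tf1 tg; exact: tfD (tfN tg). Qed.

Lemma tf_partial j f : tf f -> tf (d_ j f).
Proof. by move=> [sf bf]; split; [exact: smooth_partial|exact: bsupp_partial]. Qed.

Lemma tf_sqr f : tf f -> tf (fun x => f x ^+ 2).
Proof. by move=> [sf bf]; exact: (tfM sf (conj sf bf)). Qed.

Lemma tf_sqn phi : test_spinor phi -> tf (sqn phi).
Proof.
move=> /test_spinorP[tp tq tv tw].
exact: (tfD (tfD (tfD (tf_sqr tp) (tf_sqr tq)) (tf_sqr tv)) (tf_sqr tw)).
Qed.

Lemma tf_Psq B phi : test_spinor phi -> tf (Psq B phi).
Proof.
move=> /test_spinorP[tp tq tv tw].
have a1 f : tf f -> tf (A1 B \* f) by exact: tfM (smooth_A1 B).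
have a2 f : tf f -> tf (A2 B \* f) by exact: tfM (smooth_A2 B).
have dt j f : tf f -> tf (d_ j f) by exact: tf_partial.
have t1 : tf (prow1 B (up_re phi) (up_im phi) (dn_re phi) (dn_im phi)).
  exact: tfD (tfD (dt i2 _ tp) (tfD (dt i0 _ tv) (a1 _ tw))) (tfB (dt i1 _ tw) (a2 _ tv)).
have t2 : tf (prow2 B (up_re phi) (up_im phi) (dn_re phi) (dn_im phi)).
  exact: tfB (tfD (dt i2 _ tq) (tfB (dt i0 _ tw) (a1 _ tv))) (tfD (dt i1 _ tv) (a2 _ tw)).
have t3 : tf (prow3 B (up_re phi) (up_im phi) (dn_re phi) (dn_im phi)).
  exact: tfB (tfB (tfD (dt i0 _ tp) (a1 _ tq)) (tfB (dt i1 _ tq) (a2 _ tp))) (dt i2 _ tv).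
have t4 : tf (prow4 B (up_re phi) (up_im phi) (dn_re phi) (dn_im phi)).
  exact: tfB (tfD (tfB (dt i0 _ tq) (a1 _ tp)) (tfD (dt i1 _ tp) (a2 _ tq))) (dt i2 _ tw).
exact: (tfD (tfD (tfD (tf_sqr t1) (tf_sqr t2)) (tf_sqr t3)) (tf_sqr t4)).
Qed.

Definition n2 x : R := x.1.1 ^+ 2 + x.1.2 ^+ 2 + x.2 ^+ 2.

Lemma n2E : n2 = (coor3 i0 \* coor3 i0) \+ (coor3 i1 \* coor3 i1) \+ (coor3 i2 \* coor3 i2).
Proof. by apply/funext => x; rewrite /= !coordE /n2 !expr2. Qed.

Lemma smooth_n2 : smooth n2.
Proof.
have s2 j : smooth (coor3 j \* coor3 j) := smoothM (smooth_coord R j) (smooth_coord R j).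
by rewrite n2E; exact: smoothD (smoothD (s2 i0) (s2 i1)) (s2 i2).
Qed.

Lemma n2_ge0 x : 0 <= n2 x.
Proof. by rewrite /n2 !addr_ge0// sqr_ge0. Qed.

Lemma ord3P (j : 'I_3) : j = i0 \/ j = i1 \/ j = i2.
Proof.
by case: j => [[|[|[|//]]] jj]; [left|right; left|right; right]; apply: val_inj.
Qed.

Lemma delta3 : ((i0 == i1) = false) * ((i0 == i2) = false) * ((i1 == i0) = false) *
  ((i1 == i2) = false) * ((i2 == i0) = false) * ((i2 == i1) = false).
Proof. by []. Qed.

Lemma partial_n2 j x : d_ j n2 x = 2 * coor3 j x.
Proof.
have [D [<- Dsm DM [_ DD] [_ DX DC]]] := partial_rules.
have sX k := smooth_coord R k.
have s2 k : smooth (coor3 k \* coor3 k : V -> R) := smoothM (sX k) (sX k).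
rewrite n2E (DD j _ _ x (smoothD (s2 i0) (s2 i1)) (s2 i2)) (DD j _ _ x (s2 i0) (s2 i1)).
rewrite (DM j _ _ x (sX i0) (sX i0)) (DM j _ _ x (sX i1) (sX i1)) (DM j _ _ x (sX i2) (sX i2)).
rewrite (DX j i0) (DX j i1) (DX j i2).
by have [->|[->|->]] := ord3P j; rewrite !eqxx ?delta3 /=; ring.
Qed.

Section Regularised.
Variables (e : R) (e0 : 0 < e).
Let n2e : V -> R := n2 \+ cst e.
Let n2e0 x : 0 < n2e x. Proof. by rewrite /n2e /= ltr_wpDl// n2_ge0. Qed.
Let sn2e : smooth n2e := smoothD smooth_n2 (smooth_cst e).

Definition sreg x : R := Num.sqrt (n2 x + e).
Definition yreg x : R := (Num.sqrt (n2 x + e))^-1.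

Lemma smooth_sreg : smooth sreg.
Proof. exact: (smooth_sqrt sn2e n2e0). Qed.
Lemma smooth_yreg : smooth yreg.
Proof. exact: (smooth_invsqrt sn2e n2e0). Qed.
Lemma sreg_gt0 x : 0 < sreg x.
Proof. by rewrite sqrtr_gt0; exact: n2e0. Qed.
Lemma yreg_gt0 x : 0 < yreg x.
Proof. by rewrite invr_gt0; exact: sreg_gt0. Qed.
Lemma sy1 x : sreg x * yreg x = 1.
Proof. by rewrite mulfV// gt_eqF// sreg_gt0. Qed.
Lemma sreg2 x : sreg x * sreg x = n2 x + e.
Proof. by rewrite -expr2 sqr_sqrtr// ltW//; exact: n2e0. Qed.

Lemma partial_n2e j x : d_ j n2e x = 2 * coor3 j x.
Proof.
rewrite -partial_n2; have [D [<- _ _ [_ DD] [_ _ DC]]] := partial_rules.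
by rewrite /n2e (DD j _ _ x smooth_n2 (smooth_cst e)) DC addr0.
Qed.

(** Obtained by differentiating sreg^2 = |x|^2 + e; differentiating [sreg] times [yreg] = 1 then
    gives [partial_yreg]. *)
Lemma partial_sreg j x : d_ j sreg x = coor3 j x * yreg x.
Proof.
have := partial_n2e j x; have [D [<- Dsm DM _ _]] := partial_rules.
have -> : n2e = sreg \* sreg by apply/funext => z; rewrite /= sreg2.
rewrite (DM j _ _ x smooth_sreg smooth_sreg) => E.
have {}E : sreg x * D j sreg x = coor3 j x by lra.
by rewrite -E mulrAC sy1 mul1r.
Qed.

Lemma partial_yreg j x : d_ j yreg x = - (coor3 j x * yreg x ^+ 3).
Proof.
have := partial_sreg j x; have [D [<- Dsm DM _ [_ _ DC]]] := partial_rules => Es.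
have : D j (sreg \* yreg) x = 0.
  have -> : sreg \* yreg = cst 1 by apply/funext => z; rewrite /= sy1.
  exact: DC.
rewrite (DM j _ _ x smooth_sreg smooth_yreg) Es => E.
have s0 : sreg x != 0 by rewrite gt_eqF// sreg_gt0.
apply: (mulfI s0).
have -> : sreg x * - (coor3 j x * yreg x ^+ 3) =
  - (yreg x * (coor3 j x * yreg x)) * (sreg x * yreg x) by ring.
by rewrite sy1 mulr1; apply/eqP; rewrite -addr_eq0 E.
Qed.

Lemma partial_field m j x :
  d_ j (sreg \* coor3 m) x = (j == m)%:R * sreg x + coor3 m x * coor3 j x * yreg x.
Proof.
have := partial_sreg j x; have [D [<- _ DM _ [_ DX _]]] := partial_rules => Es.
by rewrite (DM j _ _ x smooth_sreg (smooth_coord R m)) Es DX eq_sym; ring.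
Qed.

Lemma partial_sqn j phi x : smooth_spinor phi -> d_ j (sqn phi) x =
  2 * (up_re phi x * d_ j (up_re phi) x + up_im phi x * d_ j (up_im phi) x
    + dn_re phi x * d_ j (dn_re phi) x + dn_im phi x * d_ j (dn_im phi) x).
Proof.
move=> [sp sq sv sw].
have [D [<- _ DM [_ DD] _]] := partial_rules.
have -> : sqn phi = (up_re phi \* up_re phi) \+ (up_im phi \* up_im phi)
  \+ (dn_re phi \* dn_re phi) \+ (dn_im phi \* dn_im phi).
  by apply/funext => z; rewrite /sqn /= !expr2.
have m2 f : smooth f -> smooth (f \* f) by move=> sf; exact: smoothM.
rewrite (DD j _ _ x (smoothD (smoothD (m2 _ sp) (m2 _ sq)) (m2 _ sv)) (m2 _ sw)).
rewrite (DD j _ _ x (smoothD (m2 _ sp) (m2 _ sq)) (m2 _ sv)).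
rewrite (DD j _ _ x (m2 _ sp) (m2 _ sq)).
rewrite (DM j _ _ x sp sp) (DM j _ _ x sq sq) (DM j _ _ x sv sv) (DM j _ _ x sw sw).
by ring.
Qed.

Lemma partial_radial j phi x : test_spinor phi ->
  d_ j ((coor3 j \* yreg) \* sqn phi) x =
  (yreg x - coor3 j x ^+ 2 * yreg x ^+ 3) * sqn phi x + coor3 j x * yreg x * d_ j (sqn phi) x.
Proof.
move=> tphi; have [ss _] := tf_sqn tphi; have := partial_yreg j x.
have [D [<- _ DM _ [_ DX _]]] := partial_rules => Ey.
have sX := smooth_coord R j.
rewrite (DM j _ _ x (smoothM sX smooth_yreg) ss) (DM j _ _ x sX smooth_yreg) DX Ey eqxx /=.
by ring.
Qed.

Lemma Psq0E phi x : let p := up_re phi in let q := up_im phi in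
  let v := dn_re phi in let w := dn_im phi in
  Psq 0 phi x = (d_ i2 p x + d_ i0 v x + d_ i1 w x) ^+ 2
  + (d_ i2 q x + d_ i0 w x - d_ i1 v x) ^+ 2
  + (d_ i0 p x - d_ i1 q x - d_ i2 v x) ^+ 2 + (d_ i0 q x + d_ i1 p x - d_ i2 w x) ^+ 2.
Proof.
rewrite /Psq /prow1 /prow2 /prow3 /prow4 /A1 /A2 /=.
have [D [<- _ _ _ _]] := partial_rules.
have z : 0 / 2 = 0 :> R by rewrite mul0r.
by rewrite z oppr0 !mul0r !addr0 !subr0.
Qed.

(** Integrating [hardy_pointwise] makes the determinants and the divergence disappear. *)
Lemma hardy_reg phi : test_spinor phi ->
  integrable3 (yreg \* sqn phi) /\ I (yreg \* sqn phi) <= I (sreg \* Psq 0 phi).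
Proof.
move=> tphi; have [tp tq tv tw] := (test_spinorP phi).1 tphi.
have [sp sq sv sw] := test_smooth tphi.
have tn := tf_sqn tphi.
have iy : integrable3 (yreg \* sqn phi).
  have [sy by_] := tfM smooth_yreg tn; exact: integrable_cont (smooth_cont sy) by_.
have is_ : integrable3 (sreg \* Psq 0 phi).
  have [ss bs] := tfM smooth_sreg (tf_Psq 0 tphi); exact: integrable_cont (smooth_cont ss) bs.
split=> //.
pose f m : V -> R := sreg \* coor3 m.
have sf m : smooth (f m) := smoothM smooth_sreg (smooth_coord R m).
pose p := up_re phi; pose q := up_im phi; pose v := dn_re phi; pose w := dn_im phi.
pose dt := det3 i0 i1 i2.
(* The six pairs and signs are those of the 2 x 2 minors that make up the cross terms of |P_0
   phi|^2. *)
pose Z1 : V -> R := dt v w (f i2) \+ cst (-1) \* dt p q (f i2) \+ dt q v (f i0)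
  \+ cst (-1) \* dt p w (f i0) \+ dt p v (f i1) \+ dt q w (f i1).
have z1 : zi Z1.
  have N a b m : tf a -> smooth b -> zi (dt a b (f m)).
    by move=> ta sb; exact: null_lagrangian ta sb (sf m).
  exact: ziD (ziD (ziD (ziD (ziD (N _ _ i2 tv sw) (ziZ _ (N _ _ i2 tp sq))) (N _ _ i0 tq sv))
     (ziZ _ (N _ _ i0 tp sw))) (N _ _ i1 tp sv)) (N _ _ i1 tq sw).
pose g j : V -> R := (coor3 j \* yreg) \* sqn phi.
have tg j : tf (g j) by exact: tfM (smoothM (smooth_coord R j) smooth_yreg) tn.
pose Z2 : V -> R := d_ i0 (g i0) \+ (d_ i1 (g i1)) \+ (d_ i2 (g i2)).
have z2 : zi Z2 := ziD (ziD (zi_partial i0 (tg i0)) (zi_partial i1 (tg i1))) (zi_partial i2 (tg i2)).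
have [iZ1 IZ1] := ziZ (- 2) z1; have [iZ2 IZ2] := z2.
have -> : I (sreg \* Psq 0 phi) = I (sreg \* Psq 0 phi \+ cst (-2) \* Z1 \+ Z2).
  by rewrite ID//; [rewrite ID// IZ1 IZ2 !addr0|exact: int3D].
apply: I_le => //; first by apply: int3D => //; exact: int3D.
move=> x.
have -> : (sreg \* Psq 0 phi \+ cst (-2) \* Z1 \+ Z2) x =
  sreg x * Psq 0 phi x + -2 * Z1 x + Z2 x by [].
rewrite /Z1 /Z2 /= /dt /det3 /f !partial_field !(partial_radial _ _ tphi) !partial_sqn//.
rewrite !eqxx !delta3 /= !mul1r !mul0r !add0r !coordE.
rewrite Psq0E /sqn -/p -/q -/v -/w; have [D [<- _ _ _ _]] := partial_rules.
have sE : sreg x = yreg x * (n2 x + e) by rewrite -sreg2 mulrA (mulrC (yreg x)) sy1 mul1r.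
have yE : n2 x * yreg x ^+ 2 <= 1.
  have : (n2 x + e) * yreg x ^+ 2 = 1.
    by rewrite -sreg2 expr2 mulrACA sy1 mulr1.
  move=> <-; rewrite ler_wpM2r ?sqr_ge0// lerDl ltW//.
move: (yreg_gt0 x) sE yE; rewrite /n2 => y0 sE yE.
have := hardy_pointwise (p x) (q x) (v x) (w x) (D i0 p x) (D i1 p x) (D i2 p x)
  (D i0 q x) (D i1 q x) (D i2 q x) (D i0 v x) (D i1 v x) (D i2 v x)
  (D i0 w x) (D i1 w x) (D i2 w x) y0 (ltW e0) sE yE.
by rewrite /detf /= !addrA.
Qed.


End Regularised.

End Hardy.

(** * The Dirac-Hardy inequality with the singular weights *)

Section Functionals.
Variable R : realType.
Notation V := (R * R * R)%type.
Notation Spin := (space3 R -> spinor R).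
Implicit Types (phi psi : Spin) (x : V) (B : R) (f g : V -> R).
Notation leb := (@leb3 R).
Notation I f := (Rintegral leb setT f).
Notation rad := (@enorm3 R).

Lemma rad_ge0 x : 0 <= rad x. Proof. exact: sqrtr_ge0. Qed.

Lemma rad2 x : rad x ^+ 2 = n2 x. Proof. by rewrite sqr_sqrtr// n2_ge0. Qed.

Lemma n2_eq0 x : (n2 x == 0) = (x == 0).
Proof.
apply/eqP/eqP => [|->]; last by rewrite /n2 /= !expr0n /= !addr0.
move: x => [[a b] c] /= E; rewrite /n2 /= in E.
have a0 : a = 0 by apply/eqP; rewrite -sqrf_eq0; apply/eqP; nra.
have b0 : b = 0 by apply/eqP; rewrite -sqrf_eq0; apply/eqP; nra.
have c0 : c = 0 by apply/eqP; rewrite -sqrf_eq0; apply/eqP; nra.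
by rewrite a0 b0 c0.
Qed.

Lemma rad_gt0 x : x != 0 -> 0 < rad x.
Proof. by move=> x0; rewrite sqrtr_gt0 lt_def n2_ge0 andbT n2_eq0. Qed.

Lemma rad0 : rad 0 = 0.
Proof. by rewrite /enorm3 /= expr0n /= !addr0 sqrtr0. Qed.

Lemma continuous_rad : continuous rad.
Proof.
move=> x; apply: (@continuous_comp _ _ _ (@n2 R) Num.sqrt); last exact: sqrt_continuous.
exact: smooth_cont (smooth_n2 R) x.
Qed.

Lemma continuous_mul f g : continuous f -> continuous g -> continuous (f \* g).
Proof. by move=> cf cg x; exact: cvgM (cf x) (cg x). Qed.

Lemma int3_cont f g : continuous f -> tf g -> integrable3 (f \* g).
Proof.
move=> cf [sg bg]; apply: integrable_cont; last exact: bsuppM.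
exact: continuous_mul cf (smooth_cont sg).
Qed.

Lemma int3_tf f : tf f -> integrable3 f.
Proof. by move=> [sf bf]; exact: integrable_cont (smooth_cont sf) bf. Qed.

Lemma sreg_le (e : R) x : 0 < e -> sreg e x <= rad x + Num.sqrt e.
Proof.
move=> e0; rewrite -(@ler_pXn2r _ 2)//; last 2 first.
- by rewrite nnegrE sqrtr_ge0.
- by rewrite nnegrE addr_ge0 ?sqrtr_ge0.
rewrite sqrrD rad2 !sqr_sqrtr ?(ltW e0)//; last by rewrite addr_ge0 ?n2_ge0// ltW.
by rewrite lerD2r lerDl mulrn_wge0// mulr_ge0 ?sqrtr_ge0.
Qed.

Lemma measurable3_M f g : measurable3 f -> measurable3 g -> measurable3 (f \* g).
Proof. by move=> mf mg; exact: measurable_funM. Qed.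

Notation T3 := (measurableTypeR R * measurableTypeR R * measurableTypeR R)%type.

Lemma measurable_origin : measurable ([set (0 : V)] : set T3).
Proof.
have -> : [set (0 : V)] = ([set 0] `*` [set 0]) `*` [set 0] :> set T3.
  by apply/seteqP; split => [x -> //|[[x y] z] /= [[]]] -> -> ->.
by apply: measurableX => //; exact: measurableX.
Qed.

Lemma measurable_off0 : measurable3 (fun x => (x != 0)%:R : R).
Proof.
have -> : (fun x : V => (x != 0)%:R : R) = \1_(~` [set (0 : V)]).
  apply/funext => x; rewrite indicE; congr (nat_of_bool _)%:R.
  by apply/idP/idP => [/eqP x0|]; [rewrite inE|rewrite inE => /eqP].
by apply: measurable_indic; exact: measurableC measurable_origin.
Qed.

Lemma measurable3_cvg (h : (V -> R)^nat) f : (forall n, measurable3 (h n)) ->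
  (forall x, h ^~ x @ \oo --> f x) -> measurable3 f.
Proof. by move=> mh hf; apply: (measurable_fun_cvg mh) => x _; exact: hf. Qed.

(** The second factor is there because the inverse of 0 is 0: at the origin the regularised weights
    are unbounded, while the limit weight takes the value 0. *)
Let hreg (n : nat) x : R := yreg n.+1%:R^-1 x * (x != 0)%:R.

Lemma cvg_hreg x : hreg ^~ x @ \oo --> (rad x)^-1.
Proof.
rewrite /hreg; have [->|x0] := eqVneq x 0.
  rewrite rad0 invr0 (_ : (fun n => _) = cst 0); first exact: cvg_cst.
  by apply/funext => n; rewrite mulr0.
rewrite (_ : (fun n => _) = (fun n => (Num.sqrt (n2 x + n.+1%:R^-1))^-1)); last first.
  by apply/funext => n; rewrite mulr1.
apply: cvgV; first by rewrite gt_eqF// rad_gt0.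
have H : (fun n : nat => n2 x + n.+1%:R^-1) @ \oo --> n2 x.
  rewrite -[X in _ --> X]addr0; apply: cvgD; first exact: cvg_cst.
  exact: cvg_harmonic.
have -> : rad x = Num.sqrt (n2 x) by [].
apply: (cvg_comp _ (@Num.sqrt R) H).
exact: sqrt_continuous.
Qed.

Lemma invn_gt0 (n : nat) : 0 < n.+1%:R^-1 :> R. Proof. by rewrite invr_gt0. Qed.

Lemma measurable_invrad : measurable3 (fun x => (rad x)^-1).
Proof.
apply: (@measurable3_cvg hreg); last exact: cvg_hreg.
move=> n; apply: measurable3_M; last exact: measurable_off0.
by apply: continuous_measurable3; exact: smooth_cont (smooth_yreg (invn_gt0 n)).
Qed.

Lemma hreg_nd x : nondecreasing_seq (hreg ^~ x).
Proof.
move=> m n mn; rewrite /hreg ler_wpM2r// /yreg.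
rewrite lef_pV2 ?posrE ?sqrtr_gt0 ?ltr_wpDl ?n2_ge0 ?invn_gt0//.
rewrite ler_wsqrtr// lerD2l lef_pV2 ?posrE// ler_nat//.
Qed.

(** Monotone convergence for e = 1 / (n + 1); on the right, sqrt (|x|^2 + e) <= |x| + sqrt e leaves
    an error that tends to 0. Integrability of |phi|^2 / |x| is a by-product of the bound. *)
Lemma hardy phi : test_spinor phi ->
  integrable3 (fun x => sqn phi x / rad x) /\
  I (fun x => sqn phi x / rad x) <= I (rad \* Psq 0 phi).
Proof.
move=> tphi; have tn := tf_sqn tphi; have tP := tf_Psq 0 tphi.
have mn := continuous_measurable3 (smooth_cont tn.1).
pose g (n : nat) : V -> R := hreg n \* sqn phi.
have g0 n x : 0 <= g n x.
  by rewrite /g /= mulr_ge0 ?sqn_ge0// /hreg mulr_ge0// ltW// yreg_gt0// invn_gt0.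
have mg n : measurable3 (g n).
  apply: measurable3_M => //; apply: measurable3_M; last exact: measurable_off0.
  by apply: continuous_measurable3; exact: smooth_cont (smooth_yreg (invn_gt0 n)).
have glim x : g ^~ x @ \oo --> sqn phi x / rad x.
  by rewrite mulrC; apply: cvgM; [exact: cvg_hreg|exact: cvg_cst].
have gnd x : nondecreasing_seq (fun n => (g n x)%:E).
  by move=> m n mn_; rewrite lee_fin /g /= ler_wpM2r ?sqn_ge0//; exact: hreg_nd.
have E : (\int[leb]_x (sqn phi x / rad x)%:E = limn (fun n => \int[leb]_x (g n x)%:E))%E.
  rewrite -(@monotone_convergence _ _ _ leb setT measurableT (fun n x => (g n x)%:E)).
  - apply: eq_integral => x _; apply/esym/cvg_lim => //.
    by apply: cvg_EFin; [exact: nearW|exact: glim].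
  - by move=> n; apply/measurable_EFinP; exact: mg.
  - by move=> n x _; rewrite lee_fin.
  - by move=> x _; exact: gnd.
have irP : integrable3 (rad \* Psq 0 phi) by exact: int3_cont continuous_rad tP.
have bound n : (\int[leb]_x (g n x)%:E <=
    (I (rad \* Psq 0 phi) + Num.sqrt n.+1%:R^-1 * I (Psq 0 phi))%:E)%E.
  have [iy Hy] := hardy_reg (invn_gt0 n) tphi.
  have iP := int3_tf tP.
  apply: (@le_trans _ _ (\int[leb]_x ((yreg n.+1%:R^-1 \* sqn phi) x)%:E)%E).
    apply: ge0_le_integral => //.
    - by move=> x _; rewrite lee_fin.
    - by apply/measurable_EFinP; exact: mg.
    - by case/integrableP: iy.
    - move=> x _; rewrite lee_fin /g /= ler_wpM2r ?sqn_ge0// /hreg.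
      by rewrite ler_piMr ?lern1 ?leq_b1// ltW// yreg_gt0// invn_gt0.
  rewrite -(fineK (integrable_fin_num measurableT iy)) lee_fin.
  apply: (le_trans Hy); rewrite -IZ// -ID//; last exact: int3Z.
  apply: I_le; [|by apply: int3D => //; exact: int3Z|].
    by apply: int3_cont => //; exact: smooth_cont (smooth_sreg (invn_gt0 n)).
  move=> x /=; rewrite -mulrDl ler_wpM2r ?Psq_ge0//; exact: sreg_le (invn_gt0 n).
have cv : cvgn (fun n => \int[leb]_x (g n x)%:E)%E.
  apply: ereal_nondecreasing_is_cvgn => m n mn_; apply: ge0_le_integral => //.
  - by move=> x _; rewrite lee_fin.
  - by apply/measurable_EFinP; exact: mg.
  - by apply/measurable_EFinP; exact: mg.
  - by move=> x _; exact: gnd.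
have main : (\int[leb]_x (sqn phi x / rad x)%:E <= (I (rad \* Psq 0 phi))%:E)%E.
  rewrite E; apply/lee_addgt0Pr => e e0.
  apply: lime_le => //; near=> n.
  apply: (le_trans (bound n)); rewrite -EFinD lee_fin lerD2l.
  near: n.
  have : (fun n : nat => Num.sqrt n.+1%:R^-1 * I (Psq 0 phi)) @ \oo --> (0 : R).
    rewrite -[X in _ --> X](mul0r (I (Psq 0 phi))); apply: cvgMl.
    rewrite -[X in _ --> X]sqrtr0.
    apply: (cvg_comp _ (@Num.sqrt R) (@cvg_harmonic R)).
    exact: sqrt_continuous.
  by move/cvgr_le; apply.
have i1 : integrable3 (fun x => sqn phi x / rad x).
  apply/integrableP; split.
    by apply/measurable_EFinP; apply: measurable3_M => //; exact: measurable_invrad.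
  under eq_integral => x _ do rewrite /= ger0_norm ?divr_ge0 ?sqn_ge0 ?rad_ge0//.
  by apply: (le_lt_trans main); rewrite ltry.
split=> //.
by rewrite -lee_fin /Rintegral fineK//; exact: integrable_fin_num.
Unshelve. all: by end_near. Qed.

End Functionals.

(** * Kinetic, potential and L2 masses *)

Section Masses.
Variable R : realType.
Notation V := (R * R * R)%type.
Notation Spin := (space3 R -> spinor R).
Implicit Types (phi psi : Spin) (x : V) (B nu : R) (f g : V -> R).
Notation leb := (@leb3 R).
Notation I f := (Rintegral leb setT f).
Notation rad := (@enorm3 R).
Notation d_ j f := (partial j f).
Notation T3 := (measurableTypeR R * measurableTypeR R * measurableTypeR R)%type.

Definition kin B phi : R := I (rad \* Psq B phi).
Definition pot phi : R := I (fun x => sqn phi x / rad x).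
Definition mass phi : R := I (sqn phi).

Lemma int_kin B phi : test_spinor phi -> integrable3 (rad \* Psq B phi).
Proof. by move=> tphi; exact: int3_cont (@continuous_rad R) (tf_Psq B tphi). Qed.

Lemma int_pot phi : test_spinor phi -> integrable3 (fun x => sqn phi x / rad x).
Proof. by move=> /hardy[]. Qed.

Lemma int_mass phi : test_spinor phi -> integrable3 (sqn phi).
Proof. by move=> /tf_sqn; exact: int3_tf. Qed.

Lemma kin_ge0 B phi : 0 <= kin B phi.
Proof. by apply: I_ge0 => x /=; rewrite mulr_ge0 ?rad_ge0 ?Psq_ge0. Qed.

Lemma pot_ge0 phi : 0 <= pot phi.
Proof. by apply: I_ge0 => x /=; rewrite divr_ge0 ?rad_ge0 ?sqn_ge0. Qed.

Lemma mass_ge0 phi : 0 <= mass phi.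
Proof. by apply: I_ge0 => x; exact: sqn_ge0. Qed.

Lemma energyE B nu phi : test_spinor phi ->
  energy B nu phi = kin B phi / nu - nu * pot phi.
Proof.
move=> tphi; rewrite /energy; congr (_ - _).
- rewrite mulrC -IZ; last exact: int_kin.
  by congr (Rintegral _ _); apply/funext => x; rewrite /= PsqE; ring.
- rewrite -IZ; last exact: int_pot.
  by congr (Rintegral _ _); apply/funext => x; rewrite /= sqnE; ring.
Qed.

Lemma L2normE phi : L2norm phi = Num.sqrt (mass phi).
Proof.
by congr (Num.sqrt (Rintegral _ _ _)); apply/funext => x; exact: sqnE.
Qed.

Lemma L2norm2 phi : L2norm phi ^+ 2 = mass phi.
Proof. by rewrite L2normE sqr_sqrtr// mass_ge0. Qed.

Lemma measure_box3 (c : V) (e : R) : 0 < e -> leb (box3 c e) = ((e *+ 2) ^+ 3)%:E.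
Proof.
move=> e0.
have -> : box3 c e = (ball c.1.1 e `*` ball c.1.2 e) `*` ball c.2 e.
  apply/seteqP; split => [[[x y] z] /= [? ? ?]|[[x y] z] /= [[? ?] ?]]; rewrite /ball /=.
    by split; [split|]; rewrite /= distrC.
  by split; rewrite /= distrC.
rewrite /leb3 product_measure1E//=; [|apply: measurableX; exact: measurable_ball|exact: measurable_ball].
rewrite product_measure1E//=; [|exact: measurable_ball|exact: measurable_ball].
by rewrite !lebesgue_measure_ball ?(ltW e0)// -!EFinM; congr (_%:E); ring.
Qed.

(** By continuity f stays above half its value at [x0] on a box, and a box has positive measure. *)
Lemma integral_gt0 f x0 : continuous f -> integrable3 f -> (forall x, 0 <= f x) ->
  0 < f x0 -> 0 < I f.
Proof.
move=> cf intf f0 fx0.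
have [e e0 He] : exists2 e : R, 0 < e & forall x, box3 x0 e x -> f x0 / 2 <= f x.
  have /= : \forall x \near x0, f x0 / 2 <= f x.
    by apply: (cvgr_ge (f x0) (cf x0)); lra.
  case/nbhs_ballP => e /= e0 He; exists e => // -[[x y] z] [/= h1 h2 h3]; apply: He.
  by rewrite -ball_normE /= norm3_lt /= (distrC x0.1.1) (distrC x0.1.2) (distrC x0.2) h1 h2 h3.
have mB := measurable_box3 x0 e.
have iB : integrable3 (\1_(box3 x0 e)).
  apply: (@integrable_bsupp _ _ 1).
  - exact: measurable_indic.
  - exists (`|x0| + e) => x xe; rewrite indicE; case: (boolP (x \in _)) => //.
    rewrite inE => -[h1 h2 h3]; exfalso.
    have : `|x - x0| < e by rewrite norm3_lt /= h1 h2 h3.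
    by have := ler_normD x0 (x - x0); rewrite addrC subrK; lra.
  - by move=> x; rewrite indicE ger0_norm//; case: (_ \in _).
have le1 : f x0 / 2 * I (\1_(box3 x0 e)) <= I f.
  rewrite -IZ//; apply: I_le => //; first exact: int3Z.
  move=> x /=; rewrite indicE; case: (boolP (x \in _)) => /=.
    by rewrite inE mulr1 => /He.
  by rewrite mulr0.
apply: lt_le_trans le1; rewrite mulr_gt0//; first by rewrite divr_gt0.
have -> : I (\1_(box3 x0 e)) = (e *+ 2) ^+ 3.
  transitivity (fine (leb (box3 x0 e))); last by rewrite measure_box3.
  by rewrite /Rintegral (integral_indic _ measurableT mB) setIT.
by rewrite exprn_gt0// mulrn_wgt0.
Qed.

Lemma sqn_eq0 phi x : (sqn phi x == 0) = (phi x == 0).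
Proof.
by rewrite spinor_eq0 /sqn !paddr_eq0 ?addr_ge0 ?sqr_ge0// !sqrf_eq0 -!andbA.
Qed.

Lemma mass_gt0 phi : test_spinor phi -> (exists x, phi x != 0) -> 0 < mass phi.
Proof.
move=> tphi [x px]; apply: (@integral_gt0 _ x).
- exact: smooth_cont (tf_sqn tphi).1.
- exact: int_mass.
- by move=> y; exact: sqn_ge0.
- by rewrite lt_def sqn_ge0 sqn_eq0 px.
Qed.

Lemma mass_gt0_ex phi : 0 < mass phi -> exists x, phi x != 0.
Proof.
move=> m0; apply: contrapT => H.
suff : mass phi = 0 by move: m0 => /[swap] ->; rewrite ltxx.
rewrite /mass (_ : sqn phi = cst 0) ?Rintegral_cst ?mul0r//.
by apply/funext => x; apply/eqP; rewrite /= sqn_eq0; apply/negPn/negP => px; apply: H; exists x.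
Qed.

End Masses.

(** * Localisation by a rational cutoff *)

Section Cutoff.
Variable R : realType.
Notation V := (R * R * R)%type.
Notation Spin := (space3 R -> spinor R).
Notation leb := (@leb3 R).
Notation I f := (Rintegral leb setT f).
Notation rad := (@enorm3 R).
Notation d_ j f := (partial j f).
Implicit Types (phi : Spin) (x : V).
Variables (k : R) (k0 : 0 < k).
Local Notation s := (Num.sqrt k).

(** Test spinors already have compact support; this factor serves to obtain error bounds in [mass]
    whose constants do not depend on that support. The square root of k is an inverse length. *)
Definition cutoff x : R := (1 + k * n2 x)^-1.

Let den x : R := 1 + k * n2 x.
Let den_ge1 x : 1 <= den x.
Proof. by rewrite /den lerDl mulr_ge0 ?n2_ge0// ltW. Qed.
Let den_neq0 x : den x != 0.
Proof. by rewrite gt_eqF// (lt_le_trans ltr01). Qed.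

Lemma cut_gt0 x : 0 < cutoff x.
Proof. by rewrite invr_gt0 (lt_le_trans ltr01)//; exact: den_ge1. Qed.

Lemma cut_le1 x : cutoff x <= 1.
Proof. by rewrite invf_le1 ?(lt_le_trans ltr01)//; exact: den_ge1. Qed.

Let sden : smooth den.
Proof. exact: smoothD (smooth_cst 1) (smoothM (smooth_cst k) (smooth_n2 R)). Qed.

Lemma smooth_cut : smooth cutoff.
Proof. exact: smooth_inv sden den_neq0. Qed.

Lemma partial_cut j x : d_ j cutoff x = - (2 * k * coor3 j x * cutoff x ^+ 2).
Proof.
have E1 z : cutoff z * den z = 1 := mulVf (den_neq0 z).
have := partial_n2 j x; have [D [<- Dsm DM [_ DD] [_ _ DC]]] := partial_rules R => En.
have : D j (cutoff \* den) x = 0.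
  have -> : cutoff \* den = cst 1 by apply/funext => z; exact: E1.
  exact: DC.
rewrite (DM j _ _ x smooth_cut sden).
have -> : D j den x = k * (2 * coor3 j x).
  rewrite (DD j (cst 1) (cst k \* @n2 R) x (smooth_cst 1) (smoothM (smooth_cst k) (smooth_n2 R))).
  by rewrite (DM j _ _ x (smooth_cst k) (smooth_n2 R)) !DC En /=; ring.
move: (D j cutoff x) (coor3 j x) => dc c E.
apply: (mulfI (den_neq0 x)).
have -> : den x * - (2 * k * c * cutoff x ^+ 2) = - (cutoff x * den x) * (cutoff x * (k * (2 * c))) by ring.
by rewrite E1; lra.
Qed.

Lemma grad2_cut x : grad2 cutoff x = 4 * k ^+ 2 * n2 x * cutoff x ^+ 4.
Proof.
by rewrite /grad2 !partial_cut !coordE /n2; move: (cutoff x) => c; ring.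
Qed.

Let s0 : 0 < s. Proof. by rewrite sqrtr_gt0. Qed.
Let s2 : s ^+ 2 = k. Proof. by rewrite sqr_sqrtr// ltW. Qed.
Let cutE x : cutoff x * (1 + (s * rad x) ^+ 2) = 1.
Proof. by rewrite exprMn s2 rad2; exact: mulVf (den_neq0 x). Qed.

(** This is 2 t <= 1 + t^2 for t = s |x|. *)
Lemma rad_cut x : s * rad x * cutoff x <= 1 / 2.
Proof.
have := cutE x; have := cut_gt0 x; move: (cutoff x) (s * rad x) => c t c0 E.
have : 0 <= c * (1 - t) ^+ 2 by rewrite mulr_ge0 ?sqr_ge0// ltW.
by nra.
Qed.

(** With chi the cutoff, the left side equals 4 s (s |x| chi)^3 chi, to which [rad_cut] applies. *)
Lemma rad_grad2_cut x : rad x * grad2 cutoff x <= 4 * s.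
Proof.
have -> : grad2 cutoff x = 4 * s ^+ 4 * rad x ^+ 2 * cutoff x ^+ 4.
  have -> : s ^+ 4 = k ^+ 2 by rewrite -[in RHS]s2; ring.
  by rewrite grad2_cut rad2.
have := rad_cut x; have := cut_gt0 x; have := cut_le1 x; have := rad_ge0 x.
move: (cutoff x) (rad x) => c r r0 c1 c0 H.
have -> : r * (4 * s ^+ 4 * r ^+ 2 * c ^+ 4) = 4 * s * ((s * r * c) ^+ 3 * c) by ring.
rewrite ler_piMr ?mulr_ge0 ?(ltW s0)//.
have t0 : 0 <= s * r * c by rewrite !mulr_ge0// ltW.
rewrite mulr_ile1 ?exprn_ge0 ?(ltW c0)// exprn_ile1//; lra.
Qed.

Lemma cut_defect x : (1 - cutoff x ^+ 2) / rad x <= 2 * s.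
Proof.
have [->|x0] := eqVneq x 0; first by rewrite rad0 invr0 mulr0 mulr_ge0// ltW.
rewrite ler_pdivrMr ?rad_gt0//.
have := cutE x; have := cut_gt0 x; have := cut_le1 x; have := rad_gt0 x0.
move: (cutoff x) (rad x) => c r r0 c1 c0 E.
have t0 : 0 <= s * r by rewrite mulr_ge0 ?ltW.
rewrite -mulrA; move: (s * r) t0 E => t t0 E.
(* 1 - c^2 <= 2 (1 - c) = 2 c t^2 <= t, because c t <= 1 / 2 *)
have H1 : 0 <= c * (1 - t) ^+ 2 by rewrite mulr_ge0 ?sqr_ge0// ltW.
nra.
Qed.

Variables (phi : Spin) (tphi : test_spinor phi).
Notation N := (mass phi).
Let psi := smul cutoff phi.

Lemma test_cut : test_spinor psi. Proof. exact: test_smul smooth_cut tphi. Qed.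

Lemma mass_cut : mass psi <= N.
Proof.
apply: I_le; [exact: int_mass test_cut|exact: int_mass|].
by move=> x; rewrite sqn_smul ler_piMl ?sqn_ge0// exprn_ile1 ?cut_le1// ltW// cut_gt0.
Qed.

Lemma pot_cut : pot phi <= pot psi + 2 * s * N.
Proof.
have ic := int_pot test_cut; have im := int_mass tphi.
rewrite /mass -IZ// /pot -ID//; last exact: int3Z.
apply: I_le; [exact: int_pot|by apply: int3D => //; exact: int3Z|].
move=> x /=; rewrite sqn_smul -lerBlDl.
have -> : sqn phi x / rad x - cutoff x ^+ 2 * sqn phi x / rad x =
  ((1 - cutoff x ^+ 2) / rad x) * sqn phi x by ring.
by rewrite ler_wpM2r ?sqn_ge0//; exact: cut_defect.
Qed.

Lemma int_cut B : integrable3 (rad \* (fun x => cutoff x ^+ 2 * Psq B phi x)).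
Proof.
apply: int3_cont; first exact: (@continuous_rad R).
exact: tfM (smoothM smooth_cut smooth_cut) (tf_Psq B tphi).
Qed.

(** The square of the cutoff is kept in the kinetic integral: [Jf_lower] uses its decay to compare
    |x| with the weight [wt]. *)
Lemma kin_cut B d : 0 < d ->
  kin B psi <= (1 + d) * I (rad \* (fun x => cutoff x ^+ 2 * Psq B phi x))
    + (1 + d^-1) * (4 * s) * N.
Proof.
move=> d0; have ic := int_cut B; have im := int_mass tphi.
rewrite -!IZ// -ID; [|exact: int3Z|exact: int3Z].
apply: I_le; [exact: int_kin test_cut|by apply: int3D; exact: int3Z|].
move=> x; apply: (@le_trans _ _ (rad x * ((1 + d) * (cutoff x ^+ 2 * Psq B phi x) + (1 + d^-1) * (grad2 cutoff x * sqn phi x)))).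
  by rewrite ler_wpM2l ?rad_ge0//; exact: Psq_smul_le d0 smooth_cut (test_smooth tphi).
rewrite /= mulrDr; apply: lerD; first by rewrite mulrCA.
have -> : rad x * ((1 + d^-1) * (grad2 cutoff x * sqn phi x)) =
  (1 + d^-1) * (rad x * grad2 cutoff x) * sqn phi x by ring.
rewrite ler_wpM2r ?sqn_ge0// ler_wpM2l ?rad_grad2_cut//.
by rewrite addr_ge0// invr_ge0 ltW.
Qed.

End Cutoff.

(** * Finiteness of the infimum *)

Section LowerBound.
Variable R : realType.
Notation V := (R * R * R)%type.
Notation Spin := (space3 R -> spinor R).
Notation leb := (@leb3 R).
Notation I f := (Rintegral leb setT f).
Notation rad := (@enorm3 R).
Implicit Types (phi : Spin) (x : V) (nu : R).

(** |x| |A|^2 can grow like |x|^3, and the square of the cutoff decays like |x|^-4: one factor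
    absorbs |x|, the other |A|^2. *)
Lemma rad_vecpot_cut x : rad x * (A1 1 x ^+ 2 + A2 1 x ^+ 2) * cutoff 1 x ^+ 2 <= 1.
Proof.
have c0 := cut_gt0 (@ltr01 R) x; have r0 := rad_ge0 x.
have H1 : rad x * cutoff 1 x <= 1 / 2 by have := rad_cut (@ltr01 R) x; rewrite sqrtr1 !mul1r.
have E : A1 1 x ^+ 2 + A2 1 x ^+ 2 <= rad x ^+ 2.
  rewrite rad2 /A1 /A2 /n2; move: x.1.1 x.1.2 x.2 => a b c.
  have := sqr_ge0 a; have := sqr_ge0 b; have := sqr_ge0 c.
  rewrite !exprMn sqrrN; lra.
have H2 : rad x ^+ 2 * cutoff 1 x <= 1.
  have n0 : 0 < 1 + 1 * n2 x by rewrite ltr_wpDr// mul1r n2_ge0.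
  by rewrite rad2 ler_pdivrMr// !mul1r lerDr.
have -> : rad x * (A1 1 x ^+ 2 + A2 1 x ^+ 2) * cutoff 1 x ^+ 2 =
  (rad x * cutoff 1 x) * ((A1 1 x ^+ 2 + A2 1 x ^+ 2) * cutoff 1 x) by ring.
apply: mulr_ile1; first by rewrite mulr_ge0// ltW.
- by rewrite mulr_ge0 ?addr_ge0 ?sqr_ge0// ltW.
- by apply: (le_trans H1); lra.
- by apply: le_trans H2; rewrite ler_wpM2r// ltW.
Qed.

Lemma kin0_cut phi d : 0 < d -> test_spinor phi ->
  kin 0 (smul (cutoff 1) phi) <= (1 + d) * kin 1 (smul (cutoff 1) phi) + (1 + d^-1) * mass phi.
Proof.
move=> d0 tphi; have tpsi := test_cut (@ltr01 R) tphi.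
have i1 := int_kin 1 tpsi; have i2 := int_mass tphi.
rewrite -!IZ// -ID; [|exact: int3Z|exact: int3Z].
apply: I_le; [exact: int_kin|by apply: int3D; exact: int3Z|].
move=> x; set psi := smul (cutoff 1) phi.
apply: (@le_trans _ _ (rad x * ((1 + d) * Psq 1 psi x + (1 + d^-1) *
    ((A1 1 x ^+ 2 + A2 1 x ^+ 2) * sqn psi x)))).
  by rewrite ler_wpM2l ?rad_ge0//; exact: Psq0_le d0.
rewrite /= sqn_smul mulrDr; apply: lerD; first by rewrite mulrCA.
have -> : rad x * ((1 + d^-1) * ((A1 1 x ^+ 2 + A2 1 x ^+ 2) * (cutoff 1 x ^+ 2 * sqn phi x))) =
  (1 + d^-1) * (rad x * (A1 1 x ^+ 2 + A2 1 x ^+ 2) * cutoff 1 x ^+ 2 * sqn phi x) by ring.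
rewrite ler_wpM2l//; first by rewrite addr_ge0// invr_ge0 ltW.
by rewrite ler_piMl ?sqn_ge0//; exact: rad_vecpot_cut.
Qed.

Lemma energy_lower nu : 0 < nu < 1 -> exists C : R, forall phi, test_spinor phi ->
  - C * mass phi <= energy 1 nu phi.
Proof.
(* Removing the field and removing the cutoff each cost a factor 1 + d = 1 / nu, so that nu times
   the resulting bound on [pot] contains exactly kin / nu. *)
move=> /andP[nu0 nu1]; pose d := nu^-1 - 1; have n1 : 1 < nu^-1 by rewrite invf_gt1.
have d0 : 0 < d by rewrite subr_gt0.
have d1 : 1 + d = nu^-1 by rewrite /d addrC subrK.
pose D := 1 + d^-1.
exists (nu * (nu^-1 * (D * 4) + D + 2)) => phi tphi; rewrite energyE//.
have tpsi := test_cut (@ltr01 R) tphi.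
have H1 := pot_cut (@ltr01 R) tphi; have [_ H2] := hardy tpsi.
have H3 := kin0_cut d0 tphi; have H4 := kin_cut (@ltr01 R) tphi 1 d0.
have H5 : I (rad \* (fun x => cutoff 1 x ^+ 2 * Psq 1 phi x)) <= kin 1 phi.
  apply: I_le; [exact: int_cut|exact: int_kin|] => x /=.
  rewrite ler_wpM2l ?rad_ge0// ler_piMl ?Psq_ge0//.
  by rewrite exprn_ile1 ?cut_le1// ltW// cut_gt0.
rewrite -/(pot (smul (cutoff 1) phi)) -/(kin 0 (smul (cutoff 1) phi)) in H2.
rewrite sqrtr1 !mulr1 -/D in H1 H4; rewrite d1 -/D in H3 H4.
have n0 : 0 < nu^-1 by rewrite invr_gt0.
have nE : nu * nu^-1 = 1 by rewrite mulfV// gt_eqF.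
move: H1 H2 H3 H4 H5; move: (pot phi) (pot (smul (cutoff 1) phi)) (kin 0 _) (kin 1 (smul _ _)) (I _) (kin 1 phi) (mass phi).
move: D (nu^-1) nE n0 => D m nE m0 p p1 k0 k1 i k N H1 H2 H3 H4 H5.
have H6 : p <= m * (m * k + D * 4 * N) + D * N + 2 * N.
  apply: (le_trans H1); rewrite lerD2r (le_trans H2)// (le_trans H3)// lerD2r ler_wpM2l ?(ltW m0)//.
  by rewrite (le_trans H4)// lerD2r ler_wpM2l ?(ltW m0).
have : nu * p <= nu * (m * (m * k + D * 4 * N) + D * N + 2 * N) by rewrite ler_wpM2l ?(ltW nu0).
have -> : nu * (m * (m * k + D * 4 * N) + D * N + 2 * N) =
  (nu * m) * m * k + (nu * (m * (D * 4) + D + 2)) * N by ring.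
by rewrite nE; lra.
Qed.

End LowerBound.

(** * A family of trial spinors with negative energy *)

Section Trial.
Variable R : realType.
Notation V := (R * R * R)%type.
Notation Spin := (space3 R -> spinor R).
Implicit Types (phi psi : Spin) (x : V) (B nu : R) (f g : V -> R).
Notation leb := (@leb3 R).
Notation lam := (@lebesgue_measure R).
Notation I f := (Rintegral leb setT f).
Notation rad := (@enorm3 R).
Notation d_ j f := (partial j f).
Notation RR := (measurableTypeR R).

Lemma partial_comp (h : R -> R) (dh : R) j f x : smooth f -> is_derive (f x) 1 h dh ->
  d_ j (h \o f) x = dh * d_ j f x.
Proof.
move=> sf dhf; have df := derivableP (smooth_derivable _ sf j x).
by have [_ E] := is_derive_chain dhf df.
Qed.

Lemma I_le_int f g (c : R) : integrable3 f -> measurable3 g -> (forall x, 0 <= f x) ->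
  (forall x, f x <= g x) -> (\int[leb]_x (g x)%:E = c%:E)%E -> I f <= c.
Proof.
move=> intf mg f0 fg E.
rewrite -lee_fin -E /Rintegral fineK; last exact: integrable_fin_num.
apply: ge0_le_integral => //.
- by move=> x _; rewrite lee_fin.
- by case/integrableP: intf.
- by apply/measurable_EFinP; exact: mg.
- by move=> x _; rewrite lee_fin.
Qed.

Lemma I_ge_int f g (c : R) : integrable3 f -> measurable3 g -> (forall x, 0 <= g x) ->
  (forall x, g x <= f x) -> (\int[leb]_x (g x)%:E = c%:E)%E -> c <= I f.
Proof.
move=> intf mg g0 gf E.
rewrite -lee_fin -E /Rintegral fineK; last exact: integrable_fin_num.
apply: ge0_le_integral => //.
- by move=> x _; rewrite lee_fin.
- by apply/measurable_EFinP; exact: mg.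
- by case/integrableP: intf.
- by move=> x _; rewrite lee_fin.
Qed.

Definition planar x : R := - 4^-1 * (x.1.1 ^+ 2 + x.1.2 ^+ 2).

Lemma planarE : planar = cst (- 4^-1) \* ((coor3 i0 \* coor3 i0) \+ (coor3 i1 \* coor3 i1)).
Proof. by apply/funext => x; rewrite /= !coordE /planar !expr2. Qed.

Lemma smooth_planar : smooth planar.
Proof.
have s2 j : smooth (coor3 j \* coor3 j : V -> R) := smoothM (smooth_coord R j) (smooth_coord R j).
by rewrite planarE; exact: smoothM (smooth_cst _) (smoothD (s2 i0) (s2 i1)).
Qed.

Lemma partial_planar x : (d_ i0 planar x = - 2^-1 * x.1.1) *
  (d_ i1 planar x = - 2^-1 * x.1.2) * (d_ i2 planar x = 0).
Proof.
have [D [<- Dsm DM [_ DD] [_ DX DC]]] := partial_rules R.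
have sX k := smooth_coord R k.
have s2 k : smooth (coor3 k \* coor3 k : V -> R) := smoothM (sX k) (sX k).
have E j : D j planar x = - 4^-1 * (2 * ((i0 == j)%:R * coor3 i0 x + (i1 == j)%:R * coor3 i1 x)).
  rewrite planarE (DM j _ _ x (smooth_cst (- 4^-1)) (smoothD (s2 i0) (s2 i1))) DC.
  rewrite (DD j _ _ x (s2 i0) (s2 i1)).
  rewrite (DM j _ _ x (sX i0) (sX i0)) (DM j _ _ x (sX i1) (sX i1)) (DX j i0) (DX j i1) /=; ring.
by rewrite !E !coordE !eqxx !delta3 /=; split; [split|]; field.
Qed.

Definition zeromode : V -> R := expR \o planar.

Lemma smooth_zeromode : smooth zeromode.
Proof. exact: smooth_expR smooth_planar. Qed.

Lemma partial_zeromode j x : d_ j zeromode x = zeromode x * d_ j planar x.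
Proof. exact: partial_comp smooth_planar (is_derive_expR _). Qed.

Definition zmspinor : Spin := mkspinor zeromode (cst 0) (cst 0) (cst 0).

Lemma smooth_zmspinor : smooth_spinor zmspinor.
Proof.
by rewrite /smooth_spinor /zmspinor !mkE; split; [exact: smooth_zeromode| | |]; exact: smooth_cst.
Qed.

(** A Gaussian of the lowest Landau level, constant along the field: on the spin-up component its
    planar derivatives cancel against the vector potential of the unit field. *)
Lemma Psq_zmspinor x : Psq 1 zmspinor x = 0.
Proof.
rewrite /Psq /zmspinor !mkE /prow1 /prow2 /prow3 /prow4 !partial_zeromode !partial_planar.
have -> : A1 1 x = - 2^-1 * x.1.2 by rewrite /A1 div1r.
have -> : A2 1 x = 2^-1 * x.1.1 by rewrite /A2 div1r.
rewrite !partial_cst /=; move: (zeromode x) x.1.1 x.1.2 => z a b; ring.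
Qed.

Variables (S : R) (S3 : 3 <= S).
Let S0 : 0 < S. Proof. exact: lt_le_trans S3. Qed.

Definition ball_arg x : R := 1 - (S ^+ 2)^-1 * n2 x.
Definition bump : V -> R := flat 0 \o ball_arg.

Lemma smooth_ball_arg : smooth ball_arg.
Proof. exact: smoothB (smooth_cst 1) (smoothM (smooth_cst _) (smooth_n2 R)). Qed.

Lemma partial_ball_arg j x : d_ j ball_arg x = - ((S ^+ 2)^-1 * (2 * coor3 j x)).
Proof.
have := partial_n2 j x; have [D [<- Dsm DM [DB DD] [_ DX DC]]] := partial_rules R => En.
rewrite (DB j (cst 1) _ x (smooth_cst 1) (smoothM (smooth_cst (S ^+ 2)^-1) (smooth_n2 R))).
by rewrite (DM j (cst (S ^+ 2)^-1) _ x (smooth_cst _) (smooth_n2 R)) !DC En /=; ring.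
Qed.

Lemma smooth_bump : smooth bump. Proof. exact: smooth_flat smooth_ball_arg. Qed.

Lemma tf_bump : tf bump.
Proof.
split; first exact: smooth_bump.
exists S => x Sx; rewrite /bump /= /flat ifF//; apply/negbTE; rewrite -leNgt /ball_arg.
rewrite subr_le0 mulrC ler_pdivlMr ?exprn_gt0// mul1r.
apply: (@le_trans _ _ (`|x| ^+ 2)); first by rewrite ler_pXn2r ?nnegrE ?normr_ge0 ?(ltW S0) ?(ltW Sx).
rewrite prod_normE /= prod_normE /n2.
have aux (a b : R) : Num.max `|a| `|b| ^+ 2 <= `|a| ^+ 2 + `|b| ^+ 2.
  by rewrite /Num.max; case: ifP => _; rewrite ?lerDl ?lerDr sqr_ge0.
have := aux x.1.1 x.1.2; have := aux (Num.max `|x.1.1| `|x.1.2|) x.2.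
rewrite !real_normK ?num_real// (ger0_norm (_ : 0 <= Num.max _ _)) ?le_max ?normr_ge0//.
lra.
Qed.

Lemma partial_bump j x : d_ j bump x = flat 2 (ball_arg x) * - ((S ^+ 2)^-1 * (2 * coor3 j x)).
Proof.
rewrite -partial_ball_arg; apply: partial_comp; first exact: smooth_ball_arg.
by apply: is_derive_eq; first exact: is_derive_flat; rewrite mul0r subr0.
Qed.

Lemma grad2_bump x : grad2 bump x = 4 * ((S ^+ 2)^-1) ^+ 2 * n2 x * flat 2 (ball_arg x) ^+ 2.
Proof.
by rewrite /grad2 !partial_bump !coordE /n2; move: (flat _ _) (_^-1) => c y; ring.
Qed.

(** The derivative of [flat 0] is [flat 2], bounded by 4! = 24 up to t = 1, and the remaining factor
    4 |x|^3 / S^4 is at most 4 / S. The indicator keeps the support in the one direction in which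
    the zero mode does not decay. *)
Lemma rad_grad2_bump x : rad x * grad2 bump x <= 4 * 24 ^+ 2 / S * \1_(`[- S, S]) x.2.
Proof.
rewrite grad2_bump -rad2.
have [ge|lt] := leP (ball_arg x) 0.
  have -> : flat 2 (ball_arg x) = 0 by rewrite /flat ifF//; apply/negbTE; rewrite -leNgt.
  rewrite expr0n mulr0 mulr0; apply: mulr_ge0; first by rewrite divr_ge0 ?mulr_ge0 ?exprn_ge0 ?(ltW S0).
  by rewrite indicE ler0n.
have rS : rad x <= S.
  rewrite -(@ler_pXn2r _ 2) ?nnegrE ?rad_ge0 ?(ltW S0)// rad2.
  by move: lt; rewrite /ball_arg subr_gt0 mulrC ltr_pdivrMr ?exprn_gt0// mul1r => /ltW.
have -> : \1_(`[- S, S]) x.2 = 1 :> R.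
  rewrite indicE mem_set//= in_itv /= -ler_norml; apply: le_trans rS.
  rewrite -(@ler_pXn2r _ 2) ?nnegrE ?rad_ge0// rad2 real_normK ?num_real// /n2.
  by rewrite lerDr addr_ge0// sqr_ge0.
have t1 : ball_arg x <= 1 by rewrite /ball_arg gerBl mulr_ge0 ?n2_ge0// invr_ge0 sqr_ge0.
have F0 := flat_ge0 2 (ball_arg x).
have F1 : flat 2 (ball_arg x) <= 24.
  have := flat_le 2 (ball_arg x); rewrite ger0_norm// => /le_trans; apply.
  by rewrite (_ : 4`! = 24)%N// ler_piMr// exprn_ile1// ltW.
have F2 : flat 2 (ball_arg x) ^+ 2 <= 24 ^+ 2 by rewrite ler_pXn2r ?nnegrE.
rewrite mulr1.
have r0 := rad_ge0 x.
have H : (rad x / S) ^+ 3 <= 1 by rewrite exprn_ile1 ?divr_ge0 ?(ltW S0)// ler_pdivrMr// mul1r.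
have -> : rad x * (4 * (S ^+ 2)^-1 ^+ 2 * rad x ^+ 2 * flat 2 (ball_arg x) ^+ 2) =
  4 / S * (flat 2 (ball_arg x) ^+ 2 * (rad x / S) ^+ 3).
  by move: (flat _ _) (rad x) => a b; field; rewrite gt_eqF.
rewrite (mulrAC 4 (24 ^+ 2)).
rewrite ler_wpM2l ?divr_ge0 ?(ltW S0)//.
apply: le_trans F2; rewrite ler_piMr ?sqr_ge0//.
Qed.

Definition trial : Spin := smul bump zmspinor.

Lemma test_trial : test_spinor trial.
Proof.
have aux f : smooth f -> tf (bump \* f).
  move=> sf; rewrite (_ : bump \* f = f \* bump); first exact: tfM sf tf_bump.
  by apply/funext => x; rewrite /= mulrC.
apply/test_spinorP; rewrite /trial /smul !mkE.
by split; apply: aux; [exact: smooth_zeromode| | |]; exact: smooth_cst.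
Qed.

Definition gauss1 (t : R) : R := gauss_fun ((Num.sqrt 2)^-1 * t).

Lemma sqn_zmspinor x : sqn zmspinor x = gauss1 x.1.1 * gauss1 x.1.2.
Proof.
rewrite /sqn /zmspinor !mkE /= expr0n /= !addr0 /zeromode /= /gauss1 /gauss_fun.
rewrite -expRD -expRM_natl; congr expR.
by rewrite !exprMn !exprVn !sqr_sqrtr// /planar; field.
Qed.

Lemma integral_gauss1 : (\int[lam]_t (gauss1 t)%:E = (Num.sqrt 2 * Num.sqrt pi)%:E)%E.
Proof.
have s2 : 0 < (Num.sqrt 2)^-1 :> R by rewrite invr_gt0 sqrtr_gt0.
rewrite (@ge0_integral_dilate1 _ _ s2 (EFin \o @gauss_fun R)).
- by rewrite integralT_gauss invrK.
- by apply/measurable_EFinP; exact: measurable_gauss_fun.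
- by move=> x; rewrite lee_fin gauss_fun_ge0.
Qed.


Lemma measurable_gauss1 : measurable_fun (setT : set RR) gauss1.
Proof.
apply: (measurableT_comp (@measurable_gauss_fun R)).
exact: (mulrl_measurable (Num.sqrt 2)^-1 : measurable_fun (setT : set RR) _).
Qed.

Lemma gauss1_ge0 t : 0 <= gauss1 t. Proof. exact: gauss_fun_ge0. Qed.

Lemma measurable3_prod (f g h : R -> R) :
  measurable_fun (setT : set RR) f -> measurable_fun (setT : set RR) g ->
  measurable_fun (setT : set RR) h ->
  measurable3 (fun x => f x.1.1 * g x.1.2 * h x.2).
Proof.
move=> mf mg mh; apply: measurable_funM; first apply: measurable_funM.
- by apply: (measurableT_comp mf); exact: (measurableT_comp measurable_fst measurable_fst).
- by apply: (measurableT_comp mg); exact: (measurableT_comp measurable_snd measurable_fst).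
- by apply: (measurableT_comp mh); exact: measurable_snd.
Qed.

Lemma integral_indic_itv (a b : R) : a <= b ->
  (\int[lam]_t (\1_(`[a, b]) t)%:E = (b - a)%:E)%E.
Proof.
move=> ab; rewrite integral_indic//= setIT lebesgue_measure_itv/= lte_fin.
by case: ltgtP ab => // -> _; rewrite subrr.
Qed.

Definition kin_bound : R := 2 * (4 * 24 ^+ 2) * (2 * (Num.sqrt 2 * Num.sqrt pi) ^+ 2).

(** Only the gradient of the bump contributes, since P_1 kills the zero mode. The factor 1 / S is
    compensated by the length 2 S of the support along the field, so the bound does not depend on
    S. *)
Lemma kin_trial : kin 1 trial <= kin_bound.
Proof.
have mg := measurable_gauss1.
have mi : measurable_fun (setT : set RR) (\1_(`[- S, S]) : R -> R) by exact: measurable_indic.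
pose C : R := 2 * (4 * 24 ^+ 2 / S).
have C0 : 0 < C by rewrite /C !mulr_gt0 ?exprn_gt0 ?invr_gt0.
have ik := int_kin 1 test_trial.
suff H : I (cst C^-1 \* (rad \* Psq 1 trial)) <= (Num.sqrt 2 * Num.sqrt pi) ^+ 2 * (S *+ 2).
  move: H; rewrite IZ// -/(kin 1 trial) mulrC ler_pdivrMr//.
  move=> /le_trans; apply; rewrite le_eqVlt; apply/orP; left; apply/eqP.
  by rewrite /C /kin_bound; move: (24 ^+ 2) (Num.sqrt 2 * _) => a b; field; rewrite gt_eqF.
apply: (I_le_int (int3Z _ ik) (measurable3_prod mg mg mi)).
- by move=> x /=; rewrite mulr_ge0 ?invr_ge0 ?(ltW C0)// mulr_ge0 ?rad_ge0 ?Psq_ge0.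
- move=> x /=; rewrite mulrC ler_pdivrMr//.
  apply: (@le_trans _ _ (rad x * (2 * (grad2 bump x * sqn zmspinor x)))).
    rewrite ler_wpM2l ?rad_ge0//.
    apply: le_trans (Psq_smul_le 1 x ltr01 smooth_bump smooth_zmspinor) _.
    by rewrite Psq_zmspinor !mulr0 add0r invr1.
  have -> : rad x * (2 * (grad2 bump x * sqn zmspinor x)) = sqn zmspinor x * 2 * (rad x * grad2 bump x).
    by move: (rad x) (grad2 _ _) (sqn _ _) => *; ring.
  apply: le_trans (ler_wpM2l _ (rad_grad2_bump x)) _; first by rewrite mulr_ge0 ?sqn_ge0.
  rewrite sqn_zmspinor /C le_eqVlt; apply/orP; left; apply/eqP.
  by move: (4 * 24 ^+ 2 / S) (gauss1 _) (gauss1 _) (\1_ _ _) => *; ring.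
- rewrite integral_prod3//; try exact: gauss1_ge0.
  have SS : - S <= S by apply: (@le_trans _ _ 0); rewrite ?oppr_le0 ltW.
  by rewrite integral_gauss1 (integral_indic_itv SS) -!EFinM opprK.
Qed.

Definition recip : R -> R := (fun z => z^-1) \_ `[1, S / 2].

Let S1 : 1 < S / 2. Proof. by rewrite ltr_pdivlMr// mul1r (lt_le_trans _ S3)// ltr_nat. Qed.

Let cV : {within `[1, S / 2], continuous (fun z : R => z^-1)}.
Proof.
apply: continuous_in_subspaceT => z; rewrite inE /= in_itv /= => /andP[z1 _].
by apply: inv_continuous; rewrite gt_eqF// (lt_le_trans ltr01).
Qed.

Lemma measurable_recip : measurable_fun (setT : set RR) recip.
Proof.
apply/(measurable_restrictT _ (measurable_itv `[1, S / 2])).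
exact: subspace_continuous_measurable_fun.
Qed.

Lemma integral_recip : (\int[lam]_z (recip z)%:E = (ln (S / 2))%:E)%E.
Proof.
have -> : (fun z => (recip z)%:E) = (fun z : R => (z^-1)%:E) \_ `[1, S / 2].
  by apply/funext => z; rewrite /recip /= !patchE; case: ifP.
rewrite -integral_mkcond (@continuous_FTC2 _ (fun z => z^-1) (@ln R))//.
- by rewrite ln1 sube0.
- split=> [z||].
  + by rewrite in_itv /= => /andP[z1 _]; have [] := is_derive1_ln (lt_trans ltr01 z1).
  + by apply: cvg_at_right_filter; exact: continuous_ln.
  + by apply: cvg_at_left_filter; apply: continuous_ln; exact: lt_trans S1.
- by move=> z; rewrite in_itv /= => /andP[z1 _]; rewrite derive1E; have [_ ->] := is_derive1_ln (lt_trans ltr01 z1).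
Qed.

Definition pot_factor : R := expR (- 2) ^+ 2 * expR (- 1) ^+ 2 / 2.

(** The density is bounded below on the column 0 <= x1, x2 <= 1, 1 <= x3 <= S / 2, where |x| <= 2
    x3, the bump is at least exp (-2) and each Gaussian at least exp (-1); integrating 1 / x3 gives
    the logarithm. *)
Lemma pot_trial : pot_factor * ln (S / 2) <= pot trial.
Proof.
have mi : measurable_fun (setT : set RR) (\1_(`[0, 1]) : R -> R) by exact: measurable_indic.
have mr := measurable_recip.
have c0 : 0 < pot_factor by rewrite /pot_factor divr_gt0// mulr_gt0// exprn_gt0// expR_gt0.
have ip := int_pot test_trial.
suff H : ln (S / 2) <= I (cst pot_factor^-1 \* (fun x => sqn trial x / rad x)).
  by move: H; rewrite IZ// -/(pot trial) ler_pdivlMl.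
have r0 z : 0 <= recip z.
  rewrite /recip patchE; case: ifPn => //; rewrite inE /= in_itv /= => /andP[z1 _].
  by rewrite invr_ge0 (le_trans ler01).
apply: (I_ge_int (int3Z _ ip) (measurable3_prod mi mi mr)).
- by move=> x; rewrite !mulr_ge0.
- move=> x /=; rewrite [leRHS]mulrC ler_pdivlMr//.
  have P0 : 0 <= sqn trial x / rad x by rewrite divr_ge0 ?sqn_ge0 ?rad_ge0.
  rewrite indicE; case: (boolP (x.1.1 \in _)) => [|_]; last by rewrite !mul0r.
  rewrite inE /= in_itv /= => /andP[a0 a1].
  rewrite indicE; case: (boolP (x.1.2 \in _)) => [|_]; last by rewrite mulr0 !mul0r.
  rewrite inE /= in_itv /= => /andP[b0 b1].
  rewrite /recip patchE; case: ifPn => [|_]; last by rewrite mulr0 !mul0r.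
  rewrite inE /= in_itv /= => /andP[z1 zS].
  have z0 : 0 < x.2 by rewrite (lt_le_trans ltr01).
  have aa : x.1.1 ^+ 2 <= 1 by rewrite exprn_ile1.
  have bb : x.1.2 ^+ 2 <= 1 by rewrite exprn_ile1.
  have zz : 1 <= x.2 ^+ 2 by rewrite exprn_ege1.
  have zS2 : x.2 ^+ 2 <= S ^+ 2 / 4.
    have -> : S ^+ 2 / 4 = (S / 2) ^+ 2 by field.
    by rewrite ler_pXn2r ?nnegrE ?(ltW z0) ?divr_ge0 ?(ltW S0).
  (* Makes 2 + S^2 / 4, which bounds |x|^2 on the column, at most S^2 / 2; this is the bound on
     [ball_arg] below. *)
  have SS : 9 <= S ^+ 2 by move: S3 => S3'; rewrite expr2; nra.
  have rz : rad x <= 2 * x.2.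
    rewrite -(@ler_pXn2r _ 2) ?nnegrE ?rad_ge0 ?mulr_ge0 ?(ltW z0)// rad2 /n2 exprMn.
    lra.
  have r1 : 0 < rad x.
    by rewrite sqrtr_gt0 ltr_wpDl ?addr_ge0 ?sqr_ge0// (lt_le_trans ltr01).
  have t1 : 1 / 2 <= ball_arg x.
    rewrite /ball_arg lerBrDr -lerBrDl mulrC ler_pdivrMr ?exprn_gt0// /n2; lra.
  have f1 : expR (- 2) <= bump x.
    rewrite /bump /= /flat ifT ?expr0 ?mul1r; last by apply: lt_le_trans t1.
    rewrite ler_expR lerN2 invf_ple ?posrE//; [by rewrite -div1r|by apply: lt_le_trans t1].
  have g1 t : t ^+ 2 <= 1 -> expR (- 1) <= gauss1 t.
    move=> tt; rewrite /gauss1 /gauss_fun ler_expR lerN2 exprMn exprVn sqr_sqrtr//.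
    by have := sqr_ge0 t; lra.
  rewrite /trial sqn_smul sqn_zmspinor !mul1r.
  have -> : (x.2)^-1 * pot_factor = expR (- 2) ^+ 2 * (expR (- 1) * expR (- 1)) / (2 * x.2).
    by rewrite /pot_factor invfM; move: (expR _) (expR _) (x.2^-1) => *; ring.
  apply: ler_pM.
  + by rewrite mulr_ge0 ?sqr_ge0 ?mulr_ge0 ?expR_ge0.
  + by rewrite invr_ge0 mulr_ge0// ltW.
  + apply: ler_pM; rewrite ?sqr_ge0 ?mulr_ge0 ?expR_ge0//.
      by rewrite ler_pXn2r ?nnegrE ?expR_ge0 ?flat_ge0.
    by apply: ler_pM; rewrite ?expR_ge0 ?g1.
  + by rewrite lef_pV2 ?posrE ?mulr_gt0.
- rewrite integral_prod3//.
  by rewrite integral_indic_itv// integral_recip subr0 !mul1e.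
Qed.

Lemma trial_neq0 : trial 0 != 0.
Proof.
rewrite -sqn_eq0 /trial sqn_smul sqn_zmspinor gt_eqF// mulr_gt0//.
  rewrite exprn_gt0// /bump /= /flat /ball_arg /n2 /= !expr0n /= !addr0 mulr0 subr0 ltr01.
  by rewrite expr0 mul1r expR_gt0.
by rewrite mulr_gt0//; exact: expR_gt0.
Qed.

End Trial.

Section NegativeEnergy.
Variable R : realType.

Lemma energy_neg (nu : R) : 0 < nu -> exists phi : space3 R -> spinor R,
  [/\ test_spinor phi, exists x, phi x != 0 & energy 1 nu phi < 0].
Proof.
move=> nu0.
have c0 : 0 < pot_factor R by rewrite /pot_factor divr_gt0// mulr_gt0// exprn_gt0// expR_gt0.
have K0 : 0 <= kin_bound R by rewrite /kin_bound !mulr_ge0// sqr_ge0.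
(* Solves for nu [pot_factor] L = [kin_bound] / nu + nu [pot_factor]; the choice of S turns ln (S /
   2) into L. *)
pose L := kin_bound R / (nu ^+ 2 * pot_factor R) + 1.
have L1 : 1 <= L by rewrite /L lerDr divr_ge0// mulr_ge0 ?sqr_ge0// ltW.
pose S := 2 * expR L.
have S3 : 3 <= S by have := expR_ge1Dx L; rewrite /S; lra.
exists (trial S); split; [exact: test_trial|by exists 0; exact: trial_neq0|].
rewrite energyE; last exact: test_trial.
have := pot_trial S3; have := kin_trial S3.
have -> : S / 2 = expR L by rewrite /S mulrC mulKf.
rewrite expRK => Hk Hp; rewrite subr_lt0.
apply: (@le_lt_trans _ _ (kin_bound R / nu)); first by rewrite ler_wpM2r// invr_ge0 ltW.
apply: (@lt_le_trans _ _ (nu * (pot_factor R * L))); last by rewrite ler_wpM2l// ltW.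
have -> : nu * (pot_factor R * L) = kin_bound R / nu + nu * pot_factor R.
  by rewrite /L; move: (kin_bound R) => k; field; rewrite !gt_eqF.
by rewrite ltrDl mulr_gt0.
Qed.

End NegativeEnergy.

(** * The infimum mu and dilations *)

Section Mu.
Variable R : realType.
Notation V := (R * R * R)%type.
Notation Spin := (space3 R -> spinor R).
Implicit Types (phi psi : Spin) (x : V) (B nu : R) (f g : V -> R).
Notation leb := (@leb3 R).
Notation I f := (Rintegral leb setT f).
Notation rad := (@enorm3 R).

Definition muR nu : R := fine (mu nu).

Lemma mu_fin_num nu : 0 < nu < 1 -> mu nu \is a fin_num.
Proof.
move=> nu01; have /andP[nu0 _] := nu01.
have [C HC] := energy_lower nu01; have [phi [tphi nphi _]] := energy_neg nu0.
rewrite fin_numE; apply/andP; split.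
- rewrite gt_eqF// (@lt_le_trans _ _ (- C)%:E) ?ltNyr//.
  apply: le_ereal_inf_tmp => _ [psi [tpsi npsi] <-]; rewrite lee_fin L2norm2.
  by rewrite ler_pdivlMr ?HC// mass_gt0.
- rewrite lt_eqF// (@le_lt_trans _ _ (energy 1 nu phi / L2norm phi ^+ 2)%:E) ?ltry//.
  by apply: ereal_inf_lbound; exists phi.
Qed.

Lemma muRE nu : 0 < nu < 1 -> mu nu = (muR nu)%:E.
Proof. by move=> /mu_fin_num h; rewrite /muR fineK. Qed.

Lemma muR_lt0 nu : 0 < nu < 1 -> muR nu < 0.
Proof.
move=> nu01; have /andP[nu0 _] := nu01.
have [phi [tphi nphi e0]] := energy_neg nu0.
rewrite -lte_fin -muRE//; apply: (@le_lt_trans _ _ (energy 1 nu phi / L2norm phi ^+ 2)%:E).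
  by apply: ereal_inf_lbound; exists phi.
by rewrite lte_fin L2norm2 pmulr_llt0// invr_gt0 mass_gt0.
Qed.

(** At mass 0 the quotient defining [mu] says nothing, and [energy_lower] supplies a nonnegative
    energy. *)
Lemma muR_le nu phi : 0 < nu < 1 -> test_spinor phi -> muR nu * mass phi <= energy 1 nu phi.
Proof.
move=> nu01 tphi; have := mass_ge0 phi; rewrite le_eqVlt => /orP[/eqP m0|m0].
  by have [C HC] := energy_lower nu01; have := HC _ tphi; rewrite -m0 !mulr0.
rewrite -ler_pdivlMr// -lee_fin -muRE// -L2norm2; apply: ereal_inf_lbound; exists phi => //.
by split=> //; exact: mass_gt0_ex.
Qed.

Lemma muR_lt nu (m : R) : 0 < nu < 1 -> muR nu < m ->
  exists phi, [/\ test_spinor phi, 0 < mass phi & energy 1 nu phi < m * mass phi].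
Proof.
move=> nu01; rewrite -lte_fin -muRE// => /ereal_inf_lt[_ [phi [tphi nphi] <-]].
have m0 := mass_gt0 tphi nphi.
by rewrite lte_fin L2norm2 ltr_pdivrMr// => ?; exists phi.
Qed.

Lemma muR_ge nu (m : R) : 0 < nu < 1 ->
  (forall phi, test_spinor phi -> m * mass phi <= energy 1 nu phi) -> m <= muR nu.
Proof.
move=> nu01 H; rewrite leNgt; apply/negP => /(muR_lt nu01)[phi [tphi m0]].
by rewrite ltNge H.
Qed.

(** In (nu2 / nu1) E_nu1 - E_nu2 the potential parts cancel, and a nonnegative multiple of [kin]
    remains. *)
Lemma muR_mono nu1 nu2 : 0 < nu1 -> nu1 < nu2 -> nu2 < 1 ->
  muR nu2 <= nu2 / nu1 * muR nu1.
Proof.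
move=> n1 n12 n2; have n2' := lt_trans n1 n12.
have h1 : 0 < nu1 < 1 by rewrite n1 (lt_trans n12).
have h2 : 0 < nu2 < 1 by rewrite n2'.
rewrite -ler_pdivrMl ?divr_gt0//; apply: muR_ge => // phi tphi.
rewrite -mulrA ler_pdivrMl ?divr_gt0//.
have := muR_le h2 tphi => /le_trans; apply.
rewrite !energyE// -subr_ge0.
have -> : (nu2 / nu1) * (kin 1 phi / nu1 - nu1 * pot phi) - (kin 1 phi / nu2 - nu2 * pot phi) =
  kin 1 phi * (nu2 ^+ 2 - nu1 ^+ 2) / (nu1 ^+ 2 * nu2).
  by move: (kin _ _) (pot _) => a b; field; rewrite !gt_eqF.
have s0 : 0 <= nu2 ^+ 2 - nu1 ^+ 2 by rewrite subr_ge0 ler_pXn2r ?nnegrE ?ltW.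
by rewrite divr_ge0// mulr_ge0 ?kin_ge0 ?sqr_ge0// ltW.
Qed.

Lemma muR_decr nu1 nu2 : 0 < nu1 -> nu1 < nu2 -> nu2 < 1 -> muR nu2 < muR nu1.
Proof.
move=> n1 n12 n2; apply: le_lt_trans (muR_mono n1 n12 n2) _.
have h1 : 0 < nu1 < 1 by rewrite n1 (lt_trans n12).
by rewrite -subr_gt0 -{1}[muR nu1]mul1r -mulrBl nmulr_lgt0 ?muR_lt0// subr_lt0 ltr_pdivlMr// mul1r.
Qed.

(* nu * mu(nu) is an infimum of functions affine in nu^2, hence concave in nu^2. *)
Lemma muR_concave nu1 nu2 nu3 : 0 < nu1 -> nu1 < nu2 -> nu2 < nu3 -> nu3 < 1 ->
  (nu3 ^+ 2 - nu2 ^+ 2) * (nu1 * muR nu1) + (nu2 ^+ 2 - nu1 ^+ 2) * (nu3 * muR nu3) <=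
  (nu3 ^+ 2 - nu1 ^+ 2) * (nu2 * muR nu2).
Proof.
move=> n1 n12 n23 n3; have n2 := lt_trans n1 n12; have n3' := lt_trans n2 n23.
have h1 : 0 < nu1 < 1 by rewrite n1 (lt_trans n12)// (lt_trans n23).
have h2 : 0 < nu2 < 1 by rewrite n2 (lt_trans n23).
have h3 : 0 < nu3 < 1 by rewrite n3'.
have sq (a b : R) : 0 < a -> a < b -> 0 < b ^+ 2 - a ^+ 2.
  by move=> a0 ab; rewrite subr_gt0 ltr_pXn2r ?nnegrE ?(ltW a0)// ltW// (lt_trans a0).
have t12 := sq _ _ n1 n12; have t23 := sq _ _ n2 n23; have t13 := sq _ _ n1 (lt_trans n12 n23).
rewrite [leRHS]mulrA -ler_pdivrMl ?mulr_gt0//; apply: muR_ge => // phi tphi.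
rewrite -mulrA ler_pdivrMl ?mulr_gt0//.
have H1 : (nu3 ^+ 2 - nu2 ^+ 2) * nu1 * (muR nu1 * mass phi) <=
    (nu3 ^+ 2 - nu2 ^+ 2) * nu1 * energy 1 nu1 phi.
  by rewrite ler_pM2l ?mulr_gt0//; exact: muR_le.
have H3 : (nu2 ^+ 2 - nu1 ^+ 2) * nu3 * (muR nu3 * mass phi) <=
    (nu2 ^+ 2 - nu1 ^+ 2) * nu3 * energy 1 nu3 phi.
  by rewrite ler_pM2l ?mulr_gt0//; exact: muR_le.
have -> : (nu3 ^+ 2 - nu1 ^+ 2) * nu2 * energy 1 nu2 phi =
    (nu3 ^+ 2 - nu2 ^+ 2) * nu1 * energy 1 nu1 phi +
    (nu2 ^+ 2 - nu1 ^+ 2) * nu3 * energy 1 nu3 phi.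
  by rewrite !energyE//; move: (kin _ _) (pot _) => a b; field; rewrite !gt_eqF.
by apply: le_trans (lerD H1 H3); rewrite le_eqVlt; apply/orP; left; apply/eqP; ring.
Qed.

(** [F] is nonincreasing and concave as a function of t^2, so its chords between nu and any t < b
    are at most as steep as the chord from nu to b. The single slope [L] therefore controls [F] on
    both sides of nu. *)
Lemma continuous_muR nu : 0 < nu < 1 -> {for nu, continuous muR}.
Proof.
move=> /andP[n0 n1]; pose b := (nu + 1) / 2.
have nb : nu < b by rewrite /b; lra.
have b1 : b < 1 by rewrite /b; lra.
pose F t := t * muR t.
have sq (a c : R) : 0 < a -> a < c -> 0 < c ^+ 2 - a ^+ 2.
  by move=> a0 ac; rewrite subr_gt0 ltr_pXn2r ?nnegrE ?(ltW a0)// ltW// (lt_trans a0).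
have Fdecr u v : 0 < u -> u < v -> v < 1 -> F v <= F u.
  move=> u0 uv v1; have := muR_mono u0 uv v1.
  have u01 : 0 < u < 1 by rewrite u0 (lt_trans uv).
  have v0 := lt_trans u0 uv.
  move=> H; rewrite /F; have m0 := muR_lt0 u01.
  apply: (@le_trans _ _ (v * (v / u * muR u))); first by rewrite ler_pM2l.
  rewrite mulrA ler_nM2r// mulrA ler_pdivlMr// -!expr2 ler_pXn2r ?nnegrE ?(ltW u0) ?(ltW v0)//.
  exact: ltW.
have tb := sq _ _ n0 nb.
pose L := (F nu - F b) / (b ^+ 2 - nu ^+ 2).
have L0 : 0 <= L by rewrite divr_ge0 ?(ltW tb)// subr_ge0 Fdecr.
have LE : F b = F nu - L * (b ^+ 2 - nu ^+ 2) by rewrite /L divfK ?gt_eqF// opprB addrC subrK.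
have lip t : 0 < t -> t < b -> `|F nu - F t| <= L * `|nu ^+ 2 - t ^+ 2|.
  move=> t0 tb'; have [tn|tn|->] := ltgtP t nu; last by rewrite !subrr normr0 mulr0.
  - have := muR_concave t0 tn nb b1; rewrite -/(F t) -/(F nu) -/(F b) LE => H.
    have s1 := sq _ _ t0 tn.
    rewrite distrC ger0_norm ?subr_ge0 ?Fdecr// (gtr0_norm s1).
    rewrite -(ler_pM2l tb); move: H; move: (F nu) (F t) => p q.
    by move: (t ^+ 2) (b ^+ 2) (nu ^+ 2) => *; lra.
  - have := muR_concave n0 tn tb' b1; rewrite -/(F t) -/(F nu) -/(F b) LE => H.
    have s1 := sq _ _ n0 tn.
    rewrite ger0_norm ?subr_ge0 ?Fdecr ?(lt_trans tb')// (distrC (nu ^+ 2)) (gtr0_norm s1).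
    rewrite -(ler_pM2l tb); move: H; move: (F nu) (F t) => p q.
    by move: (t ^+ 2) (b ^+ 2) (nu ^+ 2) => *; lra.
have cF : F t @[t --> nu] --> F nu.
  apply/cvgrPdist_le => e e0.
  have c2 : L * `|nu ^+ 2 - t ^+ 2| @[t --> nu] --> (0 : R).
    rewrite -[X in _ --> X](mulr0 L); apply: cvgMr.
    rewrite -[X in _ --> X](normr0 R) -[X in `|X|](subrr (nu ^+ 2)).
    apply: cvg_norm; apply: cvgB; first exact: cvg_cst.
    exact: exprn_continuous.
  near=> t; apply: (@le_trans _ _ (L * `|nu ^+ 2 - t ^+ 2|)).
    by apply: lip; near: t; [exact: lt_nbhsr|exact: lt_nbhsl].
  near: t; exact: (cvgr_le _ c2).
have cQ : F t * t^-1 @[t --> nu] --> F nu * nu^-1.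
  by apply: cvgM => //; apply: cvgV; rewrite ?gt_eqF.
have FE t : 0 < t -> F t * t^-1 = muR t by move=> t0; rewrite /F mulrAC divff ?mul1r ?gt_eqF.
rewrite (FE _ n0) in cQ; apply: cvg_trans cQ; apply: near_eq_cvg; near=> t.
by rewrite FE//; near: t; exact: lt_nbhsr.
Unshelve. all: by end_near. Qed.


Lemma I_dil (c : R) f : 0 < c -> integrable3 f -> (forall x, 0 <= f x) ->
  I (fun x => f (c *: x)) = c^-1 ^+ 3 * I f.
Proof.
move=> c0 intf f0.
have mf : measurable_fun (setT : set (measurableTypeR R * measurableTypeR R * measurableTypeR R))
  (EFin \o f) by case/integrableP: intf.
have F0 x : (0 <= (EFin \o f) x)%E by rewrite lee_fin.
have E := ge0_integral_dilate3 c0 mf F0.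
transitivity (fine ((c^-1 ^+ 3)%:E * \int[leb]_x (EFin \o f) x)%E).
  by rewrite -E; congr (fine _); apply: eq_integral => x _.
by rewrite fineM//; exact: integrable_fin_num.
Qed.

Lemma rad_scale (c : R) x : 0 < c -> rad (c *: x) = c * rad x.
Proof.
move=> c0; rewrite /enorm3 /= /GRing.scale /= !exprMn -!mulrDr sqrtrM ?sqr_ge0//.
by rewrite sqrtr_sqr gtr0_norm.
Qed.

Lemma mass_dil (c : R) phi : 0 < c -> test_spinor phi ->
  mass (dil c phi) = c^-1 ^+ 3 * mass phi.
Proof.
move=> c0 tphi; rewrite /mass -I_dil//; last by move=> x; exact: sqn_ge0.
  by congr (Rintegral _ _); apply/funext => x; rewrite sqn_dil.
exact: int_mass.
Qed.

Lemma pot_dil (c : R) phi : 0 < c -> test_spinor phi ->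
  pot (dil c phi) = c^-1 ^+ 2 * pot phi.
Proof.
move=> c0 tphi; have ip := int_pot tphi; have c0' : c != 0 by rewrite gt_eqF.
have p0 x : 0 <= sqn phi x / rad x by rewrite divr_ge0 ?sqn_ge0 ?rad_ge0.
have := I_dil c0 ip p0; rewrite -/(pot phi) => E.
have -> : pot (dil c phi) = c * I (fun x => sqn phi (c *: x) / rad (c *: x)).
  rewrite /pot -[RHS]IZ; last first.
    have := int_pot (test_dil c0' tphi) => /(int3Z c^-1); congr (integrable3 _).
    by apply/funext => x /=; rewrite sqn_dil rad_scale// invfM; ring.
  congr (Rintegral _ _); apply/funext => x /=; rewrite sqn_dil rad_scale// invfM.
  by rewrite mulrCA (mulrA c) mulfV// mul1r.
by rewrite E mulrA; congr (_ * _); field.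
Qed.

Lemma kin_dil (c B : R) phi : 0 < c -> test_spinor phi ->
  kin (c ^+ 2 * B) (dil c phi) = c^-1 ^+ 2 * kin B phi.
Proof.
move=> c0 tphi; have ip := int_kin B tphi; have c0' : c != 0 by rewrite gt_eqF.
have p0 x : 0 <= (rad \* Psq B phi) x by rewrite mulr_ge0 ?Psq_ge0 ?rad_ge0.
have := I_dil c0 ip p0; rewrite -/(kin B phi) => E.
have PE x : (rad \* Psq (c ^+ 2 * B) (dil c phi)) x = c * (rad \* Psq B phi) (c *: x).
  by rewrite /= Psq_dil ?rad_scale//; [ring|exact: test_smooth].
have -> : kin (c ^+ 2 * B) (dil c phi) = c * I (fun x => (rad \* Psq B phi) (c *: x)).
  rewrite /kin -[RHS]IZ; last first.
    have := int_kin (c ^+ 2 * B) (test_dil c0' tphi) => /(int3Z c^-1); congr (integrable3 _).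
    by apply/funext => x; rewrite /= [_ * Psq _ _ x]PE mulKf.
  by congr (Rintegral _ _); apply/funext => x; exact: PE.
by rewrite E mulrA; congr (_ * _); field.
Qed.

(** The energy scales as c^-2 against c^-3 for the mass, whence a factor c, the square root of the
    field, in the quotient. *)
Lemma energy_dil (c nu : R) phi : 0 < c -> test_spinor phi ->
  energy (c ^+ 2) nu (dil c phi) = c^-1 ^+ 2 * energy 1 nu phi.
Proof.
move=> c0 tphi; have c0' : c != 0 by rewrite gt_eqF.
rewrite !energyE//; last exact: test_dil.
by rewrite -{1}[c ^+ 2]mulr1 kin_dil// pot_dil//; ring.
Qed.

Lemma dilK (c : R) phi : c != 0 -> dil c (dil c^-1 phi) = phi.
Proof.
move=> c0; apply/funext => x; apply/matrixP => a b; rewrite (ord1 b).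
rewrite [LHS]spinor_entryE [RHS]spinor_entryE.
by have [->|->] := ord2P a; congr Complex;
  rewrite -?/(up_re _ _) -?/(up_im _ _) -?/(dn_re _ _) -?/(dn_im _ _) /dil !mkE scalerA mulVf// scale1r.
Qed.

Lemma energy_ge nu (c : R) phi : 0 < nu < 1 -> 0 < c -> test_spinor phi ->
  c * muR nu * mass phi <= energy (c ^+ 2) nu phi.
Proof.
move=> nu01 c0 tphi; have c0' : c != 0 by rewrite gt_eqF.
have ci : c^-1 != 0 by rewrite invr_eq0.
have tpsi := test_dil ci tphi.
rewrite -(dilK phi c0') energy_dil// mass_dil//.
have := muR_le nu01 tpsi; move: (mass _) (energy _ _ _) => m e H.
have -> : c * muR nu * (c^-1 ^+ 3 * m) = c^-1 ^+ 2 * (muR nu * m) by field.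
by rewrite ler_wpM2l// sqr_ge0.
Qed.

Lemma energy_lt nu (c m : R) : 0 < nu < 1 -> 0 < c -> c * muR nu < m ->
  exists phi, [/\ test_spinor phi, 0 < mass phi & energy (c ^+ 2) nu phi < m * mass phi].
Proof.
move=> nu01 c0 cm; have c0' : c != 0 by rewrite gt_eqF.
have [|phi [tphi m0 e]] := @muR_lt nu (m / c) nu01; first by rewrite ltr_pdivlMr// mulrC.
exists (dil c phi); split; first exact: test_dil.
  by rewrite mass_dil// mulr_gt0// exprn_gt0// invr_gt0.
rewrite energy_dil// mass_dil//.
have -> : m * (c^-1 ^+ 3 * mass phi) = c^-1 ^+ 2 * (m / c * mass phi) by field.
by rewrite ltr_pM2l// exprn_gt0// invr_gt0.
Qed.

End Mu.

(** * The functional J as a function of 1 + lambda *)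

Section JFunctional.
Variable R : realType.
Notation V := (R * R * R)%type.
Notation Spin := (space3 R -> spinor R).
Implicit Types (x : V) (f g : V -> R).
Notation leb := (@leb3 R).
Notation I f := (Rintegral leb setT f).
Notation rad := (@enorm3 R).
Variables (nu : R) (nu0 : 0 < nu) (B : R).

(** The inverse of e + nu / |x| with e = 1 + lambda, in a form that is continuous across the origin,
    also for e = 0. *)
Definition wt (e : R) x : R := rad x / (e * rad x + nu).
Definition Kf (e : R) (phi : Spin) : R := I (wt e \* Psq B phi).
Definition Jf (e : R) (phi : Spin) : R := Kf e phi + (2 - e) * mass phi - nu * pot phi.

Lemma den_gt0 (e : R) x : 0 <= e -> 0 < e * rad x + nu.
Proof. by move=> e0; rewrite ltr_wpDl// mulr_ge0 ?rad_ge0. Qed.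

Lemma wt_ge0 (e : R) x : 0 <= e -> 0 <= wt e x.
Proof. by move=> e0; rewrite divr_ge0 ?rad_ge0// ltW// den_gt0. Qed.

Lemma continuous_wt (e : R) : 0 <= e -> continuous (wt e).
Proof.
move=> e0 x; apply: cvgM; first exact: continuous_rad.
apply: cvgV; first by rewrite gt_eqF// den_gt0.
by apply: cvgD; [apply: cvgMr; exact: continuous_rad|exact: cvg_cst].
Qed.

Section OneSpinor.
Variables (phi : Spin) (tphi : test_spinor phi).

Lemma int_wt (e : R) : 0 <= e -> integrable3 (wt e \* Psq B phi).
Proof. by move=> e0; exact: int3_cont (continuous_wt e0) (tf_Psq B tphi). Qed.

Lemma J_Jf (lam : R) : -1 < lam -> J phi lam nu B = Jf (1 + lam) phi.
Proof.
move=> l1; have e0 : 0 < 1 + lam by lra.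
pose g : V -> R := (wt (1 + lam) \* Psq B phi \+ cst (1 - lam) \* sqn phi) \-
  cst nu \* (fun x => sqn phi x / rad x).
have iw := int_wt (ltW e0); have im := int_mass tphi; have ip := int_pot tphi.
have ig1 : integrable3 (wt (1 + lam) \* Psq B phi \+ cst (1 - lam) \* sqn phi).
  by apply: int3D => //; exact: int3Z.
have ig2 : integrable3 (cst nu \* (fun x => sqn phi x / rad x)) by exact: int3Z.
have ig : integrable3 g by exact: int3B.
have -> : Jf (1 + lam) phi = I g.
  rewrite IB// ID//; last exact: int3Z.
  by rewrite !IZ// /Jf /Kf; congr (_ + _ * _ - _); ring.
have mg : measurable3 g by case/integrableP: ig => /measurable_EFinP.
(* At the origin nu / |x| evaluates to 0, so the kinetic term of [J] is |P_B phi|^2 / (1 + lambda)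
   there while [wt] vanishes; [h] adds this value on a null set. *)
pose h : V -> R := g \+ cst (Psq B phi 0 / (1 + lam)) \* \1_[set (0 : V)].
have mh : measurable3 h.
  apply: measurable_funD => //; apply: measurable_funM => //.
  by apply: measurable_indic; exact: measurable_origin.
transitivity (I h).
  congr (Rintegral _ _); apply/funext => x; rewrite PsqE sqnE /h /g /wt /= indicE.
  have [->|x0] := eqVneq x 0.
    by rewrite mem_set// rad0 invr0 !mulr0 mul0r addr0 /=; ring.
  rewrite memNset /=; last by apply/eqP.
  have r0 := rad_gt0 x0; have d0 := den_gt0 x (ltW e0).
  have -> : Psq B phi x / (1 + lam + nu / rad x) = rad x / ((1 + lam) * rad x + nu) * Psq B phi x.
    have d1 : 1 + lam + nu / rad x != 0.
      by rewrite gt_eqF// addr_gt0// divr_gt0.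
    move: (rad x) (Psq B phi x) r0 d0 d1 => r p r0 d0 d1.
    have -> : 1 + lam + nu / r = ((1 + lam) * r + nu) / r by field; rewrite gt_eqF.
    by field; rewrite !gt_eqF.
  by rewrite mulr0 addr0; ring.
congr (fine _); apply: eq_integral_off0 => // x x0.
rewrite /h /= indicE memNset ?mulr0 ?addr0//; exact/eqP.
Qed.

Lemma Kf_le (e e' : R) : 0 <= e -> e <= e' -> Kf e' phi <= Kf e phi.
Proof.
move=> e0 ee; have e0' := le_trans e0 ee.
apply: I_le; [exact: int_wt|exact: int_wt|] => x /=.
rewrite ler_wpM2r ?Psq_ge0// ler_wpM2l ?rad_ge0// lef_pV2 ?posrE ?den_gt0//.
by rewrite lerD2r ler_wpM2r ?rad_ge0.
Qed.

Definition Kslope : R := I (fun x => n2 x / nu ^+ 2 * Psq B phi x).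

Lemma Kslope_ge0 : 0 <= Kslope.
Proof. by apply: I_ge0 => x; rewrite mulr_ge0 ?Psq_ge0// divr_ge0 ?n2_ge0 ?sqr_ge0. Qed.

(** The weights differ by (e' - e) |x|^2 / ((e |x| + nu) (e' |x| + nu)), and both denominators are
    at least nu. *)
Lemma Kf_lip (e e' : R) : 0 <= e -> e <= e' -> Kf e phi <= Kf e' phi + (e' - e) * Kslope.
Proof.
move=> e0 ee; have e0' := le_trans e0 ee.
have iq : integrable3 ((fun x => n2 x / nu ^+ 2) \* Psq B phi).
  apply: int3_cont (tf_Psq B tphi) => x; apply: cvgMl; exact: smooth_cont (smooth_n2 R) x.
have iw e1 := @int_wt e1.
rewrite -IZ// -ID; [|exact: iw|exact: int3Z].
apply: I_le; [exact: int_wt|by apply: int3D; [exact: int_wt|exact: int3Z]|] => x /=.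
rewrite mulrA -mulrDl ler_wpM2r ?Psq_ge0// -lerBlDl -rad2 /wt.
have d0 := den_gt0 x e0; have d1 := den_gt0 x e0'; have r0 := rad_ge0 x.
have -> : rad x / (e * rad x + nu) - rad x / (e' * rad x + nu) =
  (e' - e) * (rad x ^+ 2 / ((e * rad x + nu) * (e' * rad x + nu))).
  by move: (rad x) d0 d1 => r d0 d1; field; rewrite !gt_eqF.
rewrite ler_wpM2l ?subr_ge0// ler_wpM2l ?sqr_ge0// lef_pV2 ?posrE ?mulr_gt0 ?exprn_gt0//.
by rewrite expr2 ler_pM ?(ltW nu0)// lerDr mulr_ge0.
Qed.

Lemma Kf0 : Kf 0 phi = kin B phi / nu.
Proof.
rewrite mulrC -IZ; last exact: int_kin.
by congr (Rintegral _ _); apply/funext => x; rewrite /= /wt mul0r add0r; ring.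
Qed.

Lemma Jf0 : Jf 0 phi = energy B nu phi + 2 * mass phi.
Proof. by rewrite energyE// /Jf Kf0 subr0; ring. Qed.

Lemma Jf_decr (e e' : R) : 0 <= e -> e <= e' -> Jf e' phi <= Jf e phi - (e' - e) * mass phi.
Proof. by move=> e0 ee; have := Kf_le e0 ee; rewrite /Jf; lra. Qed.

Lemma Jf_lip (e e' : R) : 0 <= e -> 0 <= e' ->
  `|Jf e phi - Jf e' phi| <= (Kslope + mass phi) * `|e - e'|.
Proof.
move=> e0 e0'; wlog ee : e e' e0 e0' / e <= e'.
  by move=> H; have [/H|/ltW/H] := leP e e'; [apply|rewrite distrC (distrC e); apply].
have H1 := Kf_le e0 ee; have H2 := Kf_lip e0 ee.
have m0 := mass_ge0 phi.
have mm : 0 <= (e' - e) * mass phi by rewrite mulr_ge0// subr_ge0.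
rewrite ger0_norm; last by rewrite /Jf; lra.
by rewrite distrC (ger0_norm (_ : 0 <= e' - e)) ?subr_ge0// /Jf; lra.
Qed.

(** The absolute value extends the function from e >= 0 to the whole line, so that continuity at the
    endpoint 0 needs no separate treatment. *)
Lemma continuous_Jf : continuous (fun e : R => Jf `|e| phi).
Proof.
move=> e; apply/cvgrPdist_le => d d0.
have c2 : (Kslope + mass phi) * `|e - t| @[t --> e] --> (0 : R).
  rewrite -[X in _ --> X](mulr0 (Kslope + mass phi)); apply: cvgMr.
  rewrite -[X in _ --> X](normr0 R) -[X in `|X|](subrr e).
  by apply: cvg_norm; apply: cvgB; [exact: cvg_cst|exact: cvg_id].
near=> t; apply: (@le_trans _ _ ((Kslope + mass phi) * `|e - t|)).
  apply: le_trans (Jf_lip _ _) _; rewrite ?normr_ge0//.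
  by rewrite ler_wpM2l ?addr_ge0 ?Kslope_ge0 ?mass_ge0// ler_dist_dist.
by near: t; exact: (cvgr_le _ c2).
Unshelve. all: by end_near. Qed.

Hypothesis m1 : mass phi = 1.

Lemma Jf_neg : exists2 e : R, 0 < e & Jf e phi < 0.
Proof.
exists (`|Jf 0 phi| + 1); first by rewrite ltr_wpDl.
have := @Jf_decr 0 (`|Jf 0 phi| + 1) (lexx 0).
rewrite m1 mulr1 subr0 => /(_ (addr_ge0 (normr_ge0 _) ler01)).
by have := ler_norm (Jf 0 phi); lra.
Qed.

Lemma Jf_root : 0 < Jf 0 phi -> exists2 e : R, 0 < e & Jf e phi = 0.
Proof.
move=> J0; have [M M0 JM] := Jf_neg.
have c : {within `[0, M], continuous (fun e : R => Jf `|e| phi)}.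
  exact: continuous_subspaceT continuous_Jf.
have [|e] := IVT (ltW M0) c (v := 0).
  by rewrite normr0 (gtr0_norm M0) ge_min le_max (ltW JM) (ltW J0) orbT.
rewrite in_itv /= => /andP[e0 _]; rewrite ger0_norm// => Je; exists e => //.
by rewrite lt_neqAle e0 andbT; apply/eqP => e00; move: J0; rewrite [X in Jf X phi]e00 Je ltxx.
Qed.

Lemma Jf_pos_small : 0 < Jf 0 phi -> exists2 e : R, 0 < e & 0 < Jf e phi.
Proof.
move=> J0; have [e e0 Je] := Jf_root J0; exists (e / 2); first by rewrite divr_gt0.
have := @Jf_decr (e / 2) e; rewrite Je m1; lra.
Qed.

End OneSpinor.

(** By monotonicity a positive value of J forces one at lambda = -1. Conversely [Jf] has a root, is
    positive before it, and becomes negative because the mass term gives it slope at most -1. *)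
Lemma admissibleP phi : admissible nu B phi <->
  [/\ test_spinor phi, mass phi = 1 & 0 < Jf 0 phi].
Proof.
split=> [[tphi l2 [l l1 Jl] _]|[tphi m1 J0]].
- split=> //; first by rewrite -L2norm2 l2 expr1n.
  move: Jl; rewrite J_Jf// => Jl; apply: (lt_le_trans Jl).
  have l0 : 0 <= 1 + l by lra.
  have := Jf_decr tphi (lexx 0) l0; have : 0 <= (1 + l - 0) * mass phi.
    by rewrite subr0 mulr_ge0 ?mass_ge0.
  lra.
- split=> //; first by rewrite L2normE m1 sqrtr1.
  + have [e e0 Je] := Jf_pos_small tphi m1 J0; exists (-1 + e); first lra.
    by rewrite J_Jf//; [rewrite addrA subrr add0r|lra].
  + have [e e0 Je] := Jf_neg tphi m1; exists (-1 + e); first lra.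
    by rewrite J_Jf//; [rewrite addrA subrr add0r|lra].
Qed.

Lemma lambdaP phi : admissible nu B phi ->
  -1 < lambda nu B phi /\ Jf (1 + lambda nu B phi) phi = 0.
Proof.
move=> adm; have [tphi m1 J0] := (admissibleP phi).1 adm.
have -> : lambda nu B phi = xget (-1) [set l | -1 < l /\ J phi l nu B = 0].
  by rewrite /lambda ifT//; exact/asboolP.
case: xgetP => [l _ [l1]|]; first by rewrite J_Jf.
have [e e0 Je] := Jf_root tphi m1 J0.
move=> /(_ (-1 + e))[]; split; first lra.
by rewrite J_Jf//; [rewrite addrA subrr add0r|lra].
Qed.

Lemma lambda_ge phi (e : R) : admissible nu B phi -> 0 <= e -> 0 <= Jf e phi ->
  -1 + e <= lambda nu B phi.
Proof.
move=> adm e0 Je; have [tphi m1 J0] := (admissibleP phi).1 adm.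
have [l1 Jl] := lambdaP adm; rewrite leNgt; apply/negP => le.
have l0 : 0 <= 1 + lambda nu B phi by lra.
have := @Jf_decr _ tphi (1 + lambda nu B phi) e l0; rewrite Jl m1; lra.
Qed.

Lemma lambda_le phi (e : R) : admissible nu B phi -> 0 <= e -> Jf e phi <= 0 ->
  lambda nu B phi <= -1 + e.
Proof.
move=> adm e0 Je; have [tphi m1 J0] := (admissibleP phi).1 adm.
have [l1 Jl] := lambdaP adm; rewrite leNgt; apply/negP => le.
have := @Jf_decr _ tphi e (1 + lambda nu B phi) e0; rewrite Jl m1; lra.
Qed.

End JFunctional.

(** * Subcritical and supercritical fields *)

Section Subcritical.
Variable R : realType.
Notation V := (R * R * R)%type.
Notation Spin := (space3 R -> spinor R).
Implicit Types (x : V) (phi : Spin) (nu b : R).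
Notation leb := (@leb3 R).
Notation I f := (Rintegral leb setT f).
Notation rad := (@enorm3 R).

Lemma lambda1_ge nu B (e : R) : (forall phi, admissible nu B phi -> e <= lambda nu B phi) ->
  (e%:E <= lambda1 nu B)%E.
Proof. by move=> H; apply: le_ereal_inf_tmp => _ [phi adm <-]; rewrite lee_fin H. Qed.

(** The scaled bound for mu is applied at the coupling nu (1 + d) to phi multiplied by the cutoff
    chi of rate s^2, then divided by 1 + d: this restores the coupling nu and pays for the Young
    factor of [kin_cut], so that [Kf] comes back with coefficient 1. The condition e <= 2 s nu d
    gives chi^2 (e |x| + nu) <= nu (1 + d), because s |x| chi <= 1 / 2. *)
Lemma Jf_lower nu (d s e b c : R) phi : 0 < nu -> 0 < d -> nu * (1 + d) < 1 -> 0 < s ->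
  0 <= e -> e <= 2 * s * nu * d -> 0 < b -> b <= c -> test_spinor phi -> mass phi = 1 ->
  c * muR (nu * (1 + d)) + 2 - e
    - (2 * nu + (1 + d^-1) * 4 / ((1 + d) * (nu * (1 + d)))) * s <= Jf nu (b ^+ 2) e phi.
Proof.
move=> nu0 d0 nu1 s0 e0 es b0 bc tphi m1; set nu' := nu * (1 + d).
have d1 : 0 < 1 + d by rewrite addr_gt0.
have n0 : 0 < nu' by rewrite mulr_gt0.
have nu01 : 0 < nu' < 1 by rewrite n0.
pose k := s ^+ 2; have k0 : 0 < k by rewrite exprn_gt0.
have sk : Num.sqrt k = s by rewrite sqrtr_sqr gtr0_norm.
have tpsi := test_cut k0 tphi.
have H1 := pot_cut k0 tphi; have H2 := kin_cut k0 tphi (b ^+ 2) d0.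
have H3 := energy_ge nu01 b0 tpsi; have H4 := mass_cut k0 tphi.
rewrite energyE// in H3; rewrite sk m1 !mulr1 in H1 H2; rewrite m1 in H4.
have H5 : I (rad \* (fun x => cutoff k x ^+ 2 * Psq (b ^+ 2) phi x)) <= nu' * Kf nu (b ^+ 2) e phi.
  have iw := int_wt nu0 (b ^+ 2) tphi e0.
  rewrite -IZ//; apply: I_le; [exact: int_cut|exact: int3Z|] => x /=.
  have -> : nu' * (wt nu e x * Psq (b ^+ 2) phi x) =
    rad x * (nu' / (e * rad x + nu)) * Psq (b ^+ 2) phi x.
    by rewrite /wt; move: (Psq _ _ _) (rad x) => p r; ring.
  rewrite mulrA ler_wpM2r ?Psq_ge0//.
  have := rad_cut k0 x; rewrite sk.
  have := cut_gt0 k0 x; have := cut_le1 k0 x; have := rad_ge0 x; have := den_gt0 nu0 x e0.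
  move: (rad x) (cutoff k x) => r t D0 r0 t1 t0 srt.
  rewrite ler_wpM2l// ler_pdivlMr//.
  have t2 : t ^+ 2 <= 1 by rewrite exprn_ile1// ltW.
  have h1 : t ^+ 2 * nu <= nu by rewrite ler_piMl// ltW.
  have h2 : t ^+ 2 * (e * r) <= nu * d.
    apply: (@le_trans _ _ (t * (e * r))).
      by rewrite expr2 -mulrA ler_piMl// !mulr_ge0// ltW.
    apply: (@le_trans _ _ (2 * s * nu * d * (t * r))).
      by rewrite mulrCA ler_wpM2r// mulr_ge0// ltW.
    have -> : 2 * s * nu * d * (t * r) = (nu * d) * (2 * (s * r * t)) by ring.
    have q1 : 2 * (s * r * t) <= 1 by lra.
    have q0 : 0 <= nu * d by rewrite mulr_ge0 ?ltW.
    by rewrite ler_piMr.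
  by rewrite /nu' mulrDr mulrDr mulr1; lra.
have m'0 := muR_lt0 nu01.
(* As mu is negative, the worst case is the largest field with the full mass 1. *)
have H6 : c * muR nu' <= b * muR nu' * mass (smul (cutoff k) phi).
  apply: (@le_trans _ _ (b * muR nu')); first by rewrite ler_wnM2r// ltW.
  by rewrite ler_niMr// pmulr_rle0// ltW.
have c0 : c * muR nu' <= 0 by rewrite pmulr_rle0 ?(lt_le_trans b0)// ltW.
rewrite /Jf m1 mulr1.
move: H1 H2 H3 H5 H6; move: (pot phi) (pot (smul _ _)) (kin _ (smul _ _)) (I _) (Kf _ _ _ _) (b * _ * _).
move: (c * muR nu') c0 => M M0 p q k1 X K w H1 H2 H3 H5 H6.
have i0 : 0 < (1 + d)^-1 by rewrite invr_gt0.
have i1 : (1 + d)^-1 <= 1 by rewrite invf_le1// lerDl ltW.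
have E1 : M + nu' * q <= k1 / nu' by lra.
have E2 : M + nu * q <= (1 + d)^-1 * (k1 / nu').
  apply: (@le_trans _ _ ((1 + d)^-1 * (M + nu' * q))); last by rewrite ler_pM2l.
  rewrite mulrDr; apply: lerD; first by rewrite ler_niMl.
  by rewrite /nu' le_eqVlt; apply/orP; left; apply/eqP; field; rewrite gt_eqF.
have E3 : k1 <= (1 + d) * (nu' * K) + (1 + d^-1) * (4 * s).
  by apply: (le_trans H2); rewrite lerD2r ler_pM2l.
have E4 : (1 + d)^-1 * (k1 / nu') <= K + (1 + d^-1) * 4 / ((1 + d) * nu') * s.
  rewrite mulrA ler_pdivrMr// ler_pdivrMl//; apply: (le_trans E3).
  by rewrite le_eqVlt; apply/orP; left; apply/eqP; field; rewrite !gt_eqF.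
have E5 : nu * p <= nu * (q + 2 * s) by rewrite ler_pM2l.
by move: E2 E4 E5; move: ((1 + d)^-1 * _) ((1 + d^-1) * 4 / _) => *; lra.
Qed.

Lemma lambda1_subcritical nu (c : R) : 0 < nu < 1 -> 0 < c -> - 2 < c * muR nu ->
  exists2 e : R, 0 < e & forall b, 0 < b -> b <= c -> ((-1 + e)%:E <= lambda1 nu (b ^+ 2))%E.
Proof.
move=> nu01 c0 cm; have /andP[n0 n1] := nu01.
(* The distance from c mu(nu) to -2 is 2 g. Raising the coupling uses less than g of it, the cutoff
   error g / 4 and e at most g / 4, so [Jf] at e stays positive uniformly in phi and b. *)
pose g := (2 + c * muR nu) / 2.
have g0 : 0 < g by rewrite divr_gt0//; lra.
have [d [d0 nd md]] : exists d : R, [/\ 0 < d, nu * (1 + d) < 1 & - 2 + g < c * muR (nu * (1 + d))].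
  have H : \forall t \near nu, t < 1 /\ - 2 + g < c * muR t.
    near=> t; split; near: t; first exact: lt_nbhsl.
    have cc : c * muR t @[t --> nu] --> c * muR nu by apply: cvgMr; exact: continuous_muR.
    by apply: (cvgr_gt _ cc); rewrite /g; lra.
  move/nbhs_ballP: H => [r /= r0 H].
  exists (r / (2 * nu)); have dp : 0 < r / (2 * nu) by rewrite divr_gt0// mulr_gt0.
  have E : nu * (1 + r / (2 * nu)) = nu + r / 2 by field; rewrite gt_eqF.
  have [] := H (nu * (1 + r / (2 * nu))).
    by rewrite /ball /= E opprD addrA subrr sub0r normrN gtr0_norm ?divr_gt0//; lra.
  by [].
pose T := 2 * nu + (1 + d^-1) * 4 / ((1 + d) * (nu * (1 + d))).
have T0 : 0 < T.
  have d1 : 0 < 1 + d by rewrite addr_gt0.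
  by rewrite addr_gt0 ?mulr_gt0 ?divr_gt0 ?mulr_gt0 ?addr_gt0 ?invr_gt0 ?mulr_gt0.
pose s := g / (4 * T); have s0 : 0 < s by rewrite divr_gt0 // mulr_gt0.
pose e := Num.min (2 * s * nu * d) (g / 4).
have e0 : 0 < e by rewrite lt_min; apply/andP; split; [|exact: divr_gt0]; exact: mulr_gt0 (mulr_gt0 (mulr_gt0 (ltr0n R 2) s0) n0) d0.
exists e => // b b0 bc; apply: lambda1_ge => phi adm.
have [tphi m1 J0] := (admissibleP n0 _ _).1 adm.
apply: lambda_ge => //; first exact: ltW.
have e1 : e <= 2 * s * nu * d by rewrite ge_min lexx.
have e2 : e <= g / 4 by rewrite ge_min lexx orbT.
apply: le_trans (Jf_lower n0 d0 nd s0 (ltW e0) e1 b0 bc tphi m1).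
have -> : (2 * nu + (1 + d^-1) * 4 / ((1 + d) * (nu * (1 + d)))) * s = g / 4.
  by rewrite -/T /s; field; rewrite gt_eqF.
by move: (c * muR _) md => m md; lra.
Unshelve. all: by end_near. Qed.

End Subcritical.

(** * Supercritical fields *)

Section Supercritical.
Variable R : realType.
Notation V := (R * R * R)%type.
Notation Spin := (space3 R -> spinor R).
Implicit Types (x : V) (phi psi : Spin).
Notation leb := (@leb3 R).
Notation I f := (Rintegral leb setT f).
Notation rad := (@enorm3 R).

Section Forms.
Variables (nu : R) (nu0 : 0 < nu) (B e : R) (e0 : 0 <= e).

Lemma I_quad (f f0 f1 f2 : V -> R) (t : R) :
  integrable3 f0 -> integrable3 f1 -> integrable3 f2 ->
  (forall x, f x = f0 x + t * (f1 x - f0 x - f2 x) + t ^+ 2 * f2 x) ->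
  I f = I f0 + t * (I f1 - I f0 - I f2) + t ^+ 2 * I f2.
Proof.
move=> h0 h1 h2 E.
have -> : f = (f0 \+ cst t \* ((f1 \- f0) \- f2)) \+ cst (t ^+ 2) \* f2.
  by apply/funext => x; rewrite E.
have h3 : integrable3 ((f1 \- f0) \- f2) by apply: int3B => //; exact: int3B.
rewrite ID; [|by apply: int3D => //; exact: int3Z|exact: int3Z].
rewrite ID//; last exact: int3Z.
by rewrite !IZ// IB//; [rewrite IB|exact: int3B].
Qed.

Variables (phi psi : Spin) (tphi : test_spinor phi) (tpsi : test_spinor psi).

Lemma mass_lin (t : R) : mass (lin t phi psi) =
  mass phi + t * (mass (lin 1 phi psi) - mass phi - mass psi) + t ^+ 2 * mass psi.
Proof.
apply: I_quad => [| | |x]; try exact: int_mass.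
  by apply: int_mass; exact: test_lin.
exact: sqn_lin.
Qed.

Lemma pot_lin (t : R) : pot (lin t phi psi) =
  pot phi + t * (pot (lin 1 phi psi) - pot phi - pot psi) + t ^+ 2 * pot psi.
Proof.
apply: I_quad => [| | |x]; try exact: int_pot.
  by apply: int_pot; exact: test_lin.
by rewrite sqn_lin; ring.
Qed.

Lemma Kf_lin (t : R) : Kf nu B e (lin t phi psi) =
  Kf nu B e phi + t * (Kf nu B e (lin 1 phi psi) - Kf nu B e phi - Kf nu B e psi)
  + t ^+ 2 * Kf nu B e psi.
Proof.
apply: I_quad => [| | |x]; try exact: int_wt.
  by apply: int_wt => //; exact: test_lin.
rewrite /= (Psq_lin B t x (test_smooth tphi) (test_smooth tpsi)).
by move: (wt _ _ _) (Psq _ _ _) (Psq _ _ _) (Psq _ _ _) => *; ring.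
Qed.

Lemma Jf_lin (t : R) : Jf nu B e (lin t phi psi) =
  Jf nu B e phi + t * (Jf nu B e (lin 1 phi psi) - Jf nu B e phi - Jf nu B e psi)
  + t ^+ 2 * Jf nu B e psi.
Proof.
rewrite /Jf (Kf_lin t) (pot_lin t) (mass_lin t).
move: (Kf _ _ _ _) (Kf _ _ _ _) (Kf _ _ _ _) (pot _) (pot _) (pot _) (mass _) (mass _) (mass _).
by move=> *; ring.
Qed.

Lemma Psq_cst (k : R) x : Psq B (smul (cst k) phi) x = k ^+ 2 * Psq B phi x.
Proof.
rewrite (rows_smul B x (smooth_cst k) (test_smooth tphi)) /= !partial_cst /= /Psq.
move: (prow1 _ _ _ _ _ _) (prow2 _ _ _ _ _ _) (prow3 _ _ _ _ _ _) (prow4 _ _ _ _ _ _).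
by move=> *; ring.
Qed.

Lemma mass_cst (k : R) : mass (smul (cst k) phi) = k ^+ 2 * mass phi.
Proof.
rewrite /mass -IZ; last exact: int_mass.
by congr (Rintegral _ _); apply/funext => x; rewrite sqn_smul.
Qed.

Lemma Jf_cst (k : R) : Jf nu B e (smul (cst k) phi) = k ^+ 2 * Jf nu B e phi.
Proof.
have -> : k ^+ 2 * Jf nu B e phi = k ^+ 2 * Kf nu B e phi
  + (2 - e) * (k ^+ 2 * mass phi) - nu * (k ^+ 2 * pot phi) by rewrite /Jf; ring.
rewrite /Jf mass_cst; congr (_ + _ - _ * _).
- rewrite /Kf -IZ; last exact: int_wt.
  by congr (Rintegral _ _); apply/funext => x; rewrite /= Psq_cst mulrCA.
- rewrite /pot -IZ; last exact: int_pot.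
  by congr (Rintegral _ _); apply/funext => x; rewrite /= sqn_smul mulrA.
Qed.

Lemma sqn0_Jf : mass phi = 0 -> 0 <= Jf nu B e phi.
Proof.
move=> m0; have z x : sqn phi x = 0.
  apply/eqP; rewrite sqn_eq0; apply/negPn/negP => px.
  by have := mass_gt0 tphi (ex_intro _ x px); rewrite m0 ltxx.
rewrite /Jf m0 mulr0 addr0 (_ : pot phi = 0) ?mulr0 ?subr0.
  by apply: I_ge0 => x /=; rewrite mulr_ge0 ?Psq_ge0 ?wt_ge0.
rewrite /pot (_ : (fun x => _) = cst 0) ?Rintegral_cst ?mul0r//.
by apply/funext => x; rewrite z mul0r.
Qed.

Lemma lin_mass0 (t : R) : mass (lin t phi psi) = 0 -> phi = smul (cst (- t)) psi.
Proof.
move=> m0; apply/funext => x.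
have : sqn (lin t phi psi) x == 0.
  rewrite sqn_eq0; apply/negPn/negP => px.
  by have := mass_gt0 (test_lin t tphi tpsi) (ex_intro _ x px); rewrite m0 ltxx.
rewrite sqn_eq0 spinor_eq0 /lin !mkE /= => /and4P[/eqP h1 /eqP h2 /eqP h3 /eqP h4].
apply/matrixP => a b; rewrite (ord1 b) [LHS]spinor_entryE [RHS]spinor_entryE.
by have [->|->] := ord2P a; congr Complex;
  rewrite -?/(up_re _ _) -?/(up_im _ _) -?/(dn_re _ _) -?/(dn_im _ _) /smul !mkE /=; lra.
Qed.

End Forms.

(** The first factor vanishes on the unit ball, so that |phi|^2 / |x| <= |phi|^2: a test spinor on
    which [Jf] at 0 is positive for every field and every nu in ]0, 1[. *)
Definition outer : Spin := smul (flat 0 \o (@n2 R \- cst 1)) (trial 3).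

Lemma test_outer : test_spinor outer.
Proof.
apply: test_smul; last exact: (test_trial (lexx 3)).
exact: smooth_flat (smoothB (smooth_n2 R) (smooth_cst 1)).
Qed.

Lemma pot_outer : pot outer <= mass outer.
Proof.
apply: I_le; [exact: int_pot test_outer|exact: int_mass test_outer|] => x.
rewrite /outer sqn_smul /=; have [le1|gt1] := leP (n2 x) 1.
  by rewrite /flat ifF ?expr0n ?mul0r//; apply/negbTE; rewrite -leNgt subr_le0.
have s0 : 0 <= flat 0 (n2 x - 1) ^+ 2 * sqn (trial 3) x by rewrite mulr_ge0 ?sqr_ge0 ?sqn_ge0.
rewrite ler_piMr// invf_le1; last by rewrite sqrtr_gt0 (lt_trans _ gt1).
rewrite -(@ler_pXn2r _ 2) ?nnegrE ?rad_ge0// rad2 expr1n; exact: ltW.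
Qed.

Lemma mass_outer : 0 < mass outer.
Proof.
(* A point whose norm lies strictly between the radii 1 and 3 of the two cutoffs. *)
apply: mass_gt0; [exact: test_outer|exists (0, 0, 2)].
rewrite -sqn_eq0 /outer sqn_smul /trial sqn_smul sqn_zmspinor gt_eqF//.
have f0 t : 0 < t -> 0 < flat 0 t :> R by move=> t0; rewrite /flat t0 mul1r expR_gt0.
rewrite mulr_gt0 ?mulr_gt0 ?exprn_gt0 ?expR_gt0 ?f0//= /ball_arg /n2 /=; lra.
Qed.

(** At the larger root r of the first quadratic the second is negative; a short move to the right
    makes the first positive and keeps the second negative. The step [u] is explicit: [p] is the
    margin at r, and [M] bounds the growth of the second quadratic for u <= 1. *)
Lemma quad_crossing (a b c a' b' c' : R) : a < 0 -> 0 < c ->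
  (forall t, a + t * b + t ^+ 2 * c = 0 -> a' + t * b' + t ^+ 2 * c' < 0) ->
  exists t, 0 < a + t * b + t ^+ 2 * c /\ a' + t * b' + t ^+ 2 * c' < 0.
Proof.
move=> a0 c0 H; pose D := Num.sqrt (b ^+ 2 - 4 * a * c).
have ac : 0 <= b ^+ 2 - 4 * a * c.
  have : 0 <= (- a) * c by rewrite mulr_ge0 ?oppr_ge0// ltW.
  by have := sqr_ge0 b; lra.
have D0 : 0 <= D by exact: sqrtr_ge0.
have D2 : D ^+ 2 = b ^+ 2 - 4 * a * c by rewrite sqr_sqrtr.
pose r := (D - b) / (2 * c).
have rE : r * (2 * c) = D - b by rewrite /r divfK// gt_eqF// mulr_gt0.
have root u : a + (r + u) * b + (r + u) ^+ 2 * c = c * u ^+ 2 + D * u.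
  have E : a + r * b + r ^+ 2 * c = 0.
    have c4 : 4 * c != 0 by rewrite gt_eqF// mulr_gt0.
    apply: (mulfI c4); rewrite mulr0.
    have -> : 4 * c * (a + r * b + r ^+ 2 * c) = 4 * a * c + 2 * b * (r * (2 * c)) + (r * (2 * c)) ^+ 2.
      by ring.
    rewrite rE; have -> : 4 * a * c = b ^+ 2 - D ^+ 2 by rewrite D2; ring.
    by ring.
  have -> : a + (r + u) * b + (r + u) ^+ 2 * c =
    (a + r * b + r ^+ 2 * c) + u * b + (r * (2 * c)) * u + u ^+ 2 * c by ring.
  by rewrite E rE; ring.
have p0 : a' + r * b' + r ^+ 2 * c' < 0.
  by apply: H; have := root 0; rewrite addr0 => ->; rewrite expr0n /= !mulr0 addr0.
pose p := - (a' + r * b' + r ^+ 2 * c'); have {}p0 : 0 < p by rewrite oppr_gt0.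
pose M := `|b' + 2 * r * c'| + `|c'| + 1.
have M0 : 0 < M by rewrite /M ltr_wpDl// addr_ge0.
pose u := Num.min 1 (p / (2 * M)).
have u0 : 0 < u by rewrite lt_min ltr01 divr_gt0// mulr_gt0.
have u1 : u <= 1 by rewrite ge_min lexx.
have uM : u * M <= p / 2.
  rewrite -ler_pdivlMr// (_ : p / 2 / M = p / (2 * M)); last by rewrite invfM mulrA.
  by rewrite ge_min lexx orbT.
exists (r + u); split.
  by rewrite root ltr_wpDr ?mulr_ge0 ?(ltW u0)// mulr_gt0// exprn_gt0.
have -> : a' + (r + u) * b' + (r + u) ^+ 2 * c' = - p + u * (b' + 2 * r * c') + u ^+ 2 * c'.
  by rewrite /p; ring.
have h1 : u * (b' + 2 * r * c') <= u * `|b' + 2 * r * c'| by rewrite ler_pM2l// ler_norm.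
have h2 : u ^+ 2 * c' <= u * `|c'|.
  apply: (@le_trans _ _ (u ^+ 2 * `|c'|)); first by rewrite ler_wpM2l ?sqr_ge0// ler_norm.
  by rewrite ler_wpM2r// expr2 ler_piMl// ltW.
move: uM; rewrite /M !mulrDr mulr1; lra.
Qed.

(** Where [Jf] at 0 vanishes on the line through phi in the direction [outer], [Jf] at e is
    negative, as it decreases in e with slope at most -mass. [quad_crossing] then yields, after
    normalisation, an admissible spinor whose lambda is at most -1 + e. *)
Lemma lambda1_supercritical nu (c : R) : 0 < nu < 1 -> 0 < c -> c * muR nu < - 2 ->
  lambda1 nu (c ^+ 2) = (-1)%:E.
Proof.
move=> nu01 c0 cm; have /andP[n0 n1] := nu01; set B := c ^+ 2.
apply/eqP; rewrite eq_le; apply/andP; split; last first.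
  apply: lambda1_ge => phi adm; exact: ltW (lambdaP n0 adm).1.
have [phi [tphi m0 en]] := energy_lt nu01 c0 cm; rewrite -/B in en.
have tout := test_outer.
have Jphi : Jf nu B 0 phi < 0 by rewrite Jf0//; lra.
have Jout : 0 < Jf nu B 0 outer.
  rewrite Jf0// energyE//.
  have : nu * pot outer <= mass outer.
    apply: le_trans pot_outer; rewrite ler_piMl ?pot_ge0//; exact: ltW.
  have : 0 <= kin B outer / nu by rewrite divr_ge0 ?kin_ge0// ltW.
  by have := mass_outer; lra.
apply/lee_addgt0Pr => e e0.
have [t [J0t Jet]] : exists t, 0 < Jf nu B 0 (lin t phi outer) /\ Jf nu B e (lin t phi outer) < 0.
  pose q d := Jf nu B d (lin 1 phi outer) - Jf nu B d phi - Jf nu B d outer.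
  have [|t [h1 h2]] := @quad_crossing _ (q 0) _ (Jf nu B e phi) (q e) (Jf nu B e outer) Jphi Jout.
    move=> t; rewrite -Jf_lin// -Jf_lin ?(ltW e0)// => Jt.
    have tl := test_lin t tphi tout.
    (* If the combination vanished, phi would be a multiple of [outer], on which [Jf] at 0 is
       nonnegative. *)
    have mt : 0 < mass (lin t phi outer).
      rewrite lt_def mass_ge0 andbT; apply/eqP => /(lin_mass0 tphi tout) E.
      move: Jphi; rewrite E Jf_cst// ltNge mulr_ge0 ?sqr_ge0//; exact: ltW.
    apply: le_lt_trans (Jf_decr n0 B tl (lexx 0) (ltW e0)) _.
    by rewrite Jt subr0 sub0r oppr_lt0 mulr_gt0.
  exists t; rewrite (Jf_lin n0 B (lexx 0) tphi tout t).
  by rewrite (Jf_lin n0 B (ltW e0) tphi tout t).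
have tl := test_lin t tphi tout; set psi := lin t phi outer in J0t Jet tl.
have mt : 0 < mass psi.
  rewrite lt_def mass_ge0 andbT; apply/eqP => m00.
  by move: Jet; rewrite ltNge sqn0_Jf// ltW.
pose k := (Num.sqrt (mass psi))^-1.
have k0 : 0 < k ^+ 2 by rewrite exprn_gt0// invr_gt0 sqrtr_gt0.
have adm : admissible nu B (smul (cst k) psi).
  apply/(admissibleP n0); split.
  - exact: test_smul (smooth_cst k) tl.
  - by rewrite mass_cst// exprVn sqr_sqrtr ?mulVf ?gt_eqF// ltW.
  - by rewrite Jf_cst// mulr_gt0.
have Je : Jf nu B e (smul (cst k) psi) <= 0.
  by rewrite Jf_cst ?(ltW e0)// pmulr_rle0// ltW.
have := lambda_le n0 adm (ltW e0) Je => le.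
apply: (@le_trans _ _ (lambda nu B (smul (cst k) psi))%:E).
  by apply: ereal_inf_lbound; exists (smul (cst k) psi).
by rewrite -EFinD lee_fin.
Qed.

End Supercritical.

(** * The critical field *)

Section Critical.
Variable R : realType.
Implicit Types (nu B : R).

Definition Bstar nu : R := 4 / muR nu ^+ 2.

Lemma Bstar_gt0 nu : 0 < nu < 1 -> 0 < Bstar nu.
Proof. by move=> /muR_lt0 m0; rewrite divr_gt0// exprn_even_gt0//= lt_eqF. Qed.

Lemma limf_einf_left_le (f : R -> \bar R) B (a : R) (l : \bar R) : a < B ->
  (forall b, a < b < B -> (f b <= l)%E) -> (limf_einf f (B^'-) <= l)%E.
Proof.
move=> aB fl; rewrite limf_einfE; apply: ge_ereal_sup => _ [V VB <-].
have : \forall b \near B^'-, V b /\ a < b < B.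
  near=> b; split; first by near: b.
  by apply/andP; split; near: b; [exact: nbhs_left_gt|exact: nbhs_left_lt].
move=> /filter_ex[b [Vb ab]]; apply: le_trans (fl b ab).
by apply: ereal_inf_lbound; exists b.
Unshelve. all: by end_near. Qed.

Lemma limf_einf_left_ge (f : R -> \bar R) B (a : R) (l : \bar R) : a < B ->
  (forall b, a < b < B -> (l <= f b)%E) -> (l <= limf_einf f (B^'-))%E.
Proof.
move=> aB fl; rewrite limf_einfE; apply: (@le_trans _ _ (ereal_inf (f @` `]a, B[))).
  by apply: le_ereal_inf_tmp => _ [b /= ab <-]; apply: fl; rewrite in_itv /= in ab.
apply: ereal_sup_ubound; exists `]a, B[%classic => //.
near=> b; rewrite /= in_itv /=.
by apply/andP; split; near: b; [exact: nbhs_left_gt|exact: nbhs_left_lt].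
Unshelve. all: by end_near. Qed.

Lemma lt_Bstar nu B : 0 < nu < 1 -> 0 < B -> (B < Bstar nu) = (- 2 < Num.sqrt B * muR nu).
Proof.
move=> /muR_lt0 m0 B0; have m2 : 0 < muR nu ^+ 2 by rewrite exprn_even_gt0//= lt_eqF.
rewrite /Bstar ltr_pdivlMr// ltrNl -mulrN -{1}(sqr_sqrtr (ltW B0)) -(sqrrN (muR nu)) -exprMn.
have -> : 4 = 2 ^+ 2 :> R by rewrite expr2 -natrM.
by rewrite ltr_pXn2r// nnegrE// mulr_ge0 ?sqrtr_ge0// oppr_ge0 ltW.
Qed.

Lemma gt_Bstar nu B : 0 < nu < 1 -> 0 < B -> (Bstar nu < B) = (Num.sqrt B * muR nu < - 2).
Proof.
move=> /muR_lt0 m0 B0; have m2 : 0 < muR nu ^+ 2 by rewrite exprn_even_gt0//= lt_eqF.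
rewrite /Bstar ltr_pdivrMr// ltrNr -mulrN -{1}(sqr_sqrtr (ltW B0)) -(sqrrN (muR nu)) -exprMn.
have -> : 4 = 2 ^+ 2 :> R by rewrite expr2 -natrM.
by rewrite ltr_pXn2r// nnegrE// mulr_ge0 ?sqrtr_ge0// oppr_ge0 ltW.
Qed.

(** Whether [Bstar nu] itself belongs to the set is never decided: every larger field does, because
    [lambda1] is -1 just below it, and no smaller field does, because [lambda1] stays away from -1
    below it. *)
Lemma Bcrit_Bstar nu : 0 < nu < 1 -> Bcrit nu = (Bstar nu)%:E.
Proof.
move=> nu01; have s0 := Bstar_gt0 nu01; have /andP[n0 n1] := nu01.
apply/eqP; rewrite eq_le; apply/andP; split.
- apply/lee_addgt0Pr => d d0; rewrite -EFinD; apply: ereal_inf_lbound.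
  exists (Bstar nu + d) => //; split; first by rewrite addr_gt0.
  have E b : Bstar nu < b < Bstar nu + d -> lambda1 nu b = (-1)%:E.
    move=> /andP[bs _]; have b0 := lt_trans s0 bs.
    rewrite -(sqr_sqrtr (ltW b0)); apply: lambda1_supercritical; rewrite ?sqrtr_gt0//.
    by rewrite -gt_Bstar.
  apply/eqP; rewrite eq_le (@limf_einf_left_le _ _ (Bstar nu)) ?ltrDl//=; last first.
    by move=> b /E ->.
  by apply: (@limf_einf_left_ge _ _ (Bstar nu)) => [|b /E ->]; rewrite ?ltrDl.
- apply: le_ereal_inf_tmp => _ [B [B0 HB] <-]; rewrite lee_fin leNgt; apply/negP.
  rewrite lt_Bstar// => Bm.
  have [|e e0 He] := lambda1_subcritical nu01 _ Bm; first by rewrite sqrtr_gt0.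
  have : ((-1 + e)%:E <= limf_einf (lambda1 nu) (B^'-))%E.
    apply: (@limf_einf_left_ge _ _ 0) => // b /andP[b0 bB].
    by rewrite -(sqr_sqrtr (ltW b0)) He ?sqrtr_gt0// ler_wsqrtr// ltW.
  by rewrite HB lee_fin gerDl leNgt e0.
Qed.

Lemma continuous_Bcrit nu : 0 < nu < 1 ->
  {for nu, continuous (fun t : R => fine (Bcrit t))}.
Proof.
move=> nu01; have /andP[n0 n1] := nu01.
have c : Bstar t @[t --> nu] --> Bstar nu.
  apply: cvgM; first exact: cvg_cst.
  apply: cvgV; first by rewrite sqrf_eq0 lt_eqF// muR_lt0.
  exact: (cvgM (continuous_muR nu01) (continuous_muR nu01)).
have E (t : R) : 0 < t < 1 -> fine (Bcrit t) = Bstar t by move=> ?; rewrite Bcrit_Bstar.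
have c' : fine (Bcrit t) @[t --> nu] --> Bstar nu.
  apply: cvg_trans c; apply: near_eq_cvg; near=> t; rewrite (E t)//.
  by apply/andP; split; near: t; [exact: lt_nbhsr|exact: lt_nbhsl].
by rewrite -(E nu nu01) in c'.
Unshelve. all: by end_near. Qed.

End Critical.

Theorem theorem1 (R : realType) :
  [/\ forall nu : R, 0 < nu < 1 ->
        [/\ mu nu \is a fin_num, (mu nu < 0)%E
          & Bcrit nu = (4 / fine (mu nu) ^+ 2)%:E],
      {within `]0, 1[, continuous (fun nu : R => fine (Bcrit nu))}
    & forall nu1 nu2 : R, 0 < nu1 -> nu1 < nu2 -> nu2 < 1 ->
        (Bcrit nu2 < Bcrit nu1)%E].
Proof.
split.
- move=> nu nu01; split; first exact: mu_fin_num.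
    by rewrite muRE// lte_fin muR_lt0.
  exact: Bcrit_Bstar.
- rewrite continuous_open_subspace; last exact: interval_open.
  by move=> nu; rewrite inE /= in_itv /= => nu01; exact: continuous_Bcrit.
- move=> nu1 nu2 n1 n12 n2.
  have h1 : 0 < nu1 < 1 by rewrite n1 (lt_trans n12).
  have h2 : 0 < nu2 < 1 by rewrite (lt_trans n1).
  rewrite !Bcrit_Bstar// lte_fin /Bstar ltr_pM2l//.
  have m1 := muR_lt0 h1; have m2 := muR_lt0 h2.
  have sq0 (m : R) : m < 0 -> 0 < m ^+ 2 by move=> ?; rewrite exprn_even_gt0//= lt_eqF.
  rewrite ltf_pV2 ?posrE ?sq0//.
  (* Both values are negative, so squaring reverses their order. *)
  rewrite -(sqrrN (muR nu1)) -(sqrrN (muR nu2)).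
  by rewrite ltr_pXn2r ?nnegrE ?oppr_ge0 ?ltW// ltrN2 muR_decr.
Qed.
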